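(* For every $r\in\mathbb{N}$ (with $d=d(r)\in\mathbb{N}$) let $(\xi_{k\ell})_{1\le k<\ell\le r}$ be i.i.d. copies of a $0/1$ random variable $\xi=\xi_r$ with $\mathbf{P}(\xi=1)=p_r\in(0,1]$. Let $(\mathbf{v}^{k\ell})_{1\le k<\ell\le r}$ be mutually independent random vectors in $\mathbb{R}^d$, independent of $(\xi_{k\ell})_{k<\ell}$, which are normalized and isotropic, $\mathbf{E}\,\mathbf{v}^{k\ell}\mathbf{v}^{k\ell\,T}=d^{-1}I_d$, have norms uniformly bounded in $r$ (there is $C_0>0$ with $\|\mathbf{v}^{k\ell}\|_2^2\le C_0$ for all $r$ and $k<\ell$), and are such that for all deterministic $d\times d$ matrices $D=D_d$ with $\|D\|_{op}=1$, $$\sup_{k<\ell}\mathbf{Var}(D\mathbf{v}^{k\ell},\mathbf{v}^{k\ell})=o(1),\quad d\to\infty.$$ Let $\mathcal{L}_{rd}$ be the $rd\times rd$ block matrix defined in the context. Suppose that $$d\to\infty\quad\text{and}\quad rp_r/d\to c\ge0\quad\text{as } r\to\infty.$$ Then, as $r\to\infty$, the empirical spectral distributions $N_{\mathcal{L}_{rd}}$ converge in probability to a non-random probability measure $N_{\mathcal{L}}$ with the density $$\rho(\lambda)=\frac{1}{4\pi\lambda}\sqrt{\big((c^+-\lambda)(\lambda-c^-)\big)_+},\qquad c^\pm=(\sqrt2\pm\sqrt c)^2.$$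
   Context: For $1\le k<\ell\le r$ put $B_{k\ell}=\xi_{k\ell}\mathbf{v}^{k\ell}\mathbf{v}^{k\ell\,T}$ (a $d\times d$ matrix) and $B_{\ell k}=B_{k\ell}$. With $\delta_{k\ell}$ the Kronecker delta, define the $rd\times rd$ block matrices, with $d\times d$ blocks, $$\mathcal{A}_{rd}=\big((1-\delta_{k\ell})B_{k\ell}\big)_{k,\ell=1}^r,\qquad \mathcal{L}_{rd}=\Big(\delta_{k\ell}\sum_{j\ne k}B_{j\ell}\Big)_{k,\ell=1}^r-\mathcal{A}_{rd}.$$ Equivalently $\mathcal{L}_{rd}=\sum_{1\le k<\ell\le r}\xi_{k\ell}Y^{k\ell}Y^{k\ell\,T}$, where $Y^{k\ell}=((\delta_{jk}-\delta_{j\ell})\mathbf{v}^{k\ell})_{j=1}^r\in\mathbb{R}^{rd}$. For a real symmetric $n\times n$ matrix $M$ with eigenvalues $(\lambda_i)_i$, its empirical spectral distribution is $N_M(\Delta)=|\{i:\lambda_i\in\Delta\}|/n$, $\Delta\subset\mathbb{R}$; convergence in probability of random measures is with respect to the weak topology. $x_+=\max(x,0)$; $\|\cdot\|_{op}$ is the operator norm, $\|\cdot\|_2$ the Euclidean norm and $(\cdot,\cdot)$ the Euclidean inner product; $\mathbf{P}$, $\mathbf{E}$, $\mathbf{Var}$ denote probability, expectation and variance.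
   Formalization: For c<2 the density ρ has total mass only c/2, so no probability measure has density ρ; the limit is proved to be max(1−c/2,0)·δ₀ + ρ(λ)dλ, which for c≥2 is the probability measure with density ρ as stated. *)

(* Defs.v *)
From HB Require Import structures.
From mathcomp Require Import all_boot all_order all_algebra.
From mathcomp Require Import all_classical all_reals all_analysis.

Set Implicit Arguments.
Unset Strict Implicit.
Unset Printing Implicit Defensive.

Import Order.TTheory GRing.Theory Num.Theory.
Import numFieldNormedType.Exports.

Local Open Scope classical_set_scope.
Local Open Scope ring_scope.

Section euclidean.
Context {R : realType}.

Definition dotv n (x y : 'cV[R]_n) : R := \sum_i x i 0 * y i 0.

Definition norm2 n (x : 'cV[R]_n) : R := Num.sqrt (dotv x x).

Definition opnorm n (D : 'M[R]_n) : R :=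
  sup [set norm2 (D *m x) | x in [set x : 'cV[R]_n | norm2 x <= 1]].

End euclidean.

Section independence.
Context {d : measure_display} {T : measurableType d} {R : realType}
        (P : probability T R).

Definition sigma_gen (I : Type) (D : set I) (f : I -> T -> R) : set (set T) :=
  <<s \bigcup_(i in D) preimage_set_system setT (f i) measurable >>.

Definition mutually_independent (I : finType) (D : {pred I})
    (F : I -> set (set T)) : Prop :=
  forall (J : {set I}) (A : I -> set T), {subset J <= D} ->
    (forall i, i \in J -> F i (A i)) ->
    P (\bigcap_(i in [set i | i \in J]) A i) = (\prod_(i in J) P (A i))%E.

Definition independent2 (F G : set (set T)) : Prop :=
  forall A B, F A -> G B -> P (A `&` B) = (P A * P B)%E.

End independence.

Section block_matrices.
Context {R : realType} (r d : nat).

Definition edge : {pred 'I_r * 'I_r} := [pred kl : 'I_r * 'I_r | (kl.1 < kl.2)%N].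

(* Only the entries of xi and v with k < l are meaningful.  The value at
   k = l is irrelevant: it never enters adjacency_mx or laplacian_mx. *)
Definition edge_block (xi : 'I_r -> 'I_r -> R) (v : 'I_r -> 'I_r -> 'cV[R]_d)
    (k l : 'I_r) : 'M[R]_d :=
  if (k < l)%N then xi k l *: (v k l *m (v k l)^T)
  else xi l k *: (v l k *m (v l k)^T).

Definition adjacency_mx xi v : 'M[R]_(\sum_(k < r) d) :=
  mxblock (fun k l : 'I_r => (1 - (k == l)%:R) *: edge_block xi v k l).

Definition laplacian_mx xi v : 'M[R]_(\sum_(k < r) d) :=
  mxblock (fun k l : 'I_r =>
    (k == l)%:R *: \sum_(j < r | j != k) edge_block xi v j l)
  - adjacency_mx xi v.

End block_matrices.

Section empirical_spectral_distribution.
Context {R : realType}.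

(* The eigenvalues listed with multiplicity, when M has all of them in R (as
   a symmetric matrix does); the list is determined up to permutation. *)
Definition eigenvalues n (M : 'M[R]_n) : seq R :=
  xget [::] [set s : seq R | char_poly M = \prod_(x <- s) ('X - x%:P)].

Definition esd n (M : 'M[R]_n) : {measure set (measurableTypeR R) -> \bar R} :=
  mscale (n%:R^-1)%:nng
    (msum (fun i => \d_((eigenvalues M)`_i : measurableTypeR R)) n).

Lemma esdE n (M : 'M[R]_n) (A : set R) :
  esd M A =
  (#|[set i : 'I_n | (eigenvalues M)`_i \in A]%SET|%:R / n%:R)%:E.
Proof.
rewrite mulrC EFinM; congr (_ * _)%E.
transitivity (\sum_(i < n) (((eigenvalues M)`_i \in A)%:R)%:E : \bar R)%E.
  by apply: eq_bigr => i _; rewrite /= diracE.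
rewrite sumEFin; congr (_%:E).
rewrite -sum1_card natr_sum [RHS]big_mkcond /=; apply: eq_bigr => i _.
by rewrite inE; case: (_ \in A).
Qed.

End empirical_spectral_distribution.

Definition cvg_in_probability_weakly (R : realType)
    (disp : nat -> measure_display) (T : forall r, measurableType (disp r))
    (P : forall r, probability (T r) R)
    (N : forall r, T r -> {measure set (measurableTypeR R) -> \bar R})
    (mu : {measure set (measurableTypeR R) -> \bar R}) : Prop :=
  forall f : R -> R, continuous f -> (exists C, forall x, `|f x| <= C) ->
  forall e : R, 0 < e ->
    P r [set w | e < `| \int[N r w]_x f x - \int[mu]_x f x |]
      @[r --> \oo] --> 0%E.

Section limit_density.
Context {R : realType} (c : R).

Definition cplus : R := (Num.sqrt 2 + Num.sqrt c) ^+ 2.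
Definition cminus : R := (Num.sqrt 2 - Num.sqrt c) ^+ 2.

(* The total mass of rho is min(1, c / 2); for c < 2 the limiting law also has
   an atom of mass 1 - c / 2 at 0, the kernel of the Laplacian. *)
Definition rho (x : R) : R :=
  (4 * pi * x)^-1 * Num.sqrt (Num.max ((cplus - x) * (x - cminus)) 0).

End limit_density.

(* Main.v *)
(* For x > 0 let G = (L + x)^-1 and let g_k be the normalized trace of the k-th
   diagonal d x d block of G; the mean of the g_k is the Stieltjes transform of
   the spectral distribution at -x.  Taking the trace of the k-th diagonal block
   of (L + x) G = 1 and removing the edges at k one at a time by the
   Sherman-Morrison formula gives
     x g_k + (1/d) sum_{l != k} xi_kl A_kl / (1 + B_kl) = 1,
   where A_kl and B_kl are quadratic forms in v^kl whose coefficients depend only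
   on the other edges.  By isotropy and the variance hypothesis they concentrate
   around g_k and g_k + g_l, so that the residuals
     R_k = x g_k + (p/d) sum_l g_k / (1 + g_k + g_l) - 1
   are small in mean square.  As t |-> x t + (p/d) sum_l t / (1 + t + g_l) has
   slope at least x, small residuals force the g_k to be close to each other, and
   their mean to be close to the nonnegative root t of x t + c t / (1 + 2 t) = 1,
   which is the integral of 1 / (l + x) against the limit law.  Knowing this for
   all x > 0 suffices: by partial fractions the kernels 1 / (l + x) generate the
   polynomials in 1 / (1 + l), which are uniformly dense.  All convergences are
   in L^1, and Markov's inequality turns them into convergence in probability. *)

Require Import Defs.
From HB Require Import structures.
From mathcomp Require Import all_boot all_order all_algebra.
From mathcomp Require Import complex.
From mathcomp Require Import ring lra.
From mathcomp Require Import all_classical all_reals all_analysis measurable_realfun.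
Import Order.TTheory GRing.Theory Num.Theory.
Import numFieldNormedType.Exports.
Local Open Scope classical_set_scope.
Local Open Scope ring_scope.

Set Implicit Arguments.
Unset Strict Implicit.
Unset Printing Implicit Defensive.

(** No concentration is proved for the random [g_k] themselves. Instead [E R_k^2] is expanded in one
    of its two factors only: it becomes a sum over the edges at [k], and in each summand the other
    factor [R_k] is replaced by its value after deleting that edge, at cost O(1/d). The leading part
    is then [p - xi] times a function of the other edges and has mean zero. What remains are
    fluctuations of quadratic forms and cross traces of the blocks [(k, l)]; the squares of the
    latter sum over [k] to at most [x^-2], so a typical one has order [r^(-1/2)]. Every error must
    keep a factor [p], because [r p / d] is bounded while [r / d] need not be. Three obstacles shape
    the rest. The matrices in the quadratic forms are random, but the variance hypothesis speaks of
    one deterministic matrix per dimension, so a uniform version has to be extracted. The norm bound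
    holds almost surely only, so the vectors are truncated. Stieltjes kernels vanish at infinity, so
    bounded continuous functions need tightness; it comes from the compact support of the limit
    law. *)

Lemma le_of_eq disp (T : porderType disp) (x y : T) : x = y -> (x <= y)%O.
Proof. by move=> ->. Qed.

(* [x^-1] is the pointwise limit of the continuous functions
   [x / (x ^+ 2 + n.+1%:R^-1)], also at the junk value [0^-1 = 0]. *)
Lemma measurable_invr (R : realType) : measurable_fun [set: R] (@GRing.inv R).
Proof.
apply: (@measurable_fun_cvg _ _ _ setT
  (fun (n : nat) (x : R) => x * (x ^+ 2 + n.+1%:R^-1)^-1)) => // [n|x _].
  apply: continuous_measurable_fun => x; apply: cvgM; first exact: cvg_id.
  apply: cvgV; first by rewrite gt_eqF // ltr_wpDl ?sqr_ge0 // invr_gt0.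
  by apply: cvgD; [exact: exprn_continuous|exact: cvg_cst].
have [->|x0] := eqVneq x 0.
  rewrite invr0 [X in X @ _ --> _](_ : _ = cst 0); first exact: cvg_cst.
  by apply/funext => n; rewrite mul0r.
have -> : x^-1 = x * (x ^+ 2 + 0)^-1.
  by rewrite addr0 expr2 invfM mulrA mulfV ?mul1r.
apply: cvgMr; apply: cvgV; first by rewrite addr0 sqrf_eq0.
by apply: cvgD; [exact: cvg_cst|exact: cvg_harmonic].
Qed.

Lemma measurable_funV d (T : measurableType d) (R : realType) (D : set T) (f : T -> R) :
  measurable_fun D f -> measurable_fun D (fun x => (f x)^-1).
Proof. by move=> mf; apply: measurableT_comp mf; exact: measurable_invr. Qed.

(** * Positive semidefinite matrices and resolvents *)

Section dot_product.
Context {R : realType}.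
Implicit Types n : nat.

Lemma dotvE n (u w : 'cV[R]_n) : dotv u w = (u^T *m w) 0 0.
Proof. by rewrite mxE; apply: eq_bigr => i _; rewrite mxE. Qed.

Lemma dotvC n (u w : 'cV[R]_n) : dotv u w = dotv w u.
Proof. by apply: eq_bigr => i _; rewrite mulrC. Qed.

Lemma dotvDl n (u1 u2 w : 'cV[R]_n) : dotv (u1 + u2) w = dotv u1 w + dotv u2 w.
Proof. by rewrite /dotv -big_split; apply: eq_bigr => i _; rewrite mxE mulrDl. Qed.

Lemma dotvZl n a (u w : 'cV[R]_n) : dotv (a *: u) w = a * dotv u w.
Proof. by rewrite /dotv mulr_sumr; apply: eq_bigr => i _; rewrite mxE mulrA. Qed.

Lemma dotvNl n (u w : 'cV[R]_n) : dotv (- u) w = - dotv u w.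
Proof. by rewrite -scaleN1r dotvZl mulN1r. Qed.

Lemma dotvDr n (u w1 w2 : 'cV[R]_n) : dotv u (w1 + w2) = dotv u w1 + dotv u w2.
Proof. by rewrite dotvC dotvDl !(dotvC u). Qed.

Lemma dotvZr n a (u w : 'cV[R]_n) : dotv u (a *: w) = a * dotv u w.
Proof. by rewrite dotvC dotvZl dotvC. Qed.

Lemma dotvNr n (u w : 'cV[R]_n) : dotv u (- w) = - dotv u w.
Proof. by rewrite dotvC dotvNl dotvC. Qed.

Lemma dotv0r n (u : 'cV[R]_n) : dotv u 0 = 0.
Proof. by rewrite -(scale0r 0) dotvZr mul0r. Qed.

Lemma dotv_suml n (I : Type) (s : seq I) (Q : pred I) (F : I -> 'cV[R]_n) w :
  dotv (\sum_(i <- s | Q i) F i) w = \sum_(i <- s | Q i) dotv (F i) w.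
Proof.
elim/big_ind2: _ => // [|_ a _ b <- <-]; last by rewrite dotvDl.
by rewrite dotvC dotv0r.
Qed.

Lemma dotv_ge0 n (u : 'cV[R]_n) : 0 <= dotv u u.
Proof. by apply: sumr_ge0 => i _; exact: sqr_ge0. Qed.

Lemma dotv_eq0 n (u : 'cV[R]_n) : dotv u u = 0 -> u = 0.
Proof.
move=> /eqP; rewrite psumr_eq0 => [/allP u0|i _]; last exact: sqr_ge0.
apply/colP => i; rewrite mxE.
by have /(_ (mem_index_enum _)) := u0 i; rewrite mulf_eq0 orbb => /eqP.
Qed.

Lemma dotv_mulmx m n (A : 'M[R]_(m, n)) u w : dotv (A *m u) w = dotv u (A^T *m w).
Proof. by rewrite !dotvE trmx_mul -mulmxA. Qed.

Lemma dotv_CS n (u w : 'cV[R]_n) : dotv u w ^+ 2 <= dotv u u * dotv w w.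
Proof.
have [w0|w0] := eqVneq (dotv w w) 0.
  by rewrite (dotv_eq0 w0) !dotv0r expr0n mulr0.
have wgt0 : 0 < dotv w w by rewrite lt0r w0 dotv_ge0.
(* This is [dotv w w] times the component of [u] orthogonal to [w]; its squared norm is
   [c * (a * c - b ^+ 2)]. *)
have := dotv_ge0 (dotv w w *: u - dotv u w *: w).
rewrite !(dotvDl, dotvDr, dotvNl, dotvNr, dotvZl, dotvZr) (dotvC w u).
set a := dotv u u; set b := dotv u w; set c := dotv w w => h.
have {h} : 0 <= c * (a * c - b ^+ 2) by apply: le_trans h _; apply: le_of_eq; ring.
by rewrite pmulr_rge0 // subr_ge0.
Qed.

Lemma norm2_sqr n (u : 'cV[R]_n) : norm2 u ^+ 2 = dotv u u.
Proof. by rewrite sqr_sqrtr // dotv_ge0. Qed.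

Lemma norm_dotv_le n (u w : 'cV[R]_n) : `|dotv u w| <= norm2 u * norm2 w.
Proof.
rewrite -sqrtrM ?dotv_ge0 // -sqrtr_sqr ler_sqrt; first exact: dotv_CS.
by rewrite mulr_ge0 ?dotv_ge0.
Qed.

Lemma norm2_ge0 n (u : 'cV[R]_n) : 0 <= norm2 u.
Proof. exact: sqrtr_ge0. Qed.

Lemma norm2Z n a (u : 'cV[R]_n) : norm2 (a *: u) = `|a| * norm2 u.
Proof. by rewrite /norm2 dotvZl dotvZr mulrA sqrtrM ?sqr_ge0 // -expr2 sqrtr_sqr. Qed.

Lemma norm2D n (u w : 'cV[R]_n) : norm2 (u + w) <= norm2 u + norm2 w.
Proof.
rewrite -(@ler_pXn2r _ 2) ?nnegrE ?addr_ge0 ?norm2_ge0 //.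
rewrite sqrrD !norm2_sqr !(dotvDl, dotvDr) (dotvC w u).
have := norm_dotv_le u w; rewrite ler_norml => /andP[_ h].
lra.
Qed.

Lemma norm2N n (u : 'cV[R]_n) : norm2 (- u) = norm2 u.
Proof. by rewrite /norm2 dotvNl dotvNr opprK. Qed.

Lemma norm2B n (u w : 'cV[R]_n) : norm2 (u - w) <= norm2 u + norm2 w.
Proof. by rewrite -(norm2N w) norm2D. Qed.

Lemma dotv_delta n (u : 'cV[R]_n) i : dotv (delta_mx i 0) u = u i 0.
Proof.
rewrite /dotv (bigD1 i) //= !mxE !eqxx mul1r big1 ?addr0 // => j ji.
by rewrite mxE (negPf ji) mul0r.
Qed.

End dot_product.

Section resolvent.
Context {R : realType} {n : nat}.
Implicit Types (A : 'M[R]_n) (u w : 'cV[R]_n) (x : R).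

(** Over the reals a nonnegative quadratic form does not force symmetry, so symmetry is a separate
    conjunct. *)
Definition psdmx A := A^T = A /\ forall u, 0 <= dotv u (A *m u).

Definition resolvent x A : 'M[R]_n := invmx (A + x%:M).

Lemma psdmx0 : psdmx 0.
Proof. by split=> [|u]; rewrite ?trmx0 // mul0mx dotv0r. Qed.

Lemma psdmxD A B : psdmx A -> psdmx B -> psdmx (A + B).
Proof.
move=> [sA pA] [sB pB]; split=> [|u]; first by rewrite linearD /= sA sB.
by rewrite mulmxDl dotvDr addr_ge0.
Qed.

Lemma psdmx_dyad u : psdmx (u *m u^T).
Proof.
split=> [|w]; first by rewrite trmx_mul trmxK.
by rewrite -mulmxA dotvC dotv_mulmx dotv_ge0.
Qed.

Lemma psdmx_sum (I : Type) (s : seq I) (Q : pred I) (F : I -> 'M[R]_n) :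
  (forall i, Q i -> psdmx (F i)) -> psdmx (\sum_(i <- s | Q i) F i).
Proof. by move=> pF; apply: (big_ind psdmx) => //; [exact: psdmx0|exact: psdmxD]. Qed.

Section positive.
Variables (A : 'M[R]_n) (x : R).
Hypotheses (pA : psdmx A) (x0 : 0 < x).

(** A kernel vector [u] would satisfy [(u, A u) + x (u, u) = 0], a sum of two nonnegative terms with
    [x > 0]. *)
Lemma unitmx_shift : A + x%:M \in unitmx.
Proof.
case: pA => sA pA'; rewrite -row_free_unit -kermx_eq0; apply/eqP/row_matrixP => i.
rewrite row0; set u := row i _.
have uA : u *m (A + x%:M) = 0 by rewrite /u -row_mul mulmx_ker row0.
have {}uA : (A + x%:M) *m u^T = 0.
  by rewrite -[_ + _]trmxK -trmx_mul linearD /= sA tr_scalar_mx uA trmx0.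
have : dotv u^T ((A + x%:M) *m u^T) = 0 by rewrite uA dotv0r.
rewrite mulmxDl mul_scalar_mx dotvDr dotvZr => /eqP.
rewrite paddr_eq0 ?pA' ?mulr_ge0 ?dotv_ge0 ?ltW // mulf_eq0 (gt_eqF x0) /=.
by case/andP=> _ /eqP/dotv_eq0 /(congr1 trmx); rewrite trmxK trmx0.
Qed.

Notation G := (resolvent x A).

Lemma mulmx_resolvent : (A + x%:M) *m G = 1%:M.
Proof. exact: mulmxV unitmx_shift. Qed.

Lemma mul_resolventmx : G *m (A + x%:M) = 1%:M.
Proof. exact: mulVmx unitmx_shift. Qed.

Lemma trmx_resolvent : G^T = G.
Proof. by rewrite /resolvent trmx_inv linearD /= tr_scalar_mx pA.1. Qed.

(** Substitute [(A + x) G u] for [u]. Both summands are nonnegative, and the bounds on the resolvent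
    below are read off from this identity. *)
Lemma dotv_resolvent u :
  dotv u (G *m u) = dotv (G *m u) (A *m (G *m u)) + x * dotv (G *m u) (G *m u).
Proof.
rewrite -dotvZr -dotvDr -mul_scalar_mx -mulmxDl [in RHS]mulmxA mulmx_resolvent.
by rewrite mul1mx dotvC.
Qed.

Lemma resolvent_sqr_le u : x * dotv (G *m u) (G *m u) <= dotv u (G *m u).
Proof. by rewrite dotv_resolvent lerDr pA.2. Qed.

Lemma resolvent_ge0 u : 0 <= dotv u (G *m u).
Proof. by rewrite dotv_resolvent addr_ge0 ?pA.2 // mulr_ge0 ?dotv_ge0 // ltW. Qed.

(** From [x |G u|^2 <= (u, G u) <= |u| |G u|] one factor [|G u|] cancels; the case where it vanishes
    is apart. *)
Lemma norm2_resolvent u : norm2 (G *m u) <= norm2 u / x.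
Proof.
rewrite ler_pdivlMr //; have := norm2_ge0 (G *m u); rewrite le0r.
case/orP=> [/eqP->|g0]; first by rewrite mul0r norm2_ge0.
rewrite -(ler_pM2l g0) mulrA -expr2 norm2_sqr mulrC.
rewrite (le_trans (resolvent_sqr_le u)) // (le_trans (ler_norm _)) //.
by rewrite dotvC norm_dotv_le.
Qed.

Lemma resolvent_le u : dotv u (G *m u) <= dotv u u / x.
Proof.
rewrite (le_trans (ler_norm _)) // (le_trans (norm_dotv_le _ _)) //.
by rewrite -norm2_sqr expr2 -mulrA ler_wpM2l ?norm2_ge0 ?norm2_resolvent.
Qed.

End positive.

Section rank_one.
Variables (A : 'M[R]_n) (x : R) (y : 'cV[R]_n).
Hypotheses (pA : psdmx A) (x0 : 0 < x).
Notation G := (resolvent x (A + y *m y^T)).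
Notation G' := (resolvent x A).
Let pAy : psdmx (A + y *m y^T) := psdmxD pA (psdmx_dyad y).

Lemma resolvent_sub : G' - G = G *m (y *m y^T) *m G'.
Proof.
have {3}-> : y *m y^T = (A + y *m y^T + x%:M) - (A + x%:M).
  by rewrite opprD addrACA subrr addr0 addrAC subrr add0r.
rewrite mulmxBr mulmxBl mul_resolventmx // mul1mx -mulmxA mulmx_resolvent //.
by rewrite mulmx1.
Qed.

Lemma resolvent_rank_one : (1 + dotv y (G' *m y)) *: (G *m y) = G' *m y.
Proof.
apply/eqP; rewrite -subr_eq0 -opprB oppr_eq0 scalerDl scale1r opprD addrA.
rewrite -mulmxBl resolvent_sub subr_eq0; apply/eqP.
rewrite -!mulmxA (mx11_scalar (y^T *m _)) -dotvE mul_mx_scalar.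
by rewrite -scalemxAr.
Qed.

Lemma resolvent_rank_oneE : G *m y = (1 + dotv y (G' *m y))^-1 *: (G' *m y).
Proof.
by rewrite -{2}resolvent_rank_one scalerA mulVf ?scale1r // gt_eqF // ltr_pwDl // resolvent_ge0.
Qed.

(** Symmetry of [G'] turns the Sherman-Morrison correction into a positive multiple of a dyad. Hence
    adding an edge lowers every diagonal block trace, and the change is governed by the single
    vector [G' *m y]. *)
Lemma resolvent_subE :
  G' - G = (1 + dotv y (G' *m y))^-1 *: ((G' *m y) *m (G' *m y)^T).
Proof.
rewrite resolvent_sub mulmxA resolvent_rank_oneE -scalemxAl -scalemxAl.
by rewrite [in RHS]trmx_mul trmx_resolvent // mulmxA.
Qed.

End rank_one.

End resolvent.

(** * Block traces of the resolvent *)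

(** Lagrange's identity: [\sum_i \sum_j (F i - F j) ^+ 2] is twice the difference of the two
    sides. *)
Lemma sqr_sum_le (R : realFieldType) (I : finType) (F : I -> R) :
  (\sum_i F i) ^+ 2 <= #|I|%:R * \sum_i F i ^+ 2.
Proof.
have h : 0 <= \sum_i \sum_j (F i - F j) ^+ 2.
  by apply: sumr_ge0 => i _; apply: sumr_ge0 => j _; exact: sqr_ge0.
have E : \sum_i \sum_j (F i - F j) ^+ 2 =
    #|I|%:R * (\sum_i F i ^+ 2) *+ 2 - (\sum_i F i) ^+ 2 *+ 2.
  pose S := \sum_i F i; pose Q := \sum_i F i ^+ 2.
  transitivity (\sum_i (#|I|%:R * F i ^+ 2 - 2 * S * F i + Q)).
    apply: eq_bigr => i _; transitivity (\sum_j (F i ^+ 2 - 2 * F i * F j + F j ^+ 2)).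
      by apply: eq_bigr => j _; ring.
    rewrite !big_split /= sumrN sumr_const -(mulr_natl (F i ^+ 2)) -mulr_sumr -/S -/Q; ring.
  rewrite !big_split /= sumrN sumr_const -(mulr_natl Q) -!mulr_sumr -/S -/Q; ring.
by move: h; rewrite E -mulrnBl pmulrn_lge0 ?subr_ge0.
Qed.

Section block_system.
Context {R : realType} (n r d : nat) (E : 'I_r -> 'M[R]_(n, d)).
Hypothesis E_orth : forall k l, (E k)^T *m E l = (k == l)%:R%:M.
Hypothesis E_full : \sum_k E k *m (E k)^T = 1%:M.
Hypothesis d0 : (0 < d)%N.
Implicit Types (G : 'M[R]_n) (k l : 'I_r).

Let E_orth1 k : (E k)^T *m E k = 1%:M.
Proof. by rewrite E_orth eqxx. Qed.

Let E_orth0 k l : k != l -> (E k)^T *m E l = 0.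
Proof. by move=> kl; rewrite E_orth (negPf kl) raddf0. Qed.

Lemma norm2_emb k (u : 'cV[R]_d) : norm2 (E k *m u) = norm2 u.
Proof. by rewrite /norm2 dotv_mulmx mulmxA E_orth eqxx mul1mx. Qed.

Lemma sum_dotv_coemb (w : 'cV[R]_n) :
  \sum_k dotv ((E k)^T *m w) ((E k)^T *m w) = dotv w w.
Proof.
under eq_bigr do rewrite dotv_mulmx trmxK dotvC mulmxA.
by rewrite -dotv_suml -mulmx_suml E_full mul1mx.
Qed.

Lemma dotv_coemb_le k (w : 'cV[R]_n) :
  dotv ((E k)^T *m w) ((E k)^T *m w) <= dotv w w.
Proof.
rewrite -[leRHS]sum_dotv_coemb (bigD1 k) //= lerDl.
by apply: sumr_ge0 => i _; exact: dotv_ge0.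
Qed.

Lemma norm2_coemb k (w : 'cV[R]_n) : norm2 ((E k)^T *m w) <= norm2 w.
Proof. by rewrite ler_sqrt ?dotv_ge0 // dotv_coemb_le. Qed.

(** The [E k] are isometric embeddings of the copies of R^d; keeping them abstract hides the
    concrete shape of block matrices from all estimates. The traces [btr G k k] are the [g_k]; those
    with [k != l] are error terms. *)
Definition blk G k l : 'M[R]_d := (E k)^T *m G *m E l.
Definition btr G k l : R := \tr (blk G k l) / d%:R.

Lemma blkB G H k l : blk (G - H) k l = blk G k l - blk H k l.
Proof. by rewrite /blk mulmxBr mulmxBl. Qed.

Lemma btrB G H k l : btr (G - H) k l = btr G k l - btr H k l.
Proof. by rewrite /btr blkB linearB /= mulrBl. Qed.

Lemma btrZ a G k l : btr (a *: G) k l = a * btr G k l.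
Proof. by rewrite /btr /blk -scalemxAr -scalemxAl linearZ /= mulrA. Qed.

Lemma btr_dyad (s : 'cV[R]_n) k l :
  btr (s *m s^T) k l = dotv ((E k)^T *m s) ((E l)^T *m s) / d%:R.
Proof.
rewrite /btr /blk -!mulmxA mulmxA.
have -> : s^T *m E l = ((E l)^T *m s)^T by rewrite trmx_mul trmxK.
by rewrite mxtrace_mulC dotvC dotvE /mxtrace big_ord1.
Qed.

Lemma btr_sum G k l :
  btr G k l = (\sum_i dotv (E k *m delta_mx i 0) (G *m (E l *m delta_mx i 0))) / d%:R.
Proof.
congr (_ / _); apply: eq_bigr => i _.
by rewrite dotv_mulmx dotv_delta !mulmxA -colE [RHS]mxE.
Qed.

Lemma sum_btr G : \sum_k btr G k k = \tr G / d%:R.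
Proof.
rewrite -mulr_suml; congr (_ / _).
under eq_bigr do rewrite mxtrace_mulC mulmxA.
rewrite -linear_sum /=; rewrite -mulmx_suml E_full mul1mx //.
Qed.

Lemma norm2_delta i : norm2 (delta_mx i 0 : 'cV[R]_d) = 1.
Proof. by rewrite /norm2 dotv_delta mxE !eqxx sqrtr1. Qed.

Let dR0 : 0 < d%:R :> R.
Proof. by rewrite ltr0n. Qed.

Lemma average_bound (F : 'I_d -> R) C :
  (forall i, F i <= C) -> (\sum_i F i) / d%:R <= C.
Proof.
move=> FC; rewrite ler_pdivrMr // mulr_natr -[X in _ *+ X]card_ord -sumr_const.
by apply: ler_sum => i _; exact: FC.
Qed.

Section resolvent_blocks.
Variables (A : 'M[R]_n) (x : R).
Hypotheses (pA : psdmx A) (x0 : 0 < x).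
Notation G := (resolvent x A).

Lemma btr_ge0 k : 0 <= btr G k k.
Proof.
rewrite btr_sum mulr_ge0 ?invr_ge0 ?ler0n //.
by apply: sumr_ge0 => i _; exact: resolvent_ge0.
Qed.

Lemma btr_le k : btr G k k <= x^-1.
Proof.
rewrite btr_sum; apply: average_bound => i.
rewrite (le_trans (resolvent_le pA x0 _)) //.
by rewrite -norm2_sqr norm2_emb norm2_delta expr1n mul1r.
Qed.

(** By Cauchy-Schwarz over the [d] coordinates each square is at most an average of squared norms of
    block [k] of [G (E l e_i)], and these blocks add up to the whole vector. As the bound does not
    grow with [r], off-diagonal traces are negligible on average. *)
Lemma sum_btr_sqr l : \sum_k btr G k l ^+ 2 <= x^-1 ^+ 2.
Proof.
have step k : btr G k l ^+ 2 <= (\sum_i dotv ((E k)^T *m (G *m (E l *m delta_mx i 0)))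
    ((E k)^T *m (G *m (E l *m delta_mx i 0)))) / d%:R.
  rewrite btr_sum exprMn expr2 mulrA -expr2 ler_pM2r ?invr_gt0 //.
  rewrite ler_pdivrMr // mulrC.
  apply: le_trans (sqr_sum_le _) _; rewrite card_ord ler_pM2l //.
  apply: ler_sum => i _; rewrite dotv_mulmx; apply: le_trans (dotv_CS _ _) _.
  by rewrite -norm2_sqr norm2_delta expr1n mul1r.
apply: le_trans (ler_sum _ (fun k _ => step k)) _.
rewrite -mulr_suml exchange_big /=; apply: average_bound => i.
rewrite sum_dotv_coemb -norm2_sqr ler_pXn2r ?nnegrE ?norm2_ge0 ?invr_ge0 ?(ltW x0) //.
by rewrite (le_trans (norm2_resolvent pA x0 _)) // norm2_emb norm2_delta mul1r.
Qed.

Lemma norm2_blk k l (u : 'cV[R]_d) : norm2 (blk G k l *m u) <= norm2 u / x.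
Proof.
rewrite /blk -!mulmxA (le_trans (norm2_coemb _ _)) //.
by rewrite (le_trans (norm2_resolvent pA x0 _)) // norm2_emb.
Qed.

End resolvent_blocks.

Section rank_one_blocks.
Variables (A : 'M[R]_n) (x : R) (y : 'cV[R]_n).
Hypotheses (pA : psdmx A) (x0 : 0 < x).
Notation G := (resolvent x (A + y *m y^T)).
Notation G' := (resolvent x A).
Notation s := (G' *m y).
Notation B := (dotv y (G' *m y)).

Let B0 : 0 <= B := resolvent_ge0 pA x0 y.

Lemma btr_rank_one k l :
  btr G' k l - btr G k l =
  (1 + B)^-1 * (dotv ((E k)^T *m s) ((E l)^T *m s) / d%:R).
Proof. by rewrite -btrB resolvent_subE // btrZ btr_dyad. Qed.

(** With [s = G' y] one has [x |s|^2 <= B], and [B / (1 + B) <= 1]. The bound is therefore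
    independent of the length of [y]. *)
Lemma rank_one_weight : (1 + B)^-1 * (dotv s s / d%:R) <= (x * d%:R)^-1.
Proof.
have h : dotv s s <= B / x by rewrite ler_pdivlMr // mulrC resolvent_sqr_le.
rewrite invfM mulrA ler_pM2r ?invr_gt0 // mulrC ler_pdivrMr ?ltr_pwDl //.
by rewrite (le_trans h) // mulrC ler_pM2l ?invr_gt0 // lerDr.
Qed.

Let w0 : 0 <= (1 + B)^-1.
Proof. by rewrite invr_ge0 addr_ge0. Qed.

Lemma btr_rank_one_ge0 k : 0 <= btr G' k k - btr G k k.
Proof. by rewrite btr_rank_one mulr_ge0 // mulr_ge0 ?dotv_ge0 // invr_ge0 ltW. Qed.

Lemma sum_btr_rank_one : \sum_k (btr G' k k - btr G k k) <= (x * d%:R)^-1.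
Proof.
under eq_bigr do rewrite btr_rank_one.
by rewrite -mulr_sumr -mulr_suml sum_dotv_coemb rank_one_weight.
Qed.

Lemma btr_rank_one_norm k l : `|btr G' k l - btr G k l| <= (x * d%:R)^-1.
Proof.
rewrite btr_rank_one; apply: le_trans rank_one_weight.
rewrite !normrM !(@ger0_norm _ _^-1) // ?invr_ge0 ?ler0n //.
rewrite ler_wpM2l // ler_pM2r ?invr_gt0 // (le_trans (norm_dotv_le _ _)) //.
by rewrite -norm2_sqr expr2 ler_pM ?norm2_ge0 ?norm2_coemb.
Qed.

End rank_one_blocks.

Section laplacian.
Variables (y : 'I_r * 'I_r -> 'cV[R]_d) (x : R).
Hypothesis x0 : 0 < x.
Implicit Types e : 'I_r * 'I_r.

Definition edge_vec e : 'cV[R]_n := (E e.1 - E e.2) *m y e.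
Definition edge_dyad e : 'M[R]_n := edge_vec e *m (edge_vec e)^T.
Definition lap : 'M[R]_n := \sum_(e : 'I_r * 'I_r | (e.1 < e.2)%N) edge_dyad e.
Definition lap_del e0 : 'M[R]_n :=
  \sum_(e : 'I_r * 'I_r | (e.1 < e.2)%N && (e != e0)) edge_dyad e.

Lemma lapD e0 : (e0.1 < e0.2)%N -> lap = lap_del e0 + edge_dyad e0.
Proof. by move=> e0lt; rewrite /lap (bigD1 e0) //= addrC. Qed.

Lemma psdmx_lap : psdmx lap.
Proof. by apply: psdmx_sum => e _; exact: psdmx_dyad. Qed.

Lemma psdmx_lap_del e0 : psdmx (lap_del e0).
Proof. by apply: psdmx_sum => e _; exact: psdmx_dyad. Qed.

(** Edges are pairs with increasing entries; [srt k l] is the edge between [k] and [l], whichever is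
    larger, so that sums over the neighbours of [k] can be written uniformly. *)
Definition srt k l : 'I_r * 'I_r := if (k < l)%N then (k, l) else (l, k).

Lemma srt_lt k l : l != k -> ((srt k l).1 < (srt k l).2)%N.
Proof.
rewrite -val_eqE neq_ltn /srt => /orP[lk|kl]; last by rewrite kl.
by rewrite (ltnNge k l) (ltnW lk).
Qed.

Lemma sum_incident k (F : 'I_r * 'I_r -> R) :
  (forall e, (e.1 < e.2)%N -> e.1 != k -> e.2 != k -> F e = 0) ->
  \sum_(e : 'I_r * 'I_r | (e.1 < e.2)%N) F e = \sum_(l | l != k) F (srt k l).
Proof.
move=> F0.
rewrite (bigID (fun e : 'I_r * 'I_r => e.1 == k)) /= [X in _ + X](bigID (fun e : 'I_r * 'I_r => e.2 == k)) /=.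
rewrite [X in _ + (_ + X)]big1 ?addr0; last by move=> e /andP[/andP[? ?] ?]; exact: F0.
rewrite [RHS](bigID (fun l : 'I_r => (k < l)%N)) /=; congr (_ + _).
- rewrite (reindex_onto (fun l => (k, l)) snd) /=; last first.
    by case=> a b /= /andP[_ /eqP ->].
  apply: eq_big => [l|l /andP[/andP[kl _] _]]; last by rewrite /srt kl.
  rewrite !eqxx !andbT; case: ltnP => kl; rewrite ?andbF //= andbT.
  by apply/esym; apply: contraTneq kl => ->; rewrite ltnn.
- rewrite (reindex_onto (fun l => (l, k)) fst) /=; last first.
    by case=> a b /= /andP[_ /eqP ->].
  apply: eq_big => [l|l /andP[/andP[/andP[lk _] _] _]]; last first.
    by rewrite /srt ltnNge (ltnW lk).
  rewrite !eqxx !andbT -leqNgt; case: (ltngtP l k) => [lk|kl|/val_inj ->] /=.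
  + by have -> : l != k by apply: contraTneq lk => ->; rewrite ltnn.
  + by rewrite ?andbF.
  + by rewrite eqxx.
Qed.

Lemma resolvent_block_equation k :
  x * btr (resolvent x lap) k k +
  (\sum_(l | l != k)
     dotv (y (srt k l))
       ((blk (resolvent x (lap_del (srt k l))) k k
         - blk (resolvent x (lap_del (srt k l))) k l) *m y (srt k l)) /
     (1 + dotv (edge_vec (srt k l))
            (resolvent x (lap_del (srt k l)) *m edge_vec (srt k l)))) / d%:R = 1.
Proof.
set G := resolvent x lap.
have H : x * \tr (blk G k k) + \sum_(e : 'I_r * 'I_r | (e.1 < e.2)%N)
    dotv ((E k)^T *m edge_vec e) ((E k)^T *m (G *m edge_vec e)) = d%:R.
  have -> : d%:R = \tr ((E k)^T *m ((lap + x%:M) *m G) *m E k).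
    by rewrite (mulmx_resolvent psdmx_lap x0) mulmx1 E_orth eqxx mxtrace1.
  rewrite mulmxDl mul_scalar_mx mulmxDr mulmxDl linearD /= addrC; congr (_ + _).
    rewrite /lap mulmx_suml mulmx_sumr mulmx_suml linear_sum /=.
    apply: eq_bigr => e _; rewrite /edge_dyad; move: (edge_vec e) => Y; rewrite -!mulmxA [X in _ = \tr X]mulmxA mxtrace_mulC.
    have -> : Y^T *m (G *m E k) = ((E k)^T *m (G *m Y))^T.
      by rewrite !trmx_mul trmxK (trmx_resolvent x psdmx_lap) mulmxA.
    by rewrite [RHS]big_ord1 -dotvE dotvC.
  by rewrite -scalemxAr -scalemxAl linearZ.
rewrite /btr mulrA -mulrDl; transitivity (d%:R / d%:R : R); last by rewrite divff ?gt_eqF.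
congr (_ / _); rewrite -[RHS]H; congr (_ + _).
rewrite (sum_incident (k := k)); last first.
  move=> e _ e1 e2; rewrite /edge_vec !mulmxA mulmxBr.
  rewrite (E_orth0 (k := k)) 1?eq_sym // (E_orth0 (k := k)) 1?eq_sym //.
  by rewrite subrr mul0mx dotvC dotv0r.
apply: eq_bigr => l lk; set e := srt k l; set G' := resolvent x _.
have -> : G *m edge_vec e = (1 + dotv (edge_vec e) (G' *m edge_vec e))^-1 *: (G' *m edge_vec e).
  rewrite /G (lapD (srt_lt lk)) resolvent_rank_oneE //; exact: psdmx_lap_del.
rewrite -scalemxAr dotvZr mulrC; congr (_ * _).
have kl : k != l by rewrite eq_sym.
(* [(E k)^T] maps the edge vector to [y] or [- y] according to the end at which [k] sits. The same
   sign occurs in the second factor, so both orientations give [blk k k - blk k l]. *)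
rewrite mulmxBl /blk /edge_vec /e /srt.
case: ifP => _ /=; rewrite mulmxA mulmxBr E_orth1 E_orth0 //.
  by rewrite subr0 mul1mx !mulmxBl !mulmxBr !mulmxA.
by rewrite sub0r mulNmx mul1mx dotvNl -dotvNr mulmxBl !mulmxBr opprB !mulmxA.
Qed.

End laplacian.

End block_system.

(** * Spectral sums of a symmetric matrix *)

Lemma char_poly_invmx_conj (F : fieldType) n (P D : 'M[F]_n) : P \in unitmx ->
  char_poly (invmx P *m D *m P) = char_poly D.
Proof.
move=> uP; rewrite /char_poly.
have VP : map_mx polyC (invmx P) *m map_mx polyC P = 1%:M.
  by rewrite -map_mxM mulVmx // map_mx1.
have -> : char_poly_mx (invmx P *m D *m P) =
    map_mx polyC (invmx P) *m char_poly_mx D *m map_mx polyC P.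
  rewrite /char_poly_mx mulmxBr mulmxBl !map_mxM /= mul_mx_scalar -scalemxAl.
  by rewrite VP scalemx1.
by rewrite !det_mulmx mulrAC -det_mulmx VP det1 mul1r.
Qed.

Lemma mul_diag_conj (F : fieldType) n (P : 'M[F]_n) (a b c : 'I_n -> F) :
  P \in unitmx -> (forall i, a i * b i = c i) ->
  (invmx P *m diag_mx (\row_i a i) *m P) *m (invmx P *m diag_mx (\row_i b i) *m P)
  = invmx P *m diag_mx (\row_i c i) *m P.
Proof.
move=> uP abc; rewrite !mulmxA mulmxK //; congr (_ *m P); rewrite -mulmxA; congr (_ *m _).
by rewrite mulmx_diag; congr diag_mx; apply/rowP => i; rewrite !mxE.
Qed.

Lemma diag_conj1 (F : fieldType) n (P : 'M[F]_n) (a : 'I_n -> F) :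
  P \in unitmx -> (forall i, a i = 1) ->
  invmx P *m diag_mx (\row_i a i) *m P = 1%:M.
Proof.
move=> uP a1; have -> : \row_i a i = const_mx 1 by apply/rowP => i; rewrite !mxE a1.
by rewrite diag_const_mx mulmx1 mulVmx.
Qed.

Lemma tr_diag_conj (F : fieldType) n (P : 'M[F]_n) (a : 'I_n -> F) :
  P \in unitmx -> \tr (invmx P *m diag_mx (\row_i a i) *m P) = \sum_i a i.
Proof.
move=> uP; rewrite mxtrace_mulC mulmxA mulmxV // mul1mx mxtrace_diag.
by apply: eq_bigr => i _; rewrite mxE.
Qed.

Lemma invmx_diag_conj (F : fieldType) n (P M : 'M[F]_n) (a b : 'I_n -> F) :
  P \in unitmx -> M = invmx P *m diag_mx (\row_i a i) *m P ->
  (forall i, a i * b i = 1) ->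
  invmx M = invmx P *m diag_mx (\row_i b i) *m P.
Proof.
move=> uP -> ab.
have H := mul_diag_conj uP ab; rewrite (diag_conj1 (a := fun=> 1)) // in H.
have [V _] := mulmx1_unit H.
by rewrite -[RHS](mulKmx V) H mulmx1.
Qed.

Section symmetric_spectrum.
Context {R : realType} {n : nat}.
Implicit Types M : 'M[R]_n.

Notation toC := (real_complex R).

Lemma symmetric_diagonalization M : M^T = M ->
  exists (P : 'M[R[i]]_n) (e : 'I_n -> R), P \in unitmx /\
    map_mx toC M = invmx P *m diag_mx (\row_i (toC (e i))) *m P.
Proof.
move=> sM.
have hM : map_mx toC M \is hermsymmx.
  apply: realsym_hermsym.
    by apply/is_hermitianmxP; rewrite expr0 scale1r map_mx_id // map_trmx sM.
  by apply/mxOverP => i j; rewrite mxE; apply/complex_realP; exists (M i j).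
have /mxOverP dreal := hermitian_spectral_diag_real hM.
have /hermitian_normalmx/orthomx_spectralP E := hM.
exists (spectralmx (map_mx toC M)), (fun i => complex.Re (spectral_diag (map_mx toC M) 0 i)).
split; first exact: spectral_unit.
set D := (X in diag_mx X); have -> : D = spectral_diag (map_mx toC M).
  by apply/rowP => i; rewrite mxE RRe_real.
exact: E.
Qed.

(** The diagonalization yields a real factorization of [char_poly M], so [xget] has a witness and
    its default [[::]] is not returned; unique factorization makes any two witnesses permutations of
    each other. *)
Lemma eigenvalues_perm M : M^T = M ->
  exists (P : 'M[R[i]]_n) (e : 'I_n -> R), [/\ P \in unitmx,
    map_mx toC M = invmx P *m diag_mx (\row_i (toC (e i))) *m P,
    char_poly M = \prod_(z <- eigenvalues M) ('X - z%:P) &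
    perm_eq (eigenvalues M) [seq e i | i <- enum 'I_n]].
Proof.
move=> sM; have [P [e [uP ME]]] := symmetric_diagonalization sM.
have cM : char_poly M = \prod_(z <- [seq e i | i <- enum 'I_n]) ('X - z%:P).
  apply: (map_poly_inj toC); rewrite map_char_poly ME char_poly_invmx_conj //.
  rewrite char_poly_trig; last exact: diag_mx_is_trig.
  rewrite map_prod_XsubC big_map big_enum /=; apply: eq_bigr => i _.
  by rewrite !mxE eqxx mulr1n.
have cE : char_poly M = \prod_(z <- eigenvalues M) ('X - z%:P).
  by rewrite /eigenvalues; case: xgetP => // /(_ _ cM).
exists P, e; split => //.
by apply: prod_XsubC_eq; rewrite -cE cM.
Qed.

Lemma size_eigenvalues M : M^T = M -> size (eigenvalues M) = n.
Proof.
move=> /eigenvalues_perm[P [e [_ _ _ /perm_size ->]]].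
by rewrite size_map size_enum_ord.
Qed.

Lemma sum_eigenvalues_map M : M^T = M ->
  exists (P : 'M[R[i]]_n) (e : 'I_n -> R), [/\ P \in unitmx,
    map_mx toC M = invmx P *m diag_mx (\row_i (toC (e i))) *m P,
    forall i, e i \in eigenvalues M &
    forall f : R -> R, \sum_(z <- eigenvalues M) f z = \sum_i f (e i)].
Proof.
move=> /eigenvalues_perm[P [e [uP ME _ pe]]]; exists P, e; split => // [i|f].
  by rewrite (perm_mem pe) map_f // mem_enum.
by rewrite (perm_big _ pe) /= big_map big_enum.
Qed.

(** Power sums are polynomials in the entries of [M]. This will make spectral sums measurable
    although [eigenvalues] is a choice. *)
Lemma sum_eigenvalues_exp M k : M^T = M ->
  \sum_(z <- eigenvalues M) z ^+ k = \tr (M ^+ k).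
Proof.
move=> /sum_eigenvalues_map[P [e [uP ME _ ->]]].
apply: complexI; rewrite raddf_sum /= -trace_map_mx.
have -> : map_mx toC (M ^+ k) = invmx P *m diag_mx (\row_i (toC (e i ^+ k))) *m P.
  elim: k => [|k IH].
    by rewrite expr0 map_mx1 diag_conj1 // => i; rewrite expr0 rmorph1.
  rewrite exprS map_mxM IH ME; apply: mul_diag_conj => // i.
  by rewrite exprS rmorphM.
by rewrite tr_diag_conj.
Qed.

Lemma eigenvalues_ge0 M z : psdmx M -> z \in eigenvalues M -> 0 <= z.
Proof.
move=> pM zM; have sM := pM.1.
have [_ [_ [_ _ cM _]]] := eigenvalues_perm sM.
have : root (char_poly M) z by rewrite cM root_prod_XsubC.
rewrite -eigenvalue_root_char => /eigenvalueP[u uM u0].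
have {}uM : M *m u^T = z *: u^T by rewrite -linearZ /= -uM trmx_mul sM.
have uu : 0 < dotv u^T u^T.
  rewrite lt0r dotv_ge0 andbT; apply: contra u0 => /eqP/dotv_eq0.
  by move=> /(congr1 trmx); rewrite trmxK trmx0 => ->.
have := pM.2 u^T; rewrite uM dotvZr.
by rewrite pmulr_lge0.
Qed.

Lemma sum_eigenvalues_resolvent M x : psdmx M -> 0 < x ->
  \sum_(z <- eigenvalues M) (z + x)^-1 = \tr (resolvent x M).
Proof.
move=> pM x0; have sM := pM.1.
have [P [e [uP ME eM pe]]] := sum_eigenvalues_map sM.
rewrite pe; apply: complexI; rewrite raddf_sum /= -trace_map_mx.
have e0 i : e i + x != 0 by rewrite gt_eqF // ltr_wpDl // (eigenvalues_ge0 pM).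
have E1 : map_mx toC (M + x%:M) = invmx P *m diag_mx (\row_i toC (e i + x)) *m P.
  have -> : diag_mx (\row_i toC (e i + x)) = diag_mx (\row_i toC (e i)) + (toC x)%:M.
    apply/matrixP => i j; rewrite !mxE.
    by case: eqP => _; rewrite ?mulr1n ?mulr0n ?addr0 // rmorphD.
  rewrite map_mxD ME map_scalar_mx mulmxDr mulmxDl; congr (_ + _).
  by rewrite mul_mx_scalar -scalemxAl mulVmx // scalemx1.
rewrite map_invmx (invmx_diag_conj (b := fun i => toC (e i + x)^-1) uP E1).
  by rewrite tr_diag_conj.
by move=> i; rewrite -rmorphM mulfV // rmorph1.
Qed.

End symmetric_spectrum.

(** * The Stieltjes transform of the semicircle *)

Section clamped_arcsine.
Context {R : realType}.

(** A monotone function whose image is a whole interval has no jumps; monotonicity comes from being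
    the inverse of [sin]. *)
Lemma asin_within_continuous : {within `[(-1 : R), 1], continuous (@asin R)}.
Proof.
have pi2 : - (pi / 2) <= pi / 2 :> R by have := pi_ge0 R; lra.
have sinc : {within `[- (pi / 2), pi / 2], continuous (@sin R)}.
  by apply: continuous_subspaceT => x; exact: continuous_sin.
have s1 : sin (- (pi / 2)) = -1 :> R by rewrite sinN sin_pihalf.
have a1 : asin 1 = pi / 2 :> R.
  by rewrite -[X in asin X]sin_pihalf sinK // in_itv /= pi2 lexx.
have aN1 : asin (-1) = - (pi / 2) :> R.
  by rewrite -s1 sinK // in_itv /= pi2 lexx.
apply: segment_inc_surj_continuous.
  have := segment_can_le pi2 sinc (@sinK R).
  by rewrite s1 sin_pihalf.
rewrite a1 aN1 => z /= zpi; exists (sin z); last exact: sinK.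
by rewrite /= in_itv /= sin_geN1 sin_le1.
Qed.

(* [asin] is only specified on [-1, 1]; clamping its argument makes it
   continuous on the whole line. *)
Definition casin (x : R) : R := asin (Num.max (-1) (Num.min 1 x)).

Lemma casin_continuous : continuous casin.
Proof.
move=> x; set cl := fun x : R => Num.max (-1) (Num.min 1 x) : R.
have clc : {for x, continuous cl}.
  apply: continuous_max; first exact: cvg_cst.
  by apply: continuous_min; [exact: cvg_cst|exact: cvg_id].
have cl1 z : `[(-1 : R), 1]%classic (cl z).
  by rewrite /= in_itv /= le_max lexx /= ge_max ge_min lexx /= andbT; lra.
have /subspace_continuousP/(_ (cl x) (cl1 x)) h := asin_within_continuous.
move=> U /h hU; have hcl : nbhs x (fun z => `[(-1 : R), 1]%classic (cl z) -> U (asin (cl z))) := clc _ hU.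
by apply: (filterS _ hcl) => z; apply; exact: cl1.
Qed.

Lemma casinE x : -1 <= x <= 1 -> casin x = asin x.
Proof.
by move=> /andP[x1 x2]; rewrite /casin (min_idPr x2) (max_idPr x1).
Qed.

Lemma casin1 : casin 1 = pi / 2.
Proof.
rewrite casinE; last by lra.
rewrite -[X in asin X]sin_pihalf sinK // in_itv /= lexx andbT; have := pi_ge0 R; lra.
Qed.

Lemma casinN1 : casin (-1) = - (pi / 2).
Proof.
rewrite casinE; last by lra.
have <- : sin (- (pi / 2)) = -1 :> R by rewrite sinN sin_pihalf.
rewrite sinK // in_itv /= lexx /=; have := pi_ge0 R; lra.
Qed.

Lemma is_derive_casin (x : R) : -1 < x < 1 ->
  is_derive x 1 casin (Num.sqrt (1 - x ^+ 2))^-1.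
Proof.
move=> x1; have := is_derive1_asin x1.
apply: near_eq_is_derive.
have xI : x \in `](-1), 1[ by rewrite in_itv.
have := near_in_itvoo xI.
apply: filterS => z; rewrite in_itv /= => /andP[z1 z2].
by rewrite casinE // !ltW.
Qed.

End clamped_arcsine.

Lemma is_derive_affine (R : realType) (f : R -> R) (a b l : R) :
  (forall x, f x = a + b * x) -> is_derive l 1 f b.
Proof.
move=> fE; have -> : f = cst a + b *: id :> (R -> R).
  by apply/funext => x; rewrite fE.
have D := is_deriveD (is_derive_cst a l (1 : R)) (is_deriveZ b (is_derive_id l (1 : R))).
by apply: (is_derive_eq D); rewrite add0r [_ *: 1]mulr1.
Qed.

Section semicircle_stieltjes.
Context {R : realType} (m h z : R).
Hypotheses (h0 : 0 < h) (hm : h <= m) (z0 : 0 < z).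

Notation mu := (@lebesgue_measure R).
Let y : R := m + z.
Let s : R := Num.sqrt (y ^+ 2 - h ^+ 2).
Let q (l : R) := h ^+ 2 - (l - m) ^+ 2.
Let w (l : R) := (h ^+ 2 + y * (l - m)) * (h * (l + z))^-1.

Let yh : h < y. Proof. by rewrite /y (le_lt_trans hm) // ltrDl. Qed.
Let s2 : 0 < y ^+ 2 - h ^+ 2. Proof. by rewrite subr_sqr mulr_gt0 ?subr_gt0 // addr_gt0 // (lt_trans h0). Qed.
Let s0 : 0 < s. Proof. by rewrite sqrtr_gt0. Qed.
Let ss : s ^+ 2 = y ^+ 2 - h ^+ 2. Proof. by rewrite sqr_sqrtr // ltW. Qed.

(** With [l - m = (l + z) - y] one gets [q = - (l + z)^2 + 2 y (l + z) - s^2], so [sqrt q / (l + z)]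
    is the sum of [- (l - m) / sqrt q], [y / sqrt q] and [- s^2 / ((l + z) sqrt q)]. The three terms
    of [F] are their antiderivatives; [w] is the Moebius map sending [m - h], [m + h] to -1, 1 that
    linearizes the last one. *)
Let F (l : R) := Num.sqrt (q l) + y * casin ((l - m) / h) - s * casin (w l).

Let qcont : continuous q.
Proof.
move=> l; apply: cvgB; first exact: cvg_cst.
by apply: cvgM; apply: cvgB; [exact: cvg_id|exact: cvg_cst|exact: cvg_id|exact: cvg_cst].
Qed.

Let sqrtq_cont : continuous (fun l => Num.sqrt (q l)).
Proof. by move=> l; apply: continuous_comp; [exact: qcont|exact: sqrt_continuous]. Qed.

Let invz_cont (l : R) : m - h <= l -> {for l, continuous (fun l => (l + z)^-1)}.
Proof.
have h0' := h0; have hm' := hm; have z0' := z0.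
move=> ml; apply: cvgV; first by rewrite gt_eqF //; lra.
by apply: cvgD; [exact: cvg_id|exact: cvg_cst].
Qed.

Let F_cont (l : R) : m - h <= l -> {for l, continuous F}.
Proof.
have h0' := h0; have hm' := hm; have z0' := z0.
move=> ml; apply: cvgB; first (apply: cvgD; first exact: sqrtq_cont).
  apply: cvgMr; apply: continuous_comp; last exact: casin_continuous.
  by apply: cvgMl; apply: cvgB; [exact: cvg_id|exact: cvg_cst].
apply: cvgMr; apply: continuous_comp; last exact: casin_continuous.
apply: cvgM.
  apply: cvgD; first exact: cvg_cst.
  by apply: cvgMr; apply: cvgB; [exact: cvg_id|exact: cvg_cst].
apply: cvgV; first by rewrite gt_eqF // mulr_gt0 //; lra.
by apply: cvgMr; apply: cvgD; [exact: cvg_id|exact: cvg_cst].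
Qed.

Let F_derive (l : R) : m - h < l < m + h ->
  is_derive l 1 F (Num.sqrt (q l) / (l + z)).
Proof.
have h0' := h0; have hm' := hm; have z0' := z0.
move=> /andP[l1 l2].
have q0 : 0 < q l by rewrite /q; nra.
have lz : 0 < l + z by lra.
have hlz : 0 < h * (l + z) by rewrite mulr_gt0.
have r0 : 0 < Num.sqrt (q l) by rewrite sqrtr_gt0.
have rr : Num.sqrt (q l) ^+ 2 = q l by rewrite sqr_sqrtr // ltW.
have Dq : is_derive l 1 q (- (2 * (l - m))).
  apply: (@is_derive_eq _ _ _ (cst (h ^+ 2) - (id - cst m) ^+ 2 : R -> R)).
  by rewrite sub0r subr0 expr1 [_ *: 1]mulr1.
have D1 : is_derive l 1 (Num.sqrt \o q) ((2 * Num.sqrt (q l))^-1 * (- (2 * (l - m)))).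
  exact: (@is_derive1_comp _ _ _ _ _ _ (is_derive1_sqrt q0) Dq).
have Du : is_derive l 1 (fun l => (l - m) / h) h^-1.
  by apply: (@is_derive_affine _ _ (- m / h)) => x; ring.
have u1 : -1 < (l - m) / h < 1.
  by rewrite ltr_pdivlMr // ltr_pdivrMr //; lra.
have D2 : is_derive l 1 (casin \o (fun l => (l - m) / h)) ((Num.sqrt (q l))^-1).
  have := @is_derive1_comp _ casin (fun l => (l - m) / h) l _ _ (is_derive_casin u1) Du.
  have -> : 1 - ((l - m) / h) ^+ 2 = q l / h ^+ 2.
    by rewrite /q; field; rewrite gt_eqF.
  rewrite sqrtrM ?(ltW q0) // sqrtrV ?sqr_ge0 // sqrtr_sqr (gtr0_norm h0).
  by rewrite invfM invrK -mulrA mulfV ?gt_eqF // mulr1.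
pose c1 : R := (y ^+ 2 - h ^+ 2) / (h * (l + z) ^+ 2).
have Dw : is_derive l 1 w c1.
  have Dd : is_derive l 1 (fun l => h * (l + z)) h.
    by apply: (@is_derive_affine _ _ (h * z)) => x; ring.
  have Dn : is_derive l 1 (fun l => h ^+ 2 + y * (l - m)) y.
    by apply: (@is_derive_affine _ _ (h ^+ 2 - y * m)) => x; ring.
  have Di := @is_deriveV _ (fun l => h * (l + z)) l _ 1 (lt0r_neq0 hlz) Dd.
  have DD := @is_deriveM _ _ _ _ l 1 _ _ Dn Di.
  apply: (is_derive_eq DD); rewrite /GRing.scale /= /c1 /y.
  by field; rewrite !gt_eqF.
(* A perfect square times [q l]: this gives both [-1 < w l < 1] and the value of the square root in
   the derivative of [casin]. *)
have w2 : 1 - w l ^+ 2 = (s / (h * (l + z))) ^+ 2 * q l.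
  rewrite [in RHS]exprMn ss /w /q /y; field.
  by rewrite !gt_eqF.
have w1 : -1 < w l < 1.
  rewrite -ltr_norml -sqrtr_sqr -[X in _ < X]sqrtr1 ltr_sqrt // -subr_gt0 w2.
  by rewrite mulr_gt0 // exprn_gt0 // divr_gt0.
pose c3 : R := s / ((l + z) * Num.sqrt (q l)).
have D3 : is_derive l 1 (casin \o w) c3.
  apply: (is_derive_eq (@is_derive1_comp _ casin w l _ _ (is_derive_casin w1) Dw)).
  rewrite w2 sqrtrM ?sqr_ge0 // sqrtr_sqr gtr0_norm ?divr_gt0 // /c1 /c3 -ss; field.
  by rewrite !gt_eqF.
have D := is_deriveB (is_deriveD D1 (is_deriveZ y D2)) (is_deriveZ s D3).
apply: (is_derive_eq D).
rewrite /GRing.scale /= /c3.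
have -> : Num.sqrt (q l) / (l + z) = q l / ((l + z) * Num.sqrt (q l)).
  by move: rr (lt0r_neq0 r0); set t := Num.sqrt _ => <- t0; field; rewrite t0 gt_eqF.
have -> : s * (s / ((l + z) * Num.sqrt (q l))) = (y ^+ 2 - h ^+ 2) / ((l + z) * Num.sqrt (q l)).
  by rewrite mulrA -expr2 ss.
by rewrite /q /y; field; rewrite !gt_eqF.
Qed.

Lemma integral_semicircle_stieltjes :
  (\int[mu]_(l in `[(m - h)%R, (m + h)%R])
     (Num.sqrt (h ^+ 2 - (l - m) ^+ 2) / (l + z))%:E
   = (pi * (m + z - Num.sqrt ((m + z) ^+ 2 - h ^+ 2)))%:E)%E.
Proof.
have h0' := h0; have hm' := hm; have z0' := z0.
have ab : m - h < m + h by lra.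
have wa : w (m - h) = -1.
  rewrite /w /y; have : m - h + z != 0 by rewrite gt_eqF //; lra.
  by move=> H; field; rewrite H gt_eqF.
have wb : w (m + h) = 1.
  rewrite /w /y; have : m + h + z != 0 by rewrite gt_eqF //; lra.
  by move=> H; field; rewrite H gt_eqF.
rewrite (@continuous_FTC2 _ (fun l => Num.sqrt (q l) / (l + z)) F) //.
- rewrite -EFinB; congr (_%:E); rewrite /F wa wb casin1 casinN1.
  have -> : q (m - h) = 0 by rewrite /q; ring.
  have -> : q (m + h) = 0 by rewrite /q; ring.
  have -> : (m + h - m) / h = 1 by field; rewrite gt_eqF.
  have -> : (m - h - m) / h = -1 by field; rewrite gt_eqF.
  by rewrite casin1 casinN1 sqrtr0 -/y -/s; field.
- apply: continuous_in_subspaceT => l; rewrite inE /= in_itv /= => /andP[ml _].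
  by apply: cvgM; [exact: sqrtq_cont|exact: invz_cont].
- split.
  + by move=> l; rewrite in_itv /= => /F_derive[].
  + by apply: cvg_at_right_filter; apply: F_cont.
  + by apply: cvg_at_left_filter; apply: F_cont; lra.
- by move=> l; rewrite in_itv /= derive1E => /F_derive[_ ->].
Qed.

End semicircle_stieltjes.

(** * The limiting density *)

Section semicircle_over_line.
Context {R : realType} (m h : R).
Hypotheses (h0 : 0 < h) (hm : h <= m).
Notation mu := (@lebesgue_measure R).

Let S (l : R) := Num.sqrt (h ^+ 2 - (l - m) ^+ 2).

Lemma semicircle_out l : l <= m - h \/ m + h <= l -> S l = 0.
Proof.
have h0' := h0; have hm' := hm.
by move=> lo; apply/eqP; rewrite sqrtr_eq0 subr_sqr; case: lo => lo; nra.
Qed.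

Lemma semicircle_ge0 l : 0 <= S l.
Proof. exact: sqrtr_ge0. Qed.

Lemma measurable_semicircle : measurable_fun setT S.
Proof.
apply: continuous_measurable_fun => l; apply: continuous_comp; last exact: sqrt_continuous.
apply: cvgB; first exact: cvg_cst.
by apply: cvgM; apply: cvgB; [exact: cvg_id|exact: cvg_cst|exact: cvg_id|exact: cvg_cst].
Qed.

Lemma semicircle_div_ge0 z l : 0 <= z -> 0 <= S l / (l + z).
Proof.
move=> z0; have [ml|lm] := leP l (m - h).
  by rewrite semicircle_out ?mul0r //; left.
rewrite mulr_ge0 ?semicircle_ge0 // invr_ge0 addr_ge0 //.
by rewrite ltW // (le_lt_trans _ lm) // subr_ge0.
Qed.

Lemma semicircle_div_ge0' l : 0 <= S l / l.
Proof. by have := @semicircle_div_ge0 0 l (lexx _); rewrite addr0. Qed.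

Lemma measurable_semicircle_div z : measurable_fun setT (fun l => S l / (l + z)).
Proof.
apply: measurable_funM; first exact: measurable_semicircle.
by apply: measurable_funV; apply: measurable_funD.
Qed.

Lemma integralT_semicircle_div z : 0 < z ->
  (\int[mu]_l (S l / (l + z))%:E
   = (pi * (m + z - Num.sqrt ((m + z) ^+ 2 - h ^+ 2)))%:E)%E.
Proof.
move=> z0; rewrite -integral_semicircle_stieltjes // [RHS]integral_mkcond.
apply: eq_integral => l _; rewrite patchE.
case: ifPn => //; rewrite notin_setE /= in_itv /= => /negP lo.
rewrite -/(S l) semicircle_out ?mul0r //.
by move: lo; rewrite negb_and -!ltNge => /orP[] /ltW; [left|right].
Qed.

(** At [h = m], that is [c = 2], the integrand blows up at the end point 0 of the support. The
    shifted integrands with [z = n.+1%:R^-1] increase to this one, so monotone convergence treats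
    all cases alike. *)
Lemma integralT_semicircle :
  (\int[mu]_l (S l / l)%:E = (pi * (m - Num.sqrt (m ^+ 2 - h ^+ 2)))%:E)%E.
Proof.
have h0' := h0; have hm' := hm.
pose g n l : \bar R := (S l / (l + n.+1%:R^-1))%:E.
have g_cvg l : g n l @[n --> \oo] --> (S l / l)%:E.
  apply: cvg_EFin; first exact: nearW.
  have [lm|ml] := leP l (m - h).
    rewrite semicircle_out ?mul0r; last by left.
    rewrite [X in X @ _ --> _](_ : _ = cst 0); first exact: cvg_cst.
    by apply/funext => n /=; rewrite semicircle_out ?mul0r //; left.
  have l0 : l != 0 by rewrite gt_eqF // (le_lt_trans _ ml) // subr_ge0.
  apply: cvgMr; apply: cvgV => //; rewrite -[X in _ --> X]addr0.
  by apply: cvgD; [exact: cvg_cst|exact: cvg_harmonic].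
have -> : (\int[mu]_l (S l / l)%:E = \int[mu]_l (limn (g^~ l)))%E.
  by apply: eq_integral => l _; apply/esym/cvg_lim.
rewrite monotone_convergence //.
- apply/cvg_lim => //.
  rewrite [X in X @ _ --> _](_ : _ = fun n => (pi * (m + n.+1%:R^-1
      - Num.sqrt ((m + n.+1%:R^-1) ^+ 2 - h ^+ 2)))%:E); last first.
    by apply/funext => n; rewrite integralT_semicircle_div.
  apply: cvg_EFin; first exact: nearW.
  have mn : m + n.+1%:R^-1 @[n --> \oo] --> m.
    by rewrite -[X in _ --> X]addr0; apply: cvgD; [exact: cvg_cst|exact: cvg_harmonic].
  apply: cvgMr; apply: cvgB => //.
  apply: continuous_cvg; first exact: sqrt_continuous.
  by apply: cvgB; [exact: cvgM|exact: cvg_cst].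
- by move=> n; apply/measurable_EFinP; exact: measurable_semicircle_div.
- by move=> n l _; rewrite lee_fin semicircle_div_ge0.
- move=> l _ a b ab; rewrite lee_fin.
  have [lm|ml] := leP l (m - h).
    by rewrite !semicircle_out ?mul0r //; left.
  have l0 : 0 < l by rewrite (le_lt_trans _ ml) // subr_ge0.
  rewrite ler_wpM2l ?semicircle_ge0 // lef_pV2 ?posrE ?addr_gt0 //.
  by rewrite lerD2l lef_pV2 ?posrE // ler_nat.
Qed.

End semicircle_over_line.

(** * The density as a semicircle divided by the variable *)

Section rho_integrals.
Context {R : realType} (c : R).
Hypothesis c0 : 0 <= c.
Notation mu := (@lebesgue_measure R).

(** Centre and half-width of the support: [cplus c = m + h] and [cminus c = m - h]. *)
Let m := 2 + c.
Let h := 2 * (Num.sqrt 2 * Num.sqrt c).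

Let sqr2 : Num.sqrt 2 ^+ 2 = 2 :> R. Proof. by rewrite sqr_sqrtr. Qed.
Let sqrc : Num.sqrt c ^+ 2 = c. Proof. by rewrite sqr_sqrtr. Qed.

Lemma rhoE l : rho c l = (4 * pi)^-1 * (Num.sqrt (h ^+ 2 - (l - m) ^+ 2) / l).
Proof.
rewrite /rho; have -> : (cplus c - l) * (l - cminus c) = h ^+ 2 - (l - m) ^+ 2.
  have -> : m = Num.sqrt 2 ^+ 2 + Num.sqrt c ^+ 2 by rewrite sqr2 sqrc.
  by rewrite /cplus /cminus /h; ring.
rewrite invfM -mulrA [_ / l]mulrC; congr (_ * (_ * _)).
have [q0|q0] := leP (h ^+ 2 - (l - m) ^+ 2) 0; first by rewrite sqrtr0 ler0_sqrtr.
by [].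
Qed.

Let hm2 : m ^+ 2 - h ^+ 2 = (2 - c) ^+ 2.
Proof. by rewrite /m /h !exprMn sqr2 sqrc; ring. Qed.

Let h_gt0 : c != 0 -> 0 < h.
Proof. by move=> c1; rewrite !mulr_gt0 // sqrtr_gt0 // lt0r c1. Qed.

Let h_le : h <= m.
Proof.
have := sqr_ge0 (Num.sqrt 2 - Num.sqrt c).
by rewrite sqrrB sqr2 sqrc /h /m; set a := _ * _; lra.
Qed.

(** At [c = 0] the support collapses to a point, [h = 0], and the semicircle lemmas do not apply;
    the limit law is then the atom at 0 alone. *)
Lemma rho0 l : c = 0 -> rho c l = 0.
Proof.
move=> c1; rewrite rhoE /h c1 sqrtr0 !mulr0 expr0n sub0r ler0_sqrtr ?mul0r ?mulr0 //.
by rewrite oppr_le0 sqr_ge0.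
Qed.

Lemma rho_ge0 l : 0 <= rho c l.
Proof.
have [c1|c1] := eqVneq c 0; first by rewrite rho0.
rewrite rhoE mulr_ge0 ?(semicircle_div_ge0' (h_gt0 c1)) //.
by rewrite invr_ge0 mulr_ge0 ?pi_ge0.
Qed.

Lemma rho_lt0 l : l < 0 -> rho c l = 0.
Proof.
move=> l0; have [c1|c1] := eqVneq c 0; first by rewrite rho0.
rewrite rhoE semicircle_out ?mul0r ?mulr0 ?h_gt0 //.
by left; rewrite (le_trans (ltW l0)) // subr_ge0.
Qed.

Lemma measurable_rho : measurable_fun setT (rho c).
Proof.
have -> : rho c = fun l => (4 * pi)^-1 * (Num.sqrt (h ^+ 2 - (l - m) ^+ 2) / l).
  by apply/funext => l; rewrite rhoE.
apply: measurable_funM => //.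
have := @measurable_semicircle_div _ m h 0.
by under eq_fun do rewrite addr0.
Qed.

Lemma integral_rho :
  (\int[mu]_l (rho c l)%:E = ((2 + c - `|2 - c|) / 4)%:E)%E.
Proof.
have [c1|c1] := eqVneq c 0.
  rewrite integral0_eq => [|l _]; last by rewrite rho0.
  by rewrite c1 addr0 subr0 ger0_norm // subrr mul0r.
under eq_integral do rewrite rhoE EFinM.
rewrite ge0_integralZl //.
- rewrite (integralT_semicircle (h_gt0 c1) h_le) hm2 sqrtr_sqr -EFinM; congr (_%:E).
  by have := pi_gt0 R; move: (@pi R) => t t0; rewrite /m; field; rewrite gt_eqF.
- apply/measurable_EFinP; have := @measurable_semicircle_div _ m h 0.
  by under eq_fun do rewrite addr0.
- by move=> l _; rewrite lee_fin (semicircle_div_ge0' (h_gt0 c1)).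
- by rewrite lee_fin invr_ge0 mulr_ge0 ?pi_ge0.
Qed.

Lemma integrable_rho : mu.-integrable setT (EFin \o rho c).
Proof.
apply/integrableP; split; first by apply/measurable_EFinP; exact: measurable_rho.
under eq_integral do rewrite /= ger0_norm ?rho_ge0 //.
by rewrite integral_rho ltry.
Qed.

Lemma integral_rho_stieltjes z : 0 < z ->
  \int[mu]_l (rho c l / (l + z)) =
  (Num.sqrt ((2 + c + z) ^+ 2 - 8 * c) - z - `|2 - c|) / (4 * z).
Proof.
move=> z0; have [c1|c1] := eqVneq c 0.
  rewrite /Rintegral integral0_eq => [|l _]; last by rewrite rho0 // mul0r.
  have -> : `|2 - c| = 2 by rewrite c1 subr0 ger0_norm.
  have -> : Num.sqrt ((2 + c + z) ^+ 2 - 8 * c) = 2 + z.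
    by rewrite c1 mulr0 subr0 addr0 sqrtr_sqr ger0_norm // addr_ge0 // ltW.
  by rewrite /= addrK subrr mul0r.
have h0 := h_gt0 c1.
have I1 : mu.-integrable setT (EFin \o (fun l => Num.sqrt (h ^+ 2 - (l - m) ^+ 2) / l)).
  have mS := @measurable_semicircle_div _ m h 0.
  apply/integrableP; split.
    by apply/measurable_EFinP; move: mS; under eq_fun do rewrite addr0.
  under eq_integral => l _.
    rewrite /= ger0_norm; last exact: semicircle_div_ge0'.
    over.
  by rewrite integralT_semicircle // ltry.
have I2 : mu.-integrable setT (EFin \o (fun l => Num.sqrt (h ^+ 2 - (l - m) ^+ 2) / (l + z))).
  apply/integrableP; split.
    by apply/measurable_EFinP; exact: measurable_semicircle_div.
  under eq_integral do rewrite /= ger0_norm ?semicircle_div_ge0 ?(ltW z0) //.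
  by rewrite integralT_semicircle_div // ltry.
(* Partial fractions: [1 / (l (l + z)) = (1 / l - 1 / (l + z)) / z]. *)
have -> : \int[mu]_l (rho c l / (l + z)) =
   (4 * pi * z)^-1 * (\int[mu]_l (Num.sqrt (h ^+ 2 - (l - m) ^+ 2) / l
      - Num.sqrt (h ^+ 2 - (l - m) ^+ 2) / (l + z))).
  rewrite -RintegralZl //; last exact: (integrableB _ I1 I2).
  apply: eq_Rintegral => l _; rewrite rhoE.
  have [lm|ml] := leP l (m - h).
    by rewrite semicircle_out ?(mul0r, mulr0, subr0) //; left.
  have l0 : 0 < l by rewrite (le_lt_trans _ ml) // subr_ge0.
  have lz : 0 < l + z by rewrite addr_gt0.
  by have := pi_gt0 R; move: (@pi R) => t t0; field; rewrite !gt_eqF.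
rewrite RintegralB // /Rintegral integralT_semicircle // integralT_semicircle_div //=.
rewrite hm2 sqrtr_sqr.
have -> : (m + z) ^+ 2 - h ^+ 2 = (2 + c + z) ^+ 2 - 8 * c.
  by rewrite /m /h !exprMn sqr2 sqrc; ring.
by have := pi_gt0 R; move: (@pi R) => t t0; rewrite /m; field; rewrite !gt_eqF.
Qed.

End rho_integrals.

(** * The limiting law *)

Section density.
Context d (T : measurableType d) (R : realType).
Variables (mu nu : {measure set T -> \bar R}) (g : T -> R).
Hypothesis g0 : forall x, 0 <= g x.
Hypothesis mg : measurable_fun setT g.
Hypothesis nuE : forall A, measurable A -> nu A = (\int[mu]_(x in A) (g x)%:E)%E.

Import HBNNSimple.

Let density_indic (A : set T) : measurable A ->
  (\int[nu]_x (\1_A x)%:E = \int[mu]_x (\1_A x * g x)%:E)%E.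
Proof.
move=> mA; rewrite integral_indic // setIT nuE // integral_mkcond.
apply: eq_integral => x _; rewrite patchE indicE.
by case: (x \in A); rewrite ?mul1r ?mul0r.
Qed.

Let density_nnsfun (f : {nnsfun T >-> R}) :
  (\int[nu]_x (f x)%:E = \int[mu]_x (f x * g x)%:E)%E.
Proof.
under [LHS]eq_integral do rewrite fimfunE -fsumEFin//.
rewrite [LHS]ge0_integral_fsum//; last 2 first.
  - by move=> r; exact/measurable_EFinP/measurableT_comp.
  - by move=> n x _; rewrite EFinM nnfun_muleindic_ge0.
under [RHS]eq_integral.
  move=> x _; rewrite EFinM fimfunE -fsumEFin// ge0_mule_fsuml; last first.
    by move=> r; rewrite EFinM nnfun_muleindic_ge0.
  over.
rewrite [RHS]ge0_integral_fsum//; last 2 first.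
  - move=> r; apply: emeasurable_funM; last exact/measurable_EFinP.
    exact/measurable_EFinP/measurableT_comp.
  - by move=> n x _; rewrite EFinM mule_ge0 ?nnfun_muleindic_ge0// lee_fin.
apply: eq_fsbigr => r _; rewrite integralZl_indic_nnsfun // density_indic //.
have [r0|r0] := leP 0 r.
  rewrite -ge0_integralZl ?lee_fin //.
  - by apply: eq_integral => x _; rewrite -!EFinM mulrA.
  - apply/measurable_EFinP; apply: measurable_funM => //.
  - by move=> x _; rewrite lee_fin mulr_ge0.
rewrite preimage_nnfun0 //.
under eq_integral do rewrite indic0 mul0r.
under [RHS]eq_integral do rewrite indic0 mulr0 mul0e.
by rewrite !integral0 mule0.
Qed.

(** Indicators satisfy it by definition, simple functions by linearity, and monotone approximation
    does the rest. *)
Lemma ge0_integral_density (f : T -> R) : (forall x, 0 <= f x) ->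
  measurable_fun setT f ->
  (\int[nu]_x (f x)%:E = \int[mu]_x (f x * g x)%:E)%E.
Proof.
move=> f0 /measurable_EFinP mf; pose f_ := nnsfun_approx measurableT mf.
have fcvg x : EFin \o f_^~ x @ \oo --> (f x)%:E.
  by apply: cvg_nnsfun_approx => // y _; rewrite lee_fin.
transitivity (limn (fun n => \int[nu]_x (f_ n x)%:E)%E).
  rewrite -monotone_convergence//=.
  - by apply: eq_integral => x _; apply/esym/cvg_lim => //; exact: fcvg.
  - by move=> n; exact/measurable_EFinP.
  - by move=> n x _; rewrite lee_fin.
  - by move=> x _ a b ab; rewrite lee_fin//; exact/lefP/nd_nnsfun_approx.
transitivity (limn (fun n => \int[mu]_x (f_ n x * g x)%:E)%E).
  by congr (limn _); apply/funext => n; rewrite density_nnsfun.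
rewrite -monotone_convergence//=.
- apply: eq_integral => x _; apply/cvg_lim => //.
  under eq_fun do rewrite EFinM; rewrite EFinM.
  by apply: cvgeZr => //; exact: fcvg.
- by move=> n; apply/measurable_EFinP; apply: measurable_funM.
- by move=> n x _; rewrite lee_fin mulr_ge0.
- move=> x _ a b ab; rewrite lee_fin ler_wpM2r //.
  exact/lefP/nd_nnsfun_approx.
Qed.

End density.

Section limit_law.
Context {R : realType} (c : R).
Hypothesis c0 : 0 <= c.
Notation mu := (@lebesgue_measure R).

Definition rho_measure (A : set (measurableTypeR R)) : \bar R :=
  (\int[mu]_(x in A) (rho c x)%:E)%E.

Let rho_measure0 : rho_measure set0 = 0%E.
Proof. by rewrite /rho_measure integral_set0. Qed.

Let rho_measure_ge0 A : (0 <= rho_measure A)%E.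
Proof. by apply: integral_ge0 => x _; rewrite lee_fin rho_ge0. Qed.

Let rho_measure_sigma_additive : semi_sigma_additive rho_measure.
Proof.
move=> /= A mA tA mUA.
rewrite /rho_measure/= integral_bigcup//=; last first.
  by apply: (integrableS _ _ (subsetT _)) => //; exact: integrable_rho.
apply: is_cvg_ereal_nneg_natsum_cond => n _ _.
by apply: integral_ge0 => /= x ?; rewrite lee_fin rho_ge0.
Qed.

Definition rho_measureM : {measure set (measurableTypeR R) -> \bar R} :=
  HB.pack rho_measure (isMeasure.Build _ _ _ rho_measure rho_measure0
    rho_measure_ge0 rho_measure_sigma_additive).

Let atom_ge0 : 0 <= Num.max (1 - c / 2) 0.
Proof. by rewrite le_max lexx orbT. Qed.

Let atom := mscale (NngNum atom_ge0) (\d_(0%R : measurableTypeR R)).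
Let law : {measure set (measurableTypeR R) -> \bar R} := measure_add atom rho_measureM.

Let lawE A : law A = ((Num.max (1 - c / 2) 0)%R%:E * \d_(0%R : measurableTypeR R) A
               + \int[mu]_(x in A) (rho c x)%:E)%E.
Proof. exact: (measure_addE atom rho_measureM A). Qed.

Let lawT : law setT = 1%E.
Proof.
rewrite lawE diracT mule1 integral_rho // -EFinD; congr (_%:E).
have [c2|c2] := leP c 2.
  rewrite ger0_norm ?subr_ge0 // max_l; last by lra.
  by lra.
rewrite ltr0_norm ?subr_lt0 // max_r; last by lra.
by lra.
Qed.

(** The atom contributes [max(1 - c / 2, 0) / z = (2 - c + |2 - c|) / (4 z)], which cancels the
    absolute value in the integral of the density, so one formula serves [c <= 2] and [c > 2]. The
    kernel is clamped at 0 to be bounded on the whole line. *)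
Lemma limit_law_exists : exists N : probability (measurableTypeR R) R,
  (forall A : set (measurableTypeR R),
       N A = ((Num.max (1 - c / 2) 0)%R%:E * \d_(0%R : measurableTypeR R) A
               + \int[mu]_(x in A) (rho c x)%:E)%E) /\
  (forall z, 0 < z -> \int[N]_x (Num.max x 0 + z)^-1 =
     (2 - c - z + Num.sqrt ((2 + c + z) ^+ 2 - 8 * c)) / (4 * z)).
Proof.
(* [law] already has mass 1; normalizing equips it with the structure of a probability, with [\d_0]
   as fallback value. *)
pose N : probability (measurableTypeR R) R := mnormalize law (\d_(0%R : measurableTypeR R)).
have NE A : N A = law A.
  rewrite /N /= /mnormalize lawT /= onee_eq0 /= invr1 mule1 //.
exists N; split => [A|z z0]; first by rewrite NE; exact: lawE.
have f0 (x : R) : 0 <= (Num.max x 0 + z)^-1.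
  by rewrite invr_ge0 addr_ge0 ?(ltW z0) // le_max lexx orbT.
have mf : measurable_fun setT (fun x : R => (Num.max x 0 + z)^-1).
  by apply: measurable_funV; apply: measurable_funD => //; apply: measurable_maxr.
rewrite /Rintegral.
have -> : (\int[N]_x ((Num.max x 0 + z)^-1)%:E =
   \int[law]_x ((Num.max x 0 + z)^-1)%:E)%E.
  by apply: eq_measure_integral => A _ _; exact: NE.
have -> : (\int[law]_x ((Num.max x 0 + z)^-1)%:E = \int[atom]_x ((Num.max x 0 + z)^-1)%:E
    + \int[rho_measureM]_x ((Num.max x 0 + z)^-1)%:E)%E.
  apply: ge0_integral_measure_add => //; first by move=> x _; rewrite lee_fin.
  exact/measurable_EFinP.
have -> : (\int[atom]_x ((Num.max x 0 + z)^-1)%:E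
    = (Num.max (1 - c / 2) 0)%:E * (z^-1)%:E)%E.
  transitivity ((Num.max (1 - c / 2) 0)%:E * \int[\d_(0%R : measurableTypeR R)]_x ((Num.max x 0 + z)^-1)%:E)%E.
    apply: ge0_integral_mscale => //; first exact/measurable_EFinP.
    by move=> x _; rewrite lee_fin.
  rewrite integral_dirac //; last exact/measurable_EFinP.
  by rewrite diracT mul1e maxxx add0r.
have -> : (\int[rho_measureM]_x ((Num.max x 0 + z)^-1)%:E
    = \int[mu]_x ((Num.max x 0 + z)^-1 * rho c x)%:E)%E.
  apply: ge0_integral_density => //; first exact: rho_ge0.
  exact: measurable_rho.
have -> : (\int[mu]_x ((Num.max x 0 + z)^-1 * rho c x)%:E =
           \int[mu]_x (rho c x / (x + z))%:E)%E.
  apply: eq_integral => x _; rewrite mulrC; have [x0|x0] := leP x 0.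
    move: x0; rewrite le_eqVlt => /orP[/eqP -> //|x0].
    by rewrite rho_lt0 // !mul0r.
  by [].
have I : (\int[mu]_x (rho c x / (x + z))%:E)%E \is a fin_num.
  have r0 (x : R) : 0 <= rho c x / (x + z).
    have [x0|x0] := leP 0 x; last by rewrite rho_lt0 // mul0r.
    by rewrite mulr_ge0 ?rho_ge0 // invr_ge0 addr_ge0 // ltW.
  rewrite ge0_fin_numE; last by apply: integral_ge0 => x _; rewrite lee_fin.
  apply: (@le_lt_trans _ _ (\int[mu]_x (z^-1 * rho c x)%:E)%E); last first.
    under eq_integral do rewrite EFinM.
    rewrite ge0_integralZl ?lee_fin ?invr_ge0 ?(ltW z0) //.
    - by rewrite integral_rho // -EFinM ltry.
    - by apply/measurable_EFinP; exact: measurable_rho.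
    - by move=> x _; rewrite lee_fin rho_ge0.
  apply: ge0_le_integral => //.
  - by move=> x _; rewrite lee_fin.
  - apply/measurable_EFinP; apply: measurable_funM; first exact: measurable_rho.
    by apply: measurable_funV; apply: measurable_funD.
  - by apply/measurable_EFinP; apply: measurable_funM => //; exact: measurable_rho.
  - move=> x _; rewrite lee_fin mulrC; have [x0|x0] := leP 0 x.
      rewrite ler_wpM2r ?rho_ge0 // lef_pV2 ?posrE ?ltr_wpDl //.
      by rewrite lerDr.
    by rewrite rho_lt0 // !mulr0.
rewrite fineD // [X in _ + X](integral_rho_stieltjes c0 z0) /=.
have [c2|c2] := leP c 2.
  rewrite ger0_norm ?subr_ge0 // max_l; last by lra.
  by field; rewrite gt_eqF.
rewrite ltr0_norm ?subr_lt0 // max_r; last by lra.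
by field; rewrite gt_eqF.
Qed.

End limit_law.

(** * Expectations of bounded measurable functions *)

Section bounded_measurable.
Context d (T : measurableType d) (R : realType).
Implicit Types f g : T -> R.

(** The bound is demanded everywhere, not almost everywhere. The class is closed under sums,
    products and norms, which settles integrability once and for all. *)
Definition bmf f := measurable_fun setT f /\ exists C, forall x, `|f x| <= C.

Lemma eq_bmf f g : f =1 g -> bmf f -> bmf g.
Proof. by move=> /funext ->. Qed.

Lemma bmf_cst c : bmf (fun=> c).
Proof. by split; [exact: measurable_cst|exists `|c|]. Qed.

Lemma bmfD f g : bmf f -> bmf g -> bmf (fun x => f x + g x).
Proof.
move=> [mf [C fC]] [mg [D gD]]; split; first exact: measurable_funD.
by exists (C + D) => x; rewrite (le_trans (ler_normD _ _)) // lerD.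
Qed.

Lemma bmfM f g : bmf f -> bmf g -> bmf (fun x => f x * g x).
Proof.
move=> [mf [C fC]] [mg [D gD]]; split; first exact: measurable_funM.
by exists (C * D) => x; rewrite normrM ler_pM.
Qed.

Lemma bmfN f : bmf f -> bmf (fun x => - f x).
Proof.
move=> [mf [C fC]]; split; last by exists C => x; rewrite normrN.
exact: measurable_funN.
Qed.

Lemma bmfB f g : bmf f -> bmf g -> bmf (fun x => f x - g x).
Proof. by move=> bf bg; apply: bmfD => //; exact: bmfN. Qed.

Lemma bmf_norm f : bmf f -> bmf (fun x => `|f x|).
Proof.
move=> [mf [C fC]]; split; last by exists C => x; rewrite normr_id.
by apply: measurableT_comp => //; exact: normr_measurable.
Qed.

Lemma bmf_sum (I : Type) (s : seq I) (Q : pred I) (F : I -> T -> R) :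
  (forall i, Q i -> bmf (F i)) -> bmf (fun x => \sum_(i <- s | Q i) F i x).
Proof.
move=> bF; elim: s => [|i s IH].
  by apply: eq_bmf (bmf_cst 0) => x; rewrite big_nil.
have [Qi|Qi] := boolP (Q i); last first.
  by apply: eq_bmf IH => x; rewrite big_cons (negPf Qi).
by apply: eq_bmf (bmfD (bF _ Qi) IH) => x; rewrite big_cons Qi.
Qed.

Lemma bmf_exp f n : bmf f -> bmf (fun x => f x ^+ n).
Proof.
move=> bf; elim: n => [|n IH].
  by apply: eq_bmf (bmf_cst 1) => x; rewrite expr0.
by apply: eq_bmf (bmfM bf IH) => x; rewrite exprS.
Qed.

End bounded_measurable.

Section expectation_kit.
Context d (T : measurableType d) (R : realType) (P : probability T R).
Implicit Types f g : T -> R.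

Definition Ex f : R := \int[P]_x f x.

Lemma bmf_integrable f : bmf f -> P.-integrable setT (EFin \o f).
Proof.
move=> [mf [C fC]]; apply: measurable_bounded_integrable => //.
  have PT : (P setT < +oo)%E by rewrite probability_setT ltry.
  exact: PT.
by exists C; split; [exact: num_real|move=> x Cx y _; rewrite /= (le_trans (fC y)) // ltW].
Qed.

Lemma ExE f : bmf f -> ((Ex f)%:E = \int[P]_x (f x)%:E)%E.
Proof.
move=> /bmf_integrable fi; rewrite /Ex /Rintegral fineK //.
exact: integrable_fin_num.
Qed.

Lemma Ex_cst c : Ex (fun=> c) = c.
Proof.
transitivity (c * fine (P setT)); first exact: Rintegral_cst.
by rewrite probability_setT mulr1.
Qed.

Lemma ExD f g : bmf f -> bmf g -> Ex (fun x => f x + g x) = Ex f + Ex g.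
Proof. by move=> *; rewrite /Ex RintegralD //; exact: bmf_integrable. Qed.

Lemma ExB f g : bmf f -> bmf g -> Ex (fun x => f x - g x) = Ex f - Ex g.
Proof. by move=> *; rewrite /Ex RintegralB //; exact: bmf_integrable. Qed.

Lemma ExZ c f : bmf f -> Ex (fun x => c * f x) = c * Ex f.
Proof. by move=> *; rewrite /Ex RintegralZl //; exact: bmf_integrable. Qed.

Lemma Ex_sum (I : Type) (s : seq I) (Q : pred I) (F : I -> T -> R) :
  (forall i, Q i -> bmf (F i)) ->
  Ex (fun x => \sum_(i <- s | Q i) F i x) = \sum_(i <- s | Q i) Ex (F i).
Proof.
move=> bF; elim: s => [|i s IH].
  by rewrite big_nil -[RHS](Ex_cst 0); congr Ex; apply/funext => x; rewrite big_nil.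
rewrite big_cons.
have -> : (fun x => \sum_(j <- i :: s | Q j) F j x) = fun x =>
    if Q i then F i x + \sum_(j <- s | Q j) F j x else \sum_(j <- s | Q j) F j x.
  by apply/funext => x; rewrite big_cons.
case: ifP => // Qi.
by rewrite ExD ?IH //; [exact: bF|exact: bmf_sum].
Qed.

Lemma le_Ex f g : bmf f -> bmf g -> (forall x, f x <= g x) -> Ex f <= Ex g.
Proof. by move=> bf bg fg; apply: le_Rintegral => //; exact: bmf_integrable. Qed.

Lemma Ex_ge0 f : (forall x, 0 <= f x) -> 0 <= Ex f.
Proof. by move=> f0; apply: Rintegral_ge0. Qed.

Lemma norm_Ex_le f : bmf f -> `|Ex f| <= Ex (fun x => `|f x|).
Proof. by move=> bf; apply: le_normr_Rintegral => //; exact: bmf_integrable. Qed.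

Lemma Ex_le_cst f c : bmf f -> (forall x, f x <= c) -> Ex f <= c.
Proof. by move=> bf fc; rewrite -[leRHS]Ex_cst; apply: le_Ex => //; exact: bmf_cst. Qed.

Lemma Ex_sqr_le f : bmf f -> Ex f ^+ 2 <= Ex (fun x => f x ^+ 2).
Proof.
move=> bf; set m := Ex f.
have bf2 := bmf_exp 2 bf.
have : 0 <= Ex (fun x => (f x - m) ^+ 2) by apply: Ex_ge0 => x; exact: sqr_ge0.
have -> : (fun x => (f x - m) ^+ 2) = fun x => f x ^+ 2 + ((- (2 * m)) * f x + m ^+ 2).
  by apply/funext => x; ring.
have b1 : bmf (fun x => (- (2 * m)) * f x) by apply: bmfM => //; exact: bmf_cst.
have b0 := @bmf_cst _ T R (m ^+ 2).
rewrite (ExD bf2 (bmfD b1 b0)) (ExD b1 b0) ExZ // Ex_cst -/m.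
lra.
Qed.

Lemma markov_Ex f (e : R) : bmf f -> (forall x, 0 <= f x) -> 0 < e ->
  (P [set x | (e < f x)%R] <= (Ex f / e)%:E)%E.
Proof.
move=> bf f0 e0; set A := [set x | _].
have mA : measurable A.
  rewrite /A -[X in measurable X]setTI.
  have -> : [set x | e < f x] = f @^-1` `]e, +oo[.
    by apply/seteqP; split => x /=; rewrite in_itv /= andbT.
  by apply: bf.1 => //; exact: measurable_itv.
have bA : bmf (\1_A : T -> R).
  split; first exact: measurable_indic.
  by exists 1 => x; rewrite indicE; case: (x \in A); rewrite ?normr1 ?normr0.
have <- : (Ex (\1_A))%:E = P A by rewrite ExE // integral_indic // setIT.
rewrite lee_fin ler_pdivlMr // mulrC -ExZ //; apply: le_Ex => // [|x].
  by apply: bmfM => //; exact: bmf_cst.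
rewrite indicE; case: (boolP (x \in A)) => [|_]; last by rewrite mulr0.
by rewrite inE /A /= => /ltW; rewrite mulr1.
Qed.

End expectation_kit.

(** * Weierstrass approximation *)

Section weierstrass.
Context {R : realType}.

Lemma uniform_continuity01 (f : R -> R) (e : R) : continuous f -> 0 < e ->
  exists2 dl : R, 0 < dl & forall x y : R, 0 <= x <= 1 -> `|x - y| < dl -> `|f x - f y| < e.
Proof.
move=> cf e0.
have : compact `[(0 : R), 1] by exact: segment_compact.
move/compact_near_coveringP => /(_ _ (0 : R)^'+
  (fun (dl x : R) => forall y, `|x - y| < dl -> `|f x - f y| < e)) [].
  move=> x _; have e2 : 0 < e / 2 by rewrite divr_gt0.
  have /cvgrPdist_lt/(_ _ e2) := cf x.
  move=> /nbhs_ballP[eta /= eta0 H].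
  exists (ball x (eta / 2), [set dl | 0 < dl < eta / 2]) => /=.
    split; first by apply: nbhsx_ballx; rewrite divr_gt0.
    exists (eta / 2); first by rewrite /= divr_gt0.
    by move=> z /=; rewrite sub0r normrN => zl z0; rewrite z0 /= (le_lt_trans (ler_norm _)).
  move=> [x' dl] /= [xx' /andP[dl0 dle]] y x'y.
  have h1 : `|f x - f x'| < e / 2.
    by apply: H; apply: le_ball xx'; lra.
  have h2 : `|f x - f y| < e / 2.
    apply: H; rewrite /ball /= (le_lt_trans (ler_distD x' _ _)) //.
    by rewrite [ltRHS]splitr ltrD // (lt_trans x'y).
  rewrite (le_lt_trans (ler_distD (f x) _ _)) // [ltRHS]splitr ltrD //.
  by rewrite distrC.
move=> eta /= eta0 H; exists (eta / 2); first by rewrite divr_gt0.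
move=> x y x01; apply: (H (eta / 2)) => /=.
- by rewrite sub0r normrN gtr0_norm ?divr_gt0 //; lra.
- by rewrite divr_gt0.
- by rewrite in_itv.
Qed.

(* The expectation of [phi] at a sum of [n] independent Bernoulli(t)
   variables, by conditioning on the last one. *)
Fixpoint bernoulli_mean (n : nat) (phi : nat -> R) (t : R) : R :=
  if n is n'.+1 then t * bernoulli_mean n' (phi \o succn) t
                     + (1 - t) * bernoulli_mean n' phi t
  else phi 0%N.

Fixpoint bernstein_poly (n : nat) (phi : nat -> R) : {poly R} :=
  if n is n'.+1 then 'X * bernstein_poly n' (phi \o succn)
                     + (1 - 'X) * bernstein_poly n' phi
  else (phi 0%N)%:P.

Lemma bernstein_polyE n phi t : (bernstein_poly n phi).[t] = bernoulli_mean n phi t.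
Proof.
by elim: n phi => [|n IH] phi /=; rewrite !hornerE // !IH.
Qed.

Lemma bernoulli_mean_le n phi psi t : 0 <= t <= 1 ->
  (forall k, (k <= n)%N -> phi k <= psi k) -> bernoulli_mean n phi t <= bernoulli_mean n psi t.
Proof.
move=> /andP[t0 t1]; elim: n phi psi => [|n IH] phi psi le /=; first exact: le.
rewrite lerD // ler_wpM2l ?subr_ge0 //; apply: IH => k kn; apply: le => //.
exact: leqW.
Qed.

Lemma bernoulli_meanD n a b phi psi t :
  bernoulli_mean n (fun k => a * phi k + b * psi k) t
  = a * bernoulli_mean n phi t + b * bernoulli_mean n psi t.
Proof.
elim: n phi psi => [//|n IH] phi psi /=.
by rewrite -[X in _ * X + _]/(bernoulli_mean n (fun k => a * (phi \o succn) k + b * (psi \o succn) k) t) !IH; ring.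
Qed.

Lemma bernoulli_mean_cst n c t : bernoulli_mean n (fun=> c) t = c.
Proof. by elim: n => //= n IH; rewrite -[X in _ * X + _]/(bernoulli_mean n (fun=> c) t) IH; ring. Qed.

(** The centre [a] is arbitrary because a success in the last trial shifts it to [a - 1]. At
    [a = n t] this is the binomial variance. *)
Lemma bernoulli_mean_sqr n a t :
  bernoulli_mean n (fun k => (k%:R - a) ^+ 2) t = n%:R * t * (1 - t) + (n%:R * t - a) ^+ 2.
Proof.
elim: n a => [|n IH] a /=; first by ring.
have -> : (fun k => (k%:R - a) ^+ 2) \o succn = fun k => (k%:R - (a - 1)) ^+ 2 :> R.
  by apply/funext => k /=; rewrite -natr1; ring.
by rewrite !IH -natr1; ring.
Qed.

Lemma weierstrass01 (f : R -> R) (e : R) : continuous f -> 0 < e ->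
  exists p : {poly R}, forall t : R, 0 <= t <= 1 -> `|f t - p.[t]| <= e.
Proof.
move=> cf e0; have e2 : 0 < e / 2 by rewrite divr_gt0.
have [dl dl0 unif] := uniform_continuity01 cf e2.
have [M M0 fM] : exists2 M : R, 0 < M & forall t : R, 0 <= t <= 1 -> `|f t| <= M.
  have cs : {within `[(0 : R), 1], continuous f} by exact: continuous_subspaceT.
  have [a _ fa] := EVT_max ler01 cs; have [b _ fb] := EVT_min ler01 cs.
  exists (`|f a| + `|f b| + 1); first by rewrite ltr_wpDl // addr_ge0.
  move=> t t01; have t01' : t \in `[0, 1]%R by rewrite in_itv.
  have h1 := fa _ t01'; have h2 := fb _ t01'.
  have h3 := ler_norm (f a); have h4 := ler_norm (- f b); rewrite normrN in h4.
  have h5 := normr_ge0 (f a); have h6 := normr_ge0 (f b).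
  by rewrite ler_norml; apply/andP; split; lra.
(* Points far from [t] will contribute at most [2 M / dl^2] times the variance [t (1 - t) / n]; this
   [n] makes it at most [e / 2]. *)
have [n n0 nM] : exists2 n : nat, (0 : R) < n%:R & 2 * M / dl ^+ 2 / n%:R <= e / 2.
  exists (Num.truncn (4 * M / (dl ^+ 2 * e))).+1; first by rewrite ltr0n.
  have : 4 * M / (dl ^+ 2 * e) <= (Num.truncn (4 * M / (dl ^+ 2 * e))).+1%:R.
    by rewrite ltW // truncnS_gt.
  rewrite ler_pdivrMr ?mulr_gt0 ?exprn_gt0 // => h.
  rewrite ler_pdivrMr ?ltr0n // ler_pdivrMr ?exprn_gt0 //; lra.
exists (bernstein_poly n (fun k => f (k%:R / n%:R))) => t t01.
rewrite bernstein_polyE; pose c : R := 2 * M / dl ^+ 2.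
have c0 : 0 <= c by rewrite divr_ge0 ?sqr_ge0 // mulr_ge0 // ltW.
have kn k : (k <= n)%N -> (0 <= (k%:R / n%:R : R)) && ((k%:R / n%:R : R) <= 1).
  move=> kn; apply/andP; split; first by rewrite divr_ge0.
  by rewrite ler_pdivrMr // mul1r ler_nat.
(* As in Chebyshev's inequality: within [dl] of [t] uniform continuity applies, elsewhere the
   trivial bound [2 M] is at most [c (t - k / n)^2]. *)
have step k : (k <= n)%N -> `|f t - f (k%:R / n%:R)| <=
   e / 2 + c / n%:R ^+ 2 * (k%:R - n%:R * t) ^+ 2.
  move=> /kn kn1.
  have sq : c / n%:R ^+ 2 * (k%:R - n%:R * t) ^+ 2 = c * (t - k%:R / n%:R) ^+ 2.
    by field; rewrite gt_eqF.
  rewrite sq; have [tk|tk] := ltP `|t - k%:R / n%:R| dl.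
    by rewrite (le_trans (ltW (unif _ _ t01 tk))) // lerDl mulr_ge0 // sqr_ge0.
  have : `|f t - f (k%:R / n%:R)| <= 2 * M.
    by have := fM _ t01; have := fM _ kn1; have := ler_normB (f t) (f (k%:R / n%:R)); lra.
  move/le_trans; apply; apply: (@le_trans _ _ (c * dl ^+ 2)).
    by rewrite /c mulfVK ?gt_eqF // exprn_gt0.
  apply: (@le_trans _ _ (c * (t - k%:R / n%:R) ^+ 2)); last by rewrite lerDr ltW.
  apply: ler_wpM2l => //.
  by rewrite -[leRHS]real_normK ?num_real // ler_pXn2r // nnegrE ltW.
have mb a b : bernoulli_mean n (fun k => a + b * (k%:R - n%:R * t) ^+ 2) t
    = a + b * (n%:R * t * (1 - t)).
  have -> : (fun k => a + b * (k%:R - n%:R * t) ^+ 2) =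
     (fun k => 1 * (fun=> a) k + b * (fun k : nat => (k%:R - n%:R * t) ^+ 2) k).
    by apply/funext => k; rewrite mul1r.
  by rewrite bernoulli_meanD bernoulli_mean_cst bernoulli_mean_sqr subrr; ring.
have ft : f t = bernoulli_mean n (fun=> f t) t by rewrite bernoulli_mean_cst.
have diffE : f t - bernoulli_mean n (fun k => f (k%:R / n%:R)) t =
    bernoulli_mean n (fun k => f t - f (k%:R / n%:R)) t.
  have -> : (fun k : nat => f t - f (k%:R / n%:R)) =
     (fun k => 1 * (fun=> f t) k + (-1) * (fun k : nat => f (k%:R / n%:R)) k).
    by apply/funext => k; ring.
  by rewrite bernoulli_meanD bernoulli_mean_cst; ring.
have bnd : e / 2 + c / n%:R ^+ 2 * (n%:R * t * (1 - t)) <= e.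
  have -> : c / n%:R ^+ 2 * (n%:R * t * (1 - t)) = c / n%:R * (t * (1 - t)).
    by field; rewrite gt_eqF.
  have tt : t * (1 - t) <= 1.
    by have /andP[t0 t1] := t01; rewrite mulr_ile1 ?subr_ge0 // lerBlDr lerDl.
  have : c / n%:R * (t * (1 - t)) <= e / 2.
    by rewrite (le_trans _ nM) // ler_piMr // divr_ge0 ?ler0n.
  lra.
rewrite diffE ler_norml; apply/andP; split; last first.
  apply: le_trans bnd; rewrite -mb; apply: bernoulli_mean_le => // k kn2.
  by rewrite (le_trans (ler_norm _)) // step.
rewrite lerNl; apply: le_trans bnd; rewrite -mb.
have -> : - bernoulli_mean n (fun k => f t - f (k%:R / n%:R)) t =
    bernoulli_mean n (fun k => 0 * (fun=> 0) k + (-1) * (fun k : nat => f t - f (k%:R / n%:R)) k) t.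
  by rewrite bernoulli_meanD; ring.
apply: bernoulli_mean_le => // k kn2.
by rewrite mul0r add0r mulN1r (le_trans (ler_norm _)) // normrN step.
Qed.

End weierstrass.

(** * From Stieltjes transforms to weak convergence *)

Section stieltjes_kernel.
Context {R : realType}.

Definition bcont (f : R -> R) := continuous f /\ exists C, forall x, `|f x| <= C.

Lemma bcont_cst c : bcont (fun=> c).
Proof. by split; [move=> x; exact: cvg_cst|exists `|c|]. Qed.

Lemma bcont_lin a b f g : bcont f -> bcont g -> bcont (fun x => a * f x + b * g x).
Proof.
move=> [cf [C fC]] [cg [D gD]]; split.
  by move=> x; apply: cvgD; apply: cvgMr; [exact: cf|exact: cg].
exists (`|a| * C + `|b| * D) => x.
by rewrite (le_trans (ler_normD _ _)) // !normrM lerD // ler_wpM2l.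
Qed.

Lemma bcontM f g : bcont f -> bcont g -> bcont (fun x => f x * g x).
Proof.
move=> [cf [C fC]] [cg [D gD]]; split.
  by move=> x; apply: cvgM; [exact: cf|exact: cg].
by exists (C * D) => x; rewrite normrM ler_pM.
Qed.

Lemma bcont_bmf (f : R -> R) : bcont f -> bmf (f : measurableTypeR R -> R).
Proof. by move=> [cf bf]; split => //; exact: continuous_measurable_fun. Qed.

(** [Num.max x 0] makes the kernel bounded and continuous on the whole line; nothing changes on the
    half-line that carries the spectra and the limit law. *)
Definition sker (z x : R) : R := (Num.max x 0 + z)^-1.

Lemma sker_gt0 z x : 0 < z -> 0 < sker z x.
Proof. by move=> z0; rewrite invr_gt0 ltr_wpDl // le_max lexx orbT. Qed.

Lemma sker_le z x : 0 < z -> sker z x <= z^-1.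
Proof.
move=> z0; have m0 : 0 <= Num.max x 0 by rewrite le_max lexx orbT.
by rewrite lef_pV2 ?posrE ?ltr_wpDl // lerDr.
Qed.

Lemma continuous_sker z : 0 < z -> continuous (sker z).
Proof.
move=> z0 x; apply: cvgV.
  by rewrite gt_eqF // ltr_wpDl // le_max lexx orbT.
apply: cvgD; last exact: cvg_cst.
by apply: continuous_max; [exact: cvg_id|exact: cvg_cst].
Qed.

Lemma bcont_sker z : 0 < z -> bcont (sker z).
Proof.
move=> z0; split; first exact: continuous_sker.
by exists z^-1 => x; rewrite ger0_norm ?sker_le // ltW // sker_gt0.
Qed.

Lemma sker_partial_fraction a b x : 0 < a -> 0 < b -> a != b ->
  sker a x * sker b x = (b - a)^-1 * (sker a x - sker b x).
Proof.
move=> a0 b0 ab; have m0 : 0 <= Num.max x 0 by rewrite le_max lexx orbT.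
have ba : b - a != 0 by rewrite subr_eq0 eq_sym.
by rewrite /sker; field; rewrite ba !gt_eqF ?ltr_wpDl.
Qed.

Lemma sker_dist a b x : 1 <= a -> a <= b -> `|sker b x - sker a x| <= b - a.
Proof.
move=> a1 ab; have m0 : 0 <= Num.max x 0 by rewrite le_max lexx orbT.
have a0 : 0 < a by rewrite (lt_le_trans _ a1).
have b0 : 0 < b by rewrite (lt_le_trans a0).
have le1 z : 1 <= z -> sker z x <= 1.
  move=> z1; rewrite (le_trans (sker_le _ _)) ?(lt_le_trans _ z1) //.
  by rewrite invf_le1 // (lt_le_trans _ z1).
have -> : sker b x - sker a x = - ((b - a) * (sker a x * sker b x)).
  by rewrite /sker; field; rewrite !gt_eqF ?ltr_wpDl.
have sa0 := ltW (sker_gt0 x a0); have sb0 := ltW (sker_gt0 x b0).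
have p0 : 0 <= sker a x * sker b x by exact: mulr_ge0.
rewrite normrN normrM ger0_norm ?subr_ge0 // ger0_norm //.
apply: ler_piMr; first by rewrite subr_ge0.
by apply: mulr_ile1 => //; apply: le1 => //; exact: le_trans ab.
Qed.

Definition skers (zs : seq R) (x : R) : R := \prod_(z <- zs) sker z x.

Lemma bcont_skers zs : (forall z, z \in zs -> 0 < z) -> bcont (skers zs).
Proof.
elim: zs => [|z zs IH] zs0.
  have -> : skers [::] = fun=> 1 by apply/funext => x; rewrite /skers big_nil.
  exact: bcont_cst.
have -> : skers (z :: zs) = fun x => sker z x * skers zs x.
  by apply/funext => x; rewrite /skers big_cons.
apply: bcontM; first by apply: bcont_sker; apply: zs0; rewrite mem_head.
by apply: IH => t tz; apply: zs0; rewrite inE tz orbT.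
Qed.

(** Partial fractions require distinct poles, whereas the power [sker 1 x ^+ k] has one multiple
    pole. Spreading the poles to [1, 1 + e, ...] costs at most [i e] in the factor with index [i],
    all factors being at most 1. *)
Lemma skers_approx k e x : 0 <= e ->
  `|skers [seq 1 + i%:R * e | i <- iota 0 k] x - sker 1 x ^+ k| <= k%:R ^+ 2 * e.
Proof.
move=> e0.
have s01 i : 0 <= sker (1 + i%:R * e) x <= 1.
  have z1 : 1 <= 1 + i%:R * e by rewrite lerDl mulr_ge0.
  have z0 : 0 < 1 + i%:R * e by rewrite (lt_le_trans _ z1).
  by rewrite ltW ?sker_gt0 //= (le_trans (sker_le _ z0)) // invf_le1.
have p01 n : 0 <= skers [seq 1 + i%:R * e | i <- iota 0 n] x <= 1.
  elim: n => [|n IH]; first by rewrite /skers big_nil ler01 lexx.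
  rewrite -addn1 iotaD map_cat /skers big_cat /= big_seq1 add0n -/(skers _ x).
  move: IH (s01 n) => /andP[h1 h2] /andP[h3 h4].
  by rewrite mulr_ge0 // mulr_ile1.
elim: k => [|k IH]; first by rewrite /skers big_nil expr0 subrr normr0 expr0n mul0r.
rewrite -addn1 iotaD map_cat /skers big_cat /= big_seq1 add0n -/(skers _ x).
rewrite addn1 exprSr.
set p := skers _ x; set s := sker _ x.
have -> : p * s - sker 1 x ^+ k * sker 1 x =
   p * (s - sker 1 x) + (p - sker 1 x ^+ k) * sker 1 x by ring.
have h1 : `|s - sker 1 x| <= k%:R * e.
  rewrite (le_trans (sker_dist _ _ _)) //; first by rewrite lerDl mulr_ge0.
  by rewrite addrAC subrr add0r.
have [p0 p1] := andP (p01 k).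
have [s0 s1] : 0 <= sker 1 x /\ sker 1 x <= 1.
  by have := s01 0%N; rewrite mul0r addr0 => /andP[].
rewrite (le_trans (ler_normD _ _)) // !normrM (ger0_norm p0) (ger0_norm s0).
have h2 : p * `|s - sker 1 x| <= k%:R * e.
  by apply: le_trans h1; rewrite ler_piMl.
have h3 : `|p - sker 1 x ^+ k| * sker 1 x <= k%:R ^+ 2 * e.
  by apply: le_trans IH; rewrite ler_piMr.
have ke : 0 <= k%:R * e by rewrite mulr_ge0.
by rewrite -natr1; nra.
Qed.

End stieltjes_kernel.

Section stieltjes_to_weak.
Context (R : realType) (disp : nat -> measure_display)
  (T : forall r, measurableType (disp r)) (P : forall r, probability (T r) R)
  (N : probability (measurableTypeR R) R) (M : R)
  (L : forall r, T r -> seq R) (n : nat -> nat).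
Hypothesis sizeL : forall r (w : T r), size (L w) = n r.
Hypothesis n_gt0 : forall r, (0 < r)%N -> (0 < n r)%N.
Hypothesis L_ge0 : forall r (w : T r) z, z \in L w -> 0 <= z.
Hypothesis L_measurable : forall r (f : R -> R), bcont f ->
  measurable_fun setT (fun w : T r => \sum_(z <- L w) f z).
Hypothesis M_ge0 : 0 <= M.
Hypothesis N_supp : forall f g : R -> R, bcont f -> bcont g ->
  (forall x, 0 <= x <= M -> f x = g x) -> Ex N f = Ex N g.

Definition smean r (f : R -> R) (w : T r) : R := (\sum_(z <- L w) f z) / (n r)%:R.
Definition dev r (f : R -> R) (w : T r) : R := smean f w - Ex N f.
Definition l1dev r f : R := Ex (P r) (fun w => `|dev f w|).
Definition l1cvg f := forall e : R, 0 < e -> \forall r \near \oo, l1dev r f <= e.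

Lemma smean_norm r f (w : T r) e :
  0 <= e -> (forall x, 0 <= x -> `|f x| <= e) -> `|smean f w| <= e.
Proof.
move=> e0 fe; rewrite /smean normrM normfV normr_nat.
have [->|n0] := posnP (n r); first by rewrite invr0 mulr0.
rewrite ler_pdivrMr ?ltr0n // (le_trans (ler_norm_sum _ _ _)) //.
rewrite mulr_natr -(sizeL w).
apply: (@le_trans _ _ (\sum_(z <- L w) e)).
  by rewrite big_seq [leRHS]big_seq; apply: ler_sum => z /L_ge0 /fe.
by rewrite big_const_seq count_predT iter_addr addr0.
Qed.

Lemma smean_lin r a b f g (w : T r) :
  smean (fun x => a * f x + b * g x) w = a * smean f w + b * smean g w.
Proof. by rewrite /smean big_split /= -!mulr_sumr; ring. Qed.

Lemma dev_lin r a b f g (w : T r) : bcont f -> bcont g ->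
  dev (fun x => a * f x + b * g x) w = a * dev f w + b * dev g w.
Proof.
move=> bf bg; rewrite /dev smean_lin.
have bf' := bcont_bmf bf; have bg' := bcont_bmf bg.
rewrite (@ExD _ _ _ N (fun x => a * f x) (fun x => b * g x)); last 2 first.
- by apply: bmfM => //; exact: bmf_cst.
- by apply: bmfM => //; exact: bmf_cst.
by rewrite !ExZ //; ring.
Qed.

Lemma bmf_dev r f : bcont f -> bmf (fun w : T r => dev f w).
Proof.
move=> bf; apply: bmfB; last exact: bmf_cst.
split; first by apply: measurable_funM => //; exact: L_measurable.
have [C fC] := bf.2; exists `|C| => w; apply: smean_norm => // x _.
by rewrite (le_trans (fC x)) // ler_norm.
Qed.

Lemma l1dev_lin r a b f g : bcont f -> bcont g ->
  l1dev r (fun x => a * f x + b * g x) <= `|a| * l1dev r f + `|b| * l1dev r g.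
Proof.
move=> bf bg; have bF := bmf_norm (bmf_dev r bf); have bG := bmf_norm (bmf_dev r bg).
rewrite /l1dev -!ExZ // -ExD; last 2 first.
- by apply: bmfM => //; exact: bmf_cst.
- by apply: bmfM => //; exact: bmf_cst.
apply: le_Ex => [||w].
- by apply: bmf_norm; apply: bmf_dev; exact: bcont_lin.
- by apply: bmfD; apply: bmfM => //; exact: bmf_cst.
- by rewrite dev_lin // (le_trans (ler_normD _ _)) // !normrM.
Qed.

Lemma l1dev_small r f e : bcont f -> 0 <= e -> (forall x, `|f x| <= e) -> l1dev r f <= 2 * e.
Proof.
move=> bf e0 fe; apply: Ex_le_cst => [|w]; first by apply: bmf_norm; exact: bmf_dev.
have h1 : `|smean f w| <= e by exact: smean_norm.
have h2 : `|Ex N f| <= e.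
  apply: le_trans (norm_Ex_le _ (bcont_bmf bf)) _.
  by apply: Ex_le_cst => //; apply: bmf_norm; exact: bcont_bmf.
apply: le_trans (ler_normB _ _) _; move: h1 h2; move: `|_| `|_| => a b h1 h2.
by lra.
Qed.

Lemma l1cvg_lin a b f g : bcont f -> bcont g -> l1cvg f -> l1cvg g ->
  l1cvg (fun x => a * f x + b * g x).
Proof.
move=> bf bg cf cg e e0.
have ea : 0 < e / 2 / (`|a| + 1) by rewrite !divr_gt0 // ltr_wpDl.
have eb : 0 < e / 2 / (`|b| + 1) by rewrite !divr_gt0 // ltr_wpDl.
have ha := cf _ ea; have hb := cg _ eb; near=> r.
apply: le_trans (l1dev_lin r a b bf bg) _.
have half (u : R) x : x <= e / 2 / (`|u| + 1) -> `|u| * x <= e / 2.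
  rewrite ler_pdivlMr ?ltr_wpDl // => h.
  have u0 := normr_ge0 u; have [x0|x0] := leP 0 x; first by nra.
  by rewrite (@le_trans _ _ 0) ?mulr_ge0_le0 ?(ltW x0) // divr_ge0 // ltW.
rewrite [leRHS]splitr lerD // half //; by near: r.
Unshelve. all: by end_near. Qed.

Lemma l1cvg_approx f : bcont f ->
  (forall e, 0 < e -> exists2 g, bcont g /\ l1cvg g & forall x, `|f x - g x| <= e) -> l1cvg f.
Proof.
move=> bf H e e0; have e4 : 0 < e / 4 by rewrite divr_gt0.
have [g [bg cg] fg] := H _ e4.
have e2 : 0 < e / 2 by rewrite divr_gt0.
have hg := cg _ e2; near=> r.
have -> : f = fun x => 1 * (f x - g x) + 1 * g x.
  by apply/funext => x; ring.
have bfg : bcont (fun x => f x - g x).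
  have -> : (fun x => f x - g x) = fun x => 1 * f x + (-1) * g x by apply/funext => x; ring.
  exact: bcont_lin.
apply: le_trans (l1dev_lin r 1 1 bfg bg) _; rewrite normr1 !mul1r.
have h1 := l1dev_small r bfg (ltW e4) fg.
have h2 : l1dev r g <= e / 2 by near: r.
by lra.
Unshelve. all: by end_near. Qed.

Lemma eq_l1cvg f g : f =1 g -> l1cvg f -> l1cvg g.
Proof. by move=> /funext ->. Qed.

Lemma dev_cst1 r (w : T r) : (0 < r)%N -> dev (fun=> 1) w = 0.
Proof.
move=> r0; rewrite /dev /smean Ex_cst big_const_seq count_predT iter_addr addr0 sizeL.
by rewrite divff ?subrr // pnatr_eq0 -lt0n n_gt0.
Qed.

Lemma l1cvg_cst1 : l1cvg (fun=> 1).
Proof.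
move=> e e0; exists 1%N => // r /= r0.
rewrite /l1dev (_ : (fun w => _) = fun=> 0) ?Ex_cst ?ltW //.
by apply/funext => w; rewrite dev_cst1 // normr0.
Qed.

Hypothesis stieltjes_cvg : forall z : R, 0 < z -> l1cvg (sker z).

(** A product of two kernels is a multiple of their difference, so a product with poles [a, b, ...]
    is a combination of two products with one pole less. Distinctness keeps [b - a] invertible. *)
Lemma l1cvg_skers zs : zs != [::] -> uniq zs -> (forall z, z \in zs -> 0 < z) ->
  l1cvg (skers zs).
Proof.
have [m] := ubnP (size zs); elim: m zs => // m IH [//|a [|b zs]] szs _ uzs pzs.
  apply: eq_l1cvg (stieltjes_cvg (pzs a _)) => [x|]; last exact: mem_head.
  by rewrite /skers big_seq1.
have a0 : 0 < a by rewrite pzs // mem_head.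
have b0 : 0 < b by rewrite pzs // !inE eqxx orbT.
move: uzs => /= /andP[]; rewrite inE negb_or => /andP[ab azs] /andP[bzs uzs].
have paz z : z \in a :: zs -> 0 < z.
  by rewrite inE => /orP[/eqP -> //|zz]; apply: pzs; rewrite !inE zz !orbT.
have pbz z : z \in b :: zs -> 0 < z.
  by rewrite inE => /orP[/eqP -> //|zz]; apply: pzs; rewrite !inE zz !orbT.
have ca : l1cvg (skers (a :: zs)) by apply: IH => //=; rewrite azs.
have cb : l1cvg (skers (b :: zs)) by apply: IH => //=; rewrite bzs.
apply: eq_l1cvg (l1cvg_lin (b - a)^-1 (- (b - a)^-1) (bcont_skers paz) (bcont_skers pbz) ca cb).
move=> x; rewrite /skers !big_cons [RHS]mulrA sker_partial_fraction //; ring.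
Qed.

Lemma bcont_sker_exp k : bcont (fun x : R => sker 1 x ^+ k).
Proof.
elim: k => [|k IH].
  have -> : (fun x : R => sker 1 x ^+ 0) = fun=> 1 by apply/funext => x; rewrite expr0.
  exact: bcont_cst.
have -> : (fun x : R => sker 1 x ^+ k.+1) = fun x => sker 1 x * sker 1 x ^+ k.
  by apply/funext => x; rewrite exprS.
by apply: bcontM => //; exact: bcont_sker.
Qed.

Lemma l1cvg_sker_exp k : l1cvg (fun x => sker 1 x ^+ k).
Proof.
case: k => [|k]; first by apply: eq_l1cvg l1cvg_cst1 => x; rewrite expr0.
apply: l1cvg_approx; first exact: bcont_sker_exp.
move=> e e0; pose e' := e / k.+1%:R ^+ 2.
have e'0 : 0 < e' by rewrite divr_gt0 // exprn_gt0.
pose zs := [seq 1 + i%:R * e' | i <- iota 0 k.+1].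
have pzs z : z \in zs -> 0 < z.
  by move=> /mapP[i _ ->]; rewrite ltr_pwDl // mulr_ge0 // ltW.
exists (skers zs).
  split; first exact: bcont_skers.
  apply: l1cvg_skers => //.
  rewrite map_inj_uniq ?iota_uniq // => i j /addrI/(mulIf (lt0r_neq0 e'0))/eqP.
  by rewrite eqr_nat => /eqP.
move=> x; rewrite distrC (le_trans (skers_approx _ _ (ltW e'0))) //.
by rewrite /e' mulrC mulfVK // expf_neq0 // pnatr_eq0.
Qed.

Lemma l1cvg_poly (p : {poly R}) :
  bcont (fun x => p.[sker 1 x]) /\ l1cvg (fun x => p.[sker 1 x]).
Proof.
suff H m : bcont (fun x => \sum_(i < m) p`_i * sker 1 x ^+ i) /\
    l1cvg (fun x => \sum_(i < m) p`_i * sker 1 x ^+ i).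
  have [h1 h2] := H (size p).
  have E : (fun x => p.[sker 1 x]) = fun x => \sum_(i < size p) p`_i * sker 1 x ^+ i.
    by apply/funext => x; rewrite horner_coef.
  by rewrite E.
elim: m => [|m [IHb IHc]].
  have E : (fun x => \sum_(i < 0) p`_i * sker 1 x ^+ i) = fun x => 0 * (fun=> 1) x + 0 * (fun=> 1) x.
    by apply/funext => x; rewrite big_ord0; ring.
  rewrite E; split; first exact: (bcont_lin 0 0 (bcont_cst 1) (bcont_cst 1)).
  exact: (l1cvg_lin 0 0 (bcont_cst 1) (bcont_cst 1) l1cvg_cst1 l1cvg_cst1).
have E : (fun x => \sum_(i < m.+1) p`_i * sker 1 x ^+ i) =
    fun x => 1 * (\sum_(i < m) p`_i * sker 1 x ^+ i) + p`_m * sker 1 x ^+ m.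
  by apply/funext => x; rewrite big_ord_recr mul1r.
rewrite E; split; first exact: (bcont_lin 1 p`_m IHb (bcont_sker_exp m)).
exact: (l1cvg_lin 1 p`_m IHb (bcont_sker_exp m) IHc (l1cvg_sker_exp m)).
Qed.

Lemma l1cvg_comp_sker (phi : R -> R) : continuous phi ->
  bcont (fun x => phi (sker 1 x)) /\ l1cvg (fun x => phi (sker 1 x)).
Proof.
move=> cphi.
have s01 (x : R) : 0 <= sker 1 x <= 1.
  by rewrite ltW ?sker_gt0 //= (le_trans (sker_le _ _)) // invr1.
have bphi : bcont (fun x => phi (sker 1 x)).
  split; first by move=> x; apply: continuous_comp; [exact: continuous_sker|exact: cphi].
  have [p Hp] := weierstrass01 cphi ltr01.
  have [[_ [C pC]] _] := l1cvg_poly p.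
  exists (1 + C) => x.
  have -> : phi (sker 1 x) = (phi (sker 1 x) - p.[sker 1 x]) + p.[sker 1 x] by ring.
  by rewrite (le_trans (ler_normD _ _)) // lerD // Hp.
split => //; apply: l1cvg_approx => // e e0.
have [p Hp] := weierstrass01 cphi e0.
by exists (fun x => p.[sker 1 x]); [exact: l1cvg_poly|move=> x; exact: Hp].
Qed.

(** In the variable [t = 1 / (1 + x)] infinity becomes [t = 0], where [f] need not extend
    continuously. A cutoff [h] removes a neighbourhood of 0; the spectral mass lost is controlled
    because [h] is itself an admissible test function and its mean under [N] is 1. *)
Theorem stieltjes_l1cvg f : bcont f -> l1cvg f.
Proof.
move=> bf; have [cf [C0 fC0]] := bf.
pose C := `|C0|; have fC x : `|f x| <= C by rewrite (le_trans (fC0 x)) // ler_norm.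
have C_ge0 : 0 <= C by exact: normr_ge0.
(* [h] below rises from 0 at [dl] to 1 at [2 dl = 1 / (1 + M)], the image of the right end [M] of
   the support. *)
pose dl := (2 * (1 + M))^-1.
have M1 : 0 < 1 + M by rewrite ltr_pwDl.
have dl0 : 0 < dl by rewrite invr_gt0 mulr_gt0.
pose h (t : R) := Num.min 1 (Num.max 0 ((t - dl) / dl)).
have ch : continuous h.
  move=> t; apply: (@continuous_min _ _ (cst 1) (cst 0 \max (fun t => (t - dl) / dl))).
    exact: cvg_cst.
  apply: continuous_max; first exact: cvg_cst.
  by apply: cvgMl; apply: cvgB; [exact: cvg_id|exact: cvg_cst].
have h01 t : 0 <= h t <= 1.
  by rewrite /h le_min ler01 le_max lexx /= ge_min lexx.
(* For [t > dl] the value [t^-1 - 1] recovers [x]; for [t <= dl] the factor [h t] vanishes, so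
   [Num.max t dl] serves continuity at [t = 0] and does not affect the value. *)
pose phi t := f ((Num.max t dl)^-1 - 1) * h t.
have cphi : continuous phi.
  move=> t; apply: cvgM; last exact: ch.
  apply: (@continuous_comp _ _ _ (fun t => (Num.max t dl)^-1 - 1) f); last exact: cf.
  apply: cvgB; last exact: cvg_cst.
  apply: cvgV; first by rewrite gt_eqF // lt_max dl0 orbT.
  by apply: (@continuous_max _ _ id (cst dl)); [exact: cvg_id|exact: cvg_cst].
have [bF cF] := l1cvg_comp_sker cphi; have [bH cH] := l1cvg_comp_sker ch.
have FE x : 0 <= x -> phi (sker 1 x) = f x * h (sker 1 x).
  move=> x0; rewrite /phi; have [tdl|dlt] := leP (sker 1 x) dl.
    have -> : h (sker 1 x) = 0.
      rewrite /h max_l ?min_r //.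
      by rewrite ler_pdivrMr // mul0r subr_le0.
    by rewrite !mulr0.
  by rewrite /sker invrK max_l // addrK.
have hM x : 0 <= x <= M -> h (sker 1 x) = 1.
  move=> /andP[x0 xM]; rewrite /h min_l // le_max; apply/orP; right.
  have x1 : 0 < x + 1 by rewrite ltr_wpDl.
  rewrite ler_pdivlMr // mul1r lerBrDr -mulr2n -mulr_natl /sker max_l //.
  rewrite /dl invfM mulrA mulfV // mul1r lef_pV2 ?posrE //.
  by rewrite addrC lerD2l.
have NF : Ex N f = Ex N (fun x => phi (sker 1 x)).
  apply: N_supp => // x /[dup] /hM hx /andP[x0 _].
  by rewrite FE // hx mulr1.
have NH : Ex N (fun x => h (sker 1 x)) = 1.
  by rewrite -[RHS](Ex_cst N); apply: N_supp => //; exact: bcont_cst.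
(* On nonnegative points [|f - f h| <= C (1 - h)], and the spectral mean of [1 - h] is minus the
   deviation of [h]. *)
have key r : (0 < r)%N ->
    l1dev r f <= l1dev r (fun x => phi (sker 1 x)) + C * l1dev r (fun x => h (sker 1 x)).
  move=> r0.
  have bdf := bmf_norm (bmf_dev r bf).
  have bdF := bmf_norm (bmf_dev r bF).
  have bdH := bmf_norm (bmf_dev r bH).
  have bdCH : bmf (fun w => C * `|dev (r := r) (fun x => h (sker 1 x)) w|).
    by apply: bmfM => //; exact: bmf_cst.
  rewrite /l1dev -ExZ // -ExD //; apply: le_Ex => // [|w]; first exact: bmfD.
  have -> : dev f w = dev (fun x => phi (sker 1 x)) w +
      smean (fun x => 1 * f x + (-1) * phi (sker 1 x)) w.
    by rewrite smean_lin /dev NF; ring.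
  rewrite (le_trans (ler_normD _ _)) // lerD2l.
  have -> : dev (fun x => h (sker 1 x)) w = - smean (fun x => 1 * (fun=> 1) x + (-1) * h (sker 1 x)) w.
    have := dev_cst1 w r0; rewrite /dev Ex_cst smean_lin NH => /eqP.
    by rewrite subr_eq0 => /eqP ->; ring.
  rewrite normrN /smean !normrM mulrA ler_wpM2r //.
  rewrite (le_trans (ler_norm_sum _ _ _)) //.
  rewrite [X in _ <= _ * X]ger0_norm; last first.
    by apply: sumr_ge0 => z _; have /andP[_] := h01 (sker 1 z); lra.
  rewrite mulr_sumr big_seq [leRHS]big_seq; apply: ler_sum => z /L_ge0 z0.
  rewrite FE // mul1r mulN1r -[X in `|X - _|]mulr1 -mulrBr normrM.
  have /andP[_ h1] := h01 (sker 1 z).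
  rewrite [X in _ * X <= _]ger0_norm ?subr_ge0 // mul1r mulN1r.
  by rewrite ler_wpM2r ?subr_ge0.
move=> e e0; have e2 : 0 < e / 2 by rewrite divr_gt0.
have eC : 0 < e / 2 / (C + 1) by rewrite divr_gt0 // ltr_wpDl.
have hF := cF _ e2; have hH := cH _ eC; near=> r.
have r0 : (0 < r)%N by near: r; exists 1%N.
apply: le_trans (key r r0) _; rewrite [leRHS]splitr lerD //; first by near: r.
have : l1dev r (fun x => h (sker 1 x)) <= e / 2 / (C + 1) by near: r.
rewrite ler_pdivlMr ?ltr_wpDl // mulrC => hh.
have : 0 <= l1dev r (fun x => h (sker 1 x)) by apply: Ex_ge0.
nra.
Unshelve. all: by end_near. Qed.

End stieltjes_to_weak.

(** * Measurability of matrix functions *)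

Section measurable_matrix.
Context dd (T : measurableType dd) (R : realType).

Lemma eq_mf (f g : T -> R) : f =1 g -> measurable_fun setT f -> measurable_fun setT g.
Proof. by move=> /funext ->. Qed.

Lemma measurable_big_sum (I : Type) (s : seq I) (Q : pred I) (F : I -> T -> R) :
  (forall i, Q i -> measurable_fun setT (F i)) ->
  measurable_fun setT (fun w => \sum_(i <- s | Q i) F i w).
Proof.
move=> mF; elim: s => [|i s IH].
  by apply: (@eq_mf (cst 0)) => [w|]; [rewrite big_nil|exact: measurable_cst].
have [Qi|Qi] := boolP (Q i); last first.
  by apply: eq_mf IH => w; rewrite big_cons (negPf Qi).
by apply: eq_mf (measurable_funD (mF _ Qi) IH) => w; rewrite big_cons Qi.
Qed.

Lemma measurable_big_prod (I : Type) (s : seq I) (Q : pred I) (F : I -> T -> R) :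
  (forall i, Q i -> measurable_fun setT (F i)) ->
  measurable_fun setT (fun w => \prod_(i <- s | Q i) F i w).
Proof.
move=> mF; elim: s => [|i s IH].
  by apply: (@eq_mf (cst 1)) => [w|]; [rewrite big_nil|exact: measurable_cst].
have [Qi|Qi] := boolP (Q i); last first.
  by apply: eq_mf IH => w; rewrite big_cons (negPf Qi).
by apply: eq_mf (measurable_funM (mF _ Qi) IH) => w; rewrite big_cons Qi.
Qed.

Definition mfmx m n (M : T -> 'M[R]_(m, n)) :=
  forall i j, measurable_fun setT (fun w => M w i j).

Lemma eq_mfmx m n (M N : T -> 'M[R]_(m, n)) : M =1 N -> mfmx M -> mfmx N.
Proof. by move=> /funext ->. Qed.

Lemma mfmx_cst m n (A : 'M[R]_(m, n)) : mfmx (fun=> A).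
Proof. by move=> i j; exact: measurable_cst. Qed.

Lemma mfmxD m n (M N : T -> 'M[R]_(m, n)) : mfmx M -> mfmx N -> mfmx (fun w => M w + N w).
Proof.
move=> mM mN i j; apply: eq_mf (measurable_funD (mM i j) (mN i j)) => w.
by rewrite mxE.
Qed.

Lemma mfmxM m n p (M : T -> 'M[R]_(m, n)) (N : T -> 'M[R]_(n, p)) :
  mfmx M -> mfmx N -> mfmx (fun w => M w *m N w).
Proof.
move=> mM mN i j.
apply: (@eq_mf (fun w => \sum_k M w i k * N w k j)) => [w|].
  by rewrite mxE.
by apply: measurable_big_sum => k _; exact: measurable_funM.
Qed.

Lemma mfmx_tr m n (M : T -> 'M[R]_(m, n)) : mfmx M -> mfmx (fun w => (M w)^T).
Proof.
by move=> mM i j; apply: eq_mf (mM j i) => w; rewrite mxE.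
Qed.

Lemma mfmxZ m n (a : T -> R) (M : T -> 'M[R]_(m, n)) :
  measurable_fun setT a -> mfmx M -> mfmx (fun w => a w *: M w).
Proof.
move=> ma mM i j; apply: eq_mf (measurable_funM ma (mM i j)) => w.
by rewrite mxE.
Qed.

Lemma mfmx_sum m n (I : Type) (s : seq I) (Q : pred I) (F : I -> T -> 'M[R]_(m, n)) :
  (forall i, Q i -> mfmx (F i)) -> mfmx (fun w => \sum_(i <- s | Q i) F i w).
Proof.
move=> mF i j.
apply: (@eq_mf (fun w => \sum_(k <- s | Q k) F k w i j)) => [w|].
  by rewrite summxE.
by apply: measurable_big_sum => k Qk; exact: mF.
Qed.

Lemma mfmx_exp n (M : T -> 'M[R]_n) k : mfmx M -> mfmx (fun w => M w ^+ k).
Proof.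
move=> mM; elim: k => [|k IH].
  by apply: eq_mfmx (mfmx_cst 1%:M) => w; rewrite expr0.
by apply: eq_mfmx (mfmxM mM IH) => w; rewrite exprS.
Qed.

Lemma measurable_trace n (M : T -> 'M[R]_n) : mfmx M -> measurable_fun setT (fun w => \tr (M w)).
Proof. by move=> mM; apply: measurable_big_sum => i _; exact: mM. Qed.

Lemma measurable_det n (M : T -> 'M[R]_n) : mfmx M -> measurable_fun setT (fun w => \det (M w)).
Proof.
move=> mM; apply: measurable_big_sum => s _; apply: measurable_funM => //.
by apply: measurable_big_prod => i _; exact: mM.
Qed.

Lemma mfmx_adj n (M : T -> 'M[R]_n) : mfmx M -> mfmx (fun w => \adj (M w)).
Proof.
move=> mM i j.
apply: (@eq_mf (fun w => cofactor (M w) j i)) => [w|].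
  by rewrite mxE.
apply: measurable_funM => //; apply: measurable_det => a b.
apply: (@eq_mf (fun w => M w (lift j a) (lift i b))) => [w|//].
by rewrite !mxE.
Qed.

(** Cramer's rule: entries of the inverse are cofactors divided by the determinant. *)
Lemma mfmx_resolvent n x (M : T -> 'M[R]_n) : 0 < x -> (forall w, psdmx (M w)) ->
  mfmx M -> mfmx (fun w => resolvent x (M w)).
Proof.
move=> x0 pM mM.
have mS : mfmx (fun w => M w + x%:M) by apply: mfmxD => //; exact: mfmx_cst.
apply: eq_mfmx (mfmxZ (measurable_funV (measurable_det mS)) (mfmx_adj mS)) => w.
by rewrite /resolvent /invmx (unitmx_shift (pM w) x0).
Qed.

Lemma measurable_dotv n (u v : T -> 'cV[R]_n) : mfmx u -> mfmx v ->
  measurable_fun setT (fun w => dotv (u w) (v w)).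
Proof.
by move=> mu mv; apply: measurable_big_sum => i _; apply: measurable_funM; [exact: mu|exact: mv].
Qed.

(** For a polynomial the sum is a combination of traces of powers. A continuous [f] is the pointwise
    limit of polynomials close to it on [[-(m+1), m+1]], an interval that eventually contains the
    finitely many eigenvalues of a given matrix. *)
Lemma measurable_sum_eigenvalues n (M : T -> 'M[R]_n) (f : R -> R) :
  (forall w, (M w)^T = M w) -> mfmx M -> continuous f ->
  measurable_fun setT (fun w => \sum_(z <- eigenvalues (M w)) f z).
Proof.
move=> sM mM cf.
have mpoly (p : {poly R}) : measurable_fun setT (fun w => \sum_(z <- eigenvalues (M w)) p.[z]).
  apply: (@eq_mf (fun w => \sum_(i < size p) p`_i * \tr (M w ^+ i))) => [w|].
    under [RHS]eq_bigr do rewrite horner_coef.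
    rewrite exchange_big /=; apply: eq_bigr => i _.
    by rewrite -mulr_sumr sum_eigenvalues_exp.
  apply: measurable_big_sum => i _; apply: measurable_funM => //.
  by apply: measurable_trace; exact: mfmx_exp.
have approx (m : nat) : exists p : {poly R}, forall z : R, `|z| <= m.+1%:R -> `|f z - p.[z]| <= m.+1%:R^-1.
  have a0 : 0 < m.+1%:R :> R by rewrite ltr0n.
  have cg : continuous (fun t : R => f (2 * m.+1%:R * t - m.+1%:R)).
    move=> t; apply: (@continuous_comp _ _ _ (fun t : R => 2 * m.+1%:R * t - m.+1%:R) f); last exact: cf.
    by apply: cvgB; [apply: cvgMr; exact: cvg_id|exact: cvg_cst].
  have [p Hp] := @weierstrass01 R _ m.+1%:R^-1 cg ltac:(by rewrite invr_gt0).
  (* The affine substitution carries [[-(m+1), m+1]] to [[0, 1]]. *)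
  exists (p \Po ((2 * m.+1%:R)^-1 *: 'X + (2^-1)%:P)) => z.
  rewrite ler_norml => /andP[z1 z2].
  have := Hp ((2 * m.+1%:R)^-1 * z + 2^-1).
  rewrite horner_comp !hornerE.
  have -> : 2 * m.+1%:R * ((2 * m.+1%:R)^-1 * z + 2^-1) - m.+1%:R = z.
    by move: (m.+1%:R : R) a0 => a a0; field; rewrite gt_eqF.
  apply; rewrite mulrC; apply/andP; split.
    have : - 2^-1 <= z / (2 * m.+1%:R) by rewrite ler_pdivlMr ?mulr_gt0 //; lra.
    by move: (z / _) => u; lra.
  have : z / (2 * m.+1%:R) <= 2^-1 by rewrite ler_pdivrMr ?mulr_gt0 //; lra.
  by move: (z / _) => u; lra.
have [p Hp] := choice approx.
apply: (@measurable_fun_cvg _ _ _ _ (fun m w => \sum_(z <- eigenvalues (M w)) (p m).[z])) => [m|w _].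
  exact: mpoly.
have pf z : (p m).[z] @[m --> \oo] --> f z; last first.
  elim: (eigenvalues (M w)) => [|z s IH].
    by under eq_fun do rewrite big_nil; rewrite big_nil; exact: cvg_cst.
  under eq_fun do rewrite big_cons; rewrite big_cons.
  by apply: cvgD; [exact: pf|exact: IH].
apply/cvgrPdist_le => e e0; near=> m.
have zm : `|z| <= m.+1%:R.
  rewrite (@le_trans _ _ m%:R) ?ler_nat //; near: m; exact: nbhs_infty_ger.
apply: le_trans (Hp m z zm) _.
rewrite -[leRHS]invrK lef_pV2 ?posrE ?invr_gt0 // (@le_trans _ _ m%:R) ?ler_nat //.
by near: m; exact: nbhs_infty_ger.
Unshelve. all: by end_near. Qed.

End measurable_matrix.

(** * Independence *)

Section product_rule.
Context dd (T : measurableType dd) (R : realType) (P : probability T R).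
Implicit Types (U V : T -> R).

Lemma clamp_id (C x : R) : `|x| <= C -> Num.max (- C) (Num.min C x) = x.
Proof.
rewrite ler_norml => /andP[x1 x2].
by rewrite (min_idPr x2) (max_idPr x1).
Qed.

Lemma bcont_clamp (C x : R) : 0 <= C -> `|Num.max (- C) (Num.min C x)| <= C.
Proof.
move=> C0; rewrite ler_norml le_max lexx /= ge_max ge_min lexx /= andbT.
by rewrite (le_trans _ C0) // oppr_le0.
Qed.

Lemma measurable_clamp (C : R) :
  measurable_fun setT (fun x : R => Num.max (- C) (Num.min C x)).
Proof. by apply: measurable_maxr => //; apply: measurable_minr. Qed.

(** Independence says that the joint law agrees with the product of the marginals on rectangles,
    hence everywhere; Fubini then splits the integral. *)
Lemma Ex_mul_indep U V : bmf U -> bmf V ->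
  (forall A B, measurable A -> measurable B ->
     P (U @^-1` A `&` V @^-1` B) = (P (U @^-1` A) * P (V @^-1` B))%E) ->
  Ex P (fun w => U w * V w) = Ex P U * Ex P V.
Proof.
move=> bU bV UV; have bUV := bmfM bU bV.
have [mU [C1 UC]] := bU; have [mV [C2 VC]] := bV.
pose C := `|C1| + `|C2|.
have C0 : 0 <= C by rewrite addr_ge0.
have {}UC w : `|U w| <= C by rewrite (le_trans (UC w)) // (le_trans (ler_norm _)) // lerDl.
have {}VC w : `|V w| <= C by rewrite (le_trans (VC w)) // (le_trans (ler_norm _)) // lerDr.
(* The product of the coordinates is unbounded on the plane. Clamping at a common bound changes
   nothing on the ranges of [U] and [V] and makes the integrand integrable for the product law. *)
pose cl (x : R) := Num.max (- C) (Num.min C x).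
have mcl : measurable_fun setT cl by exact: measurable_clamp.
pose X : {RV P >-> R} := HB.pack U (isMeasurableFun.Build _ _ _ _ U mU).
pose Y : {RV P >-> R} := HB.pack V (isMeasurableFun.Build _ _ _ _ V mV).
have mXY : measurable_fun setT (fun w => (U w, V w)) by exact: measurable_fun_pair.
pose XY := mfun_Sub (mem_set mXY).
pose f (z : R * R) : \bar R := (cl z.1 * cl z.2)%:E.
have mf : measurable_fun setT f.
  apply/measurable_EFinP; apply: measurable_funM.
    by apply: measurableT_comp => //; exact: measurable_fst.
  by apply: measurableT_comp => //; exact: measurable_snd.
have joint (Z : set (R * R)) : measurable Z ->
    (distribution P X \x distribution P Y)%E Z = distribution P XY Z.
  by apply: product_measure_unique => A B mA mB; exact: UV.
have fi : (distribution P X \x distribution P Y)%E.-integrable setT f.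
  apply/integrableP; split => //.
  apply: (@le_lt_trans _ _ (\int[(distribution P X \x distribution P Y)%E]_z (cst (C * C)%:E z))%E).
    apply: ge0_le_integral => //.
    - by apply: measurableT_comp.
    - move=> z _; rewrite lee_fin normrM ler_pM //; exact: bcont_clamp.
  have PT : (distribution P X \x distribution P Y)%E setT = 1%E.
    by rewrite joint // /distribution /pushforward preimage_setT probability_setT.
  have -> : (\int[(distribution P X \x distribution P Y)%E]_z (cst (C * C)%:E z) = (C * C)%:E * 1)%E.
    by rewrite -PT; exact: integral_cst.
  by rewrite mule1 ltry.
apply: EFin_inj; rewrite ExE //.
transitivity (\int[P]_w (f \o XY) w)%E.
  by apply: eq_integral => w _; rewrite /f /= /cl !clamp_id.
rewrite -integral_distribution //; last first.
  apply: eq_integrable (bmf_integrable P bUV) => // w _.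
  by rewrite /f /= /cl !clamp_id.
transitivity (\int[(distribution P X \x distribution P Y)%E]_z f z)%E.
  by apply: eq_measure_integral => Z mZ _; first [exact: joint|exact/esym/joint].
rewrite -integral12_prod_meas1 // /fubini_F.
have cl_le (x : R) : `|cl x| <= C by exact: bcont_clamp.
have EY (x : R) : (\int[distribution P Y]_y f (x, y) = (cl x * Ex P V)%:E)%E.
  transitivity (\int[P]_w ((fun y => f (x, y)) \o Y) w)%E.
    apply: integral_distribution.
      by apply/measurable_EFinP; exact: (measurable_funM (measurable_cst (cl x)) mcl).
    apply: (bmf_integrable P (f := fun w => cl x * cl (V w))).
    apply: bmfM; first exact: bmf_cst.
    by split; [exact: measurableT_comp|exists C => w; exact: cl_le].
  rewrite -ExZ // ExE; last by apply: bmfM => //; exact: bmf_cst.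
  by apply: eq_integral => w _; rewrite /f /= /cl (clamp_id (VC w)).
under eq_integral do rewrite EY.
transitivity (\int[P]_w ((fun x => (cl x * Ex P V)%:E) \o X) w)%E.
  apply: integral_distribution.
    by apply/measurable_EFinP; exact: (measurable_funM mcl (measurable_cst (Ex P V))).
  apply: (bmf_integrable P (f := fun w => cl (U w) * Ex P V)).
  apply: bmfM; last exact: bmf_cst.
  by split; [exact: measurableT_comp|exists C => w; exact: cl_le].
rewrite mulrC -ExZ // ExE; last by apply: bmfM => //; exact: bmf_cst.
by apply: eq_integral => w _; rewrite /= /cl (clamp_id (UC w)) mulrC.
Qed.

Lemma indep_sigma_ext (A : set T) (G : set (set T)) : measurable A ->
  G `<=` measurable -> G setT -> setI_closed G ->
  (forall C, G C -> P (A `&` C) = (P A * P C)%E) ->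
  forall C, <<s G >> C -> P (A `&` C) = (P A * P C)%E.
Proof.
move=> mA Gm GT GI AG C GC.
have PA : P A \is a fin_num by exact: fin_num_measure.
have PA0 : (0 <= fine (P A)) by apply: fine_ge0.
pose m1 := mrestr P mA.
pose m2 := mscale (NngNum PA0) P.
have := @g_sigma_algebra_measure_unique _ R T G Gm (fun=> setT) (fun=> GT) _ m1 m2 GI.
have m1E B : P (A `&` B) = m1 B by rewrite /m1 /mrestr setIC.
rewrite m1E.
have m2E B : (P A * P B)%E = m2 B by rewrite -{1}(fineK PA).
rewrite m2E.
apply => //.
- by apply/seteqP; split => // x _; exists 0%N.
- move=> B GB; transitivity (P A * P B)%E; last exact: m2E.
  by rewrite -AG //; exact/esym/m1E.
- move=> _; have : (P (A `&` setT) < +oo)%E.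
    by rewrite setIT -ge0_fin_numE.
  by rewrite m1E.
Qed.

Lemma indep_sigma_ext2 (F G : set (set T)) :
  F `<=` measurable -> F setT -> setI_closed F ->
  G `<=` measurable -> G setT -> setI_closed G ->
  (forall A B, F A -> G B -> P (A `&` B) = (P A * P B)%E) ->
  forall A B, <<s F >> A -> <<s G >> B -> P (A `&` B) = (P A * P B)%E.
Proof.
move=> Fm FT FI Gm GT GI FG A B FA GB.
have sFm := smallest_sub (@sigma_algebra_measurable _ T) Fm.
have sGm := smallest_sub (@sigma_algebra_measurable _ T) Gm.
rewrite setIC muleC; apply: (indep_sigma_ext (sGm _ GB) Fm FT FI) => // C FC.
rewrite setIC muleC; apply: (indep_sigma_ext (Fm _ FC) Gm GT GI) => // D GD.
exact: FG.
Qed.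

Lemma bmf_sub_sigma (G : set (set T)) (U : T -> R) : G `<=` measurable ->
  bmf (U : g_sigma_algebraType G -> R) -> bmf U.
Proof.
move=> Gm [mU bU]; split => // _ B mB.
have sGm := smallest_sub (@sigma_algebra_measurable _ T) Gm.
by apply: sGm; have := mU measurableT B mB.
Qed.

Lemma Ex_mul_indep_sigma (F G : set (set T)) U V :
  F `<=` measurable -> G `<=` measurable ->
  (forall A B, <<s F >> A -> <<s G >> B -> P (A `&` B) = (P A * P B)%E) ->
  bmf (U : g_sigma_algebraType F -> R) -> bmf (V : g_sigma_algebraType G -> R) ->
  Ex P (fun w => U w * V w) = Ex P U * Ex P V.
Proof.
move=> Fm Gm FG bU bV; apply: Ex_mul_indep.
- exact: bmf_sub_sigma bU.
- exact: bmf_sub_sigma bV.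
move=> A B mA mB; apply: FG.
- by have := bU.1 measurableT A mA; rewrite setTI.
- by have := bV.1 measurableT B mB; rewrite setTI.
Qed.

End product_rule.

(** * Decoupling one edge *)

Section edge_independence.
Context dd (T : measurableType dd) (R : realType) (P : probability T R).
Variables (r d : nat) (xi : 'I_r -> 'I_r -> T -> R) (v : 'I_r -> 'I_r -> T -> 'cV[R]_d) (p : R).
Hypothesis xi_measurable : forall k l : 'I_r, (k < l)%N -> measurable_fun setT (xi k l).
Hypothesis v_measurable : forall (k l : 'I_r) (i : 'I_d), (k < l)%N ->
  measurable_fun setT (fun w => v k l w i 0).
Hypothesis xi_law : forall k l : 'I_r, (k < l)%N -> P [set w | xi k l w = 1] = p%:E.
Hypothesis xi_independent : mutually_independent P (@edge r)
     (fun kl => sigma_gen setT (fun _ : unit => xi kl.1 kl.2)).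
Hypothesis v_independent : mutually_independent P (@edge r)
     (fun kl => sigma_gen setT (fun (i : 'I_d) w => v kl.1 kl.2 w i 0)).
Hypothesis xi_v_independent : independent2 P
     (sigma_gen [set kl : 'I_r * 'I_r | (kl.1 < kl.2)%N] (fun kl => xi kl.1 kl.2))
     (sigma_gen [set q : ('I_r * 'I_r) * 'I_d | (q.1.1 < q.1.2)%N]
        (fun q w => v q.1.1 q.1.2 w q.2 0)).
Implicit Types e : 'I_r * 'I_r.

Definition xi_gen e : set (set T) :=
  \bigcup_(i in [set: unit]) preimage_set_system setT (xi e.1 e.2) measurable.
Definition v_gen e : set (set T) :=
  \bigcup_(i in [set: 'I_d]) preimage_set_system setT (fun w => v e.1 e.2 w i 0) measurable.

Lemma xi_gen_measurable e : (e.1 < e.2)%N -> xi_gen e `<=` measurable.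
Proof. by move=> e12 _ [_ _ [B mB <-]]; exact: xi_measurable. Qed.

Lemma v_gen_measurable e : (e.1 < e.2)%N -> v_gen e `<=` measurable.
Proof. by move=> e12 _ [i _ [B mB <-]]; exact: v_measurable. Qed.

Lemma xi_gen_sub e : (e.1 < e.2)%N -> <<s xi_gen e >> `<=`
  sigma_gen [set kl : 'I_r * 'I_r | (kl.1 < kl.2)%N] (fun kl => xi kl.1 kl.2).
Proof. by move=> e12; apply: sub_sigma_algebra2 => A [_ _ HA]; exists e. Qed.

Lemma v_gen_sub e : (e.1 < e.2)%N -> <<s v_gen e >> `<=`
  sigma_gen [set q : ('I_r * 'I_r) * 'I_d | (q.1.1 < q.1.2)%N]
        (fun q w => v q.1.1 q.1.2 w q.2 0).
Proof. by move=> e12; apply: sub_sigma_algebra2 => A [i _ HA]; exists (e, i). Qed.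

Lemma g_sigma_bigcap (G : set (set T)) (J : {set 'I_r * 'I_r}) (A : 'I_r * 'I_r -> set T) :
  (forall e, e \in J -> <<s G >> (A e)) ->
  <<s G >> (\bigcap_(e in [set e | e \in J]) A e).
Proof.
move=> GA; apply: (@fin_bigcap_measurable _ (g_sigma_algebraType G)) => [|e].
  exact: finite_finset.
exact: GA.
Qed.

(** The three independence hypotheses meet here: [xi] against [v] splits the two intersections, and
    each family then factors over its edges. *)
Lemma probability_rectangles (J : {set 'I_r * 'I_r}) (A B : 'I_r * 'I_r -> set T) :
  {subset J <= @edge r} ->
  (forall e, e \in J -> <<s xi_gen e >> (A e)) ->
  (forall e, e \in J -> <<s v_gen e >> (B e)) ->
  P (\bigcap_(e in [set e | e \in J]) (A e `&` B e)) =
  (\prod_(e in J) (P (A e) * P (B e)))%E.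
Proof.
move=> JE JA JB; rewrite bigcapI xi_v_independent; last 2 first.
- by apply: g_sigma_bigcap => e eJ; apply: (xi_gen_sub (JE e eJ)); exact: JA.
- by apply: g_sigma_bigcap => e eJ; apply: (v_gen_sub (JE e eJ)); exact: JB.
by rewrite xi_independent // v_independent // big_split.
Qed.

Definition rest_edges e0 : {set 'I_r * 'I_r} :=
  [set e : 'I_r * 'I_r | (e.1 < e.2)%N && (e != e0)]%SET.

(** Full rectangles over all other edges are closed under intersection, as the extension by
    pi-systems requires; events of a single edge are recovered by putting [setT] elsewhere. *)
Definition rest_gen e0 : set (set T) :=
  [set C | exists A B : 'I_r * 'I_r -> set T,
     [/\ forall e, <<s xi_gen e >> (A e), forall e, <<s v_gen e >> (B e) &
       C = \bigcap_(e in [set e | e \in rest_edges e0]) (A e `&` B e)]].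

Definition here_gen e0 : set (set T) :=
  [set C | exists A B, [/\ <<s xi_gen e0 >> A, <<s v_gen e0 >> B & C = A `&` B]].

Let gT (G : set (set T)) : <<s G >> setT.
Proof. exact: (@measurableT _ (g_sigma_algebraType G)). Qed.

Let gI (G : set (set T)) A B : <<s G >> A -> <<s G >> B -> <<s G >> (A `&` B).
Proof. exact: (@measurableI _ (g_sigma_algebraType G)). Qed.

Let gm (G : set (set T)) : G `<=` measurable -> <<s G >> `<=` measurable.
Proof. exact: smallest_sub (@sigma_algebra_measurable _ T). Qed.

Lemma rest_gen_measurable e0 : rest_gen e0 `<=` measurable.
Proof.
move=> _ [A [B [HA HB ->]]]; apply: fin_bigcap_measurable => [|e].
  exact: finite_finset.
rewrite /= inE => /andP[e12 _]; apply: measurableI.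
  exact: (gm (xi_gen_measurable e12)).
exact: (gm (v_gen_measurable e12)).
Qed.

Lemma rest_genT e0 : rest_gen e0 setT.
Proof.
exists (fun=> setT), (fun=> setT); split => [e|e|]; try exact: gT.
by rewrite setTI; apply/seteqP; split => // x _ e _.
Qed.

Lemma rest_genI e0 : setI_closed (rest_gen e0).
Proof.
move=> _ _ [A [B [HA HB ->]]] [A' [B' [HA' HB' ->]]].
exists (fun e => A e `&` A' e), (fun e => B e `&` B' e).
split => [e|e|]; try exact: gI.
by rewrite -bigcapI; apply: eq_bigcapr => e _; rewrite setIACA.
Qed.

Lemma here_gen_measurable e0 : (e0.1 < e0.2)%N -> here_gen e0 `<=` measurable.
Proof.
move=> e12 _ [A [B [HA HB ->]]]; apply: measurableI.
  exact: (gm (xi_gen_measurable e12)).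
exact: (gm (v_gen_measurable e12)).
Qed.

Lemma here_genT e0 : here_gen e0 setT.
Proof. by exists setT, setT; split; [exact: gT|exact: gT|rewrite setTI]. Qed.

Lemma here_genI e0 : setI_closed (here_gen e0).
Proof.
move=> _ _ [A [B [HA HB ->]]] [A' [B' [HA' HB' ->]]].
by exists (A `&` A'), (B `&` B'); split; [exact: gI|exact: gI|rewrite setIACA].
Qed.

Lemma here_indep e0 (A B : set T) : (e0.1 < e0.2)%N ->
  <<s xi_gen e0 >> A -> <<s v_gen e0 >> B -> P (A `&` B) = (P A * P B)%E.
Proof.
move=> e12 HA HB.
have := @probability_rectangles [set e0]%SET (fun=> A) (fun=> B).
rewrite big_set1 => <-.
- by congr (P _); apply/seteqP; split => [x AB e //|x AB]; apply: (AB e0); rewrite /= inE.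
- by move=> e; rewrite inE => /eqP ->.
- by move=> e; rewrite inE => /eqP ->.
- by move=> e; rewrite inE => /eqP ->.
Qed.

Lemma here_rest_indep e0 (C D : set T) : (e0.1 < e0.2)%N ->
  here_gen e0 C -> rest_gen e0 D -> P (C `&` D) = (P C * P D)%E.
Proof.
move=> e12 [A0 [B0 [HA0 HB0 ->]]] [A [B [HA HB ->]]].
rewrite (here_indep e12 HA0 HB0).
set J := rest_edges e0.
pose J1 := [set e : 'I_r * 'I_r | (e.1 < e.2)%N]%SET.
(* The events at [e0] are inserted into the family of the other edges, so that the intersection
   becomes one rectangle over all edges and the product formula applies to it. *)
pose A1 e := if e == e0 then A0 else A e; pose B1 e := if e == e0 then B0 else B e.
have HA1 e : <<s xi_gen e >> (A1 e) by rewrite /A1; case: eqP => [->|].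
have HB1 e : <<s v_gen e >> (B1 e) by rewrite /B1; case: eqP => [->|].
rewrite [in RHS]probability_rectangles //; last by move=> e; rewrite inE => /andP[].
have -> : A0 `&` B0 `&` \bigcap_(e in [set e | e \in J]) (A e `&` B e) =
    \bigcap_(e in [set e | e \in J1]) (A1 e `&` B1 e).
  apply/seteqP; split => [x [AB0 AB] e /=|x AB].
    rewrite inE => e1; rewrite /A1 /B1; case: eqVneq => [_|e10] //.
    by apply: AB; rewrite /= inE e1.
  split; first by have := AB e0; rewrite /= inE e12 /A1 /B1 eqxx; apply.
  move=> e /=; rewrite inE => /andP[e1 e10].
  by have := AB e; rewrite /= inE e1 /A1 /B1 (negPf e10); apply.
rewrite probability_rectangles //; last by move=> e; rewrite inE.
rewrite (bigD1 e0) /=; last by rewrite inE.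
rewrite /A1 /B1 eqxx; congr (_ * _)%E.
apply: eq_big => [e|e /andP[_ /negPf ->]] //.
by rewrite !inE.
Qed.

Lemma sub_g_sigmaP (F G : set (set T)) : F `<=` <<s G >> -> <<s F >> `<=` <<s G >>.
Proof. by apply: smallest_sub; exact: smallest_sigma_algebra. Qed.

Lemma bmf_g_sigma_sub (F G : set (set T)) (U : T -> R) : F `<=` <<s G >> ->
  bmf (U : g_sigma_algebraType F -> R) -> bmf (U : g_sigma_algebraType G -> R).
Proof.
move=> FG [mU bU]; split => // _ B mB; apply: (sub_g_sigmaP FG).
exact: (mU measurableT B mB).
Qed.

Lemma eq1_indic e0 : (fun w => (xi e0.1 e0.2 w == 1)%:R : R) = \1_[set w | xi e0.1 e0.2 w = 1].
Proof.
apply/funext => w; rewrite indicE; case: eqP => h; first by rewrite mem_set.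
by rewrite memNset.
Qed.

(** The product rule is applied twice: the edge [e0] against all others, then [xi] against [v] at
    [e0]. *)
Lemma edge_decoupling e0 (U phi : T -> R) : (e0.1 < e0.2)%N ->
  bmf (U : g_sigma_algebraType (rest_gen e0) -> R) ->
  bmf (phi : g_sigma_algebraType (v_gen e0) -> R) ->
  Ex P (fun w => (xi e0.1 e0.2 w == 1)%:R * phi w * U w) = p * Ex P phi * Ex P U.
Proof.
move=> e12 bU bphi.
have bX : bmf ((fun w => (xi e0.1 e0.2 w == 1)%:R : R) : g_sigma_algebraType (xi_gen e0) -> R).
  rewrite eq1_indic.
  split.
    apply: measurable_indic; apply: sub_sigma_algebra; exists tt => //.
    by exists [set 1] => //; rewrite setTI.
  by exists 1 => w; rewrite indicE; case: (_ \in _); rewrite ?normr0 ?normr1.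
have xh : xi_gen e0 `<=` <<s here_gen e0 >>.
  move=> A HA; apply: sub_sigma_algebra; exists A, setT.
  by split; [exact: sub_sigma_algebra|exact: gT|rewrite setIT].
have vh : v_gen e0 `<=` <<s here_gen e0 >>.
  move=> A HA; apply: sub_sigma_algebra; exists setT, A.
  by split; [exact: gT|exact: sub_sigma_algebra|rewrite setTI].
rewrite (Ex_mul_indep_sigma (here_gen_measurable e12) (@rest_gen_measurable e0)) //; last 2 first.
- apply: indep_sigma_ext2.
  + exact: here_gen_measurable.
  + exact: here_genT.
  + exact: here_genI.
  + exact: rest_gen_measurable.
  + exact: rest_genT.
  + exact: rest_genI.
  + by move=> A B; exact: here_rest_indep.
- by apply: bmfM; [exact: bmf_g_sigma_sub bX|exact: bmf_g_sigma_sub bphi].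
congr (_ * _).
rewrite (Ex_mul_indep_sigma (xi_gen_measurable e12) (v_gen_measurable e12)) //; last first.
  by move=> A B; exact: here_indep.
congr (_ * _); apply: EFin_inj; rewrite ExE; last exact: (bmf_sub_sigma (xi_gen_measurable e12) bX).
rewrite -(xi_law e12).
transitivity (\int[P]_w (\1_[set w | xi e0.1 e0.2 w = 1] w)%:E)%E.
  by apply: eq_integral => w _; rewrite -eq1_indic.
rewrite integral_indic ?setIT //.
rewrite -[X in measurable X]setTI; exact: (xi_measurable e12 measurableT (measurable_set1 (1 : R))).
Qed.


End edge_independence.

(** * Residuals of the block equations *)

Section fraction.
Context {R : realType}.
Implicit Types s t A B : R.

Definition rfrac s t : R := s / (1 + s + t).

Lemma frac01 s t : 0 <= s -> 0 <= t -> 0 <= rfrac s t <= 1.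
Proof.
move=> s0 t0; have st : 0 < 1 + s + t by lra.
by rewrite divr_ge0 ?(ltW st) //= ler_pdivrMr // mul1r; lra.
Qed.

Lemma norm_frac_le s t : 0 <= s -> 0 <= t -> `|rfrac s t| <= 1.
Proof. by move=> s0 t0; have /andP[h1 h2] := frac01 s0 t0; rewrite ger0_norm. Qed.

(** All denominators are at least 1, so the fraction is 1-Lipschitz in numerator and denominator. No
    sign is asked of [A], which is a bilinear and not a quadratic form of the resolvent. *)
Lemma frac_perturb A B s t : 0 <= B -> 0 <= s -> 0 <= t ->
  `|A / (1 + B) - rfrac s t| <= `|A - s| + `|B - (s + t)|.
Proof.
move=> B0 s0 t0; have B1 : 0 < 1 + B by lra.
have st : 0 < 1 + s + t by lra.
have -> : A / (1 + B) - rfrac s t =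
    (A - s) * (1 + B)^-1 + ((s + t) - B) * ((1 + B)^-1 * rfrac s t).
  by rewrite /rfrac; field; rewrite !gt_eqF.
have i0 : 0 <= (1 + B)^-1 by rewrite invr_ge0 ltW.
have i1 : (1 + B)^-1 <= 1 by rewrite invf_le1 // lerDl.
have /andP[] := frac01 s0 t0; move: (rfrac s t) => f f0 f1.
rewrite (le_trans (ler_normD _ _)) // !normrM lerD //.
  by rewrite ler_piMr // ger0_norm.
rewrite distrC ler_piMr // (ger0_norm i0) (ger0_norm f0) mulr_ile1 //.
Qed.

Lemma frac_lip s t s' t' : 0 <= s -> 0 <= t -> 0 <= s' -> 0 <= t' ->
  `|rfrac s t - rfrac s' t'| <= `|s - s'| + `|t - t'|.
Proof.
move=> s0 t0 s0' t0'; have st : 0 < 1 + s + t by lra.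
have st' : 0 < 1 + s' + t' by lra.
have -> : rfrac s t - rfrac s' t' =
   (s - s') * ((1 + t') / ((1 + s + t) * (1 + s' + t')))
   + (t' - t) * (s' / ((1 + s + t) * (1 + s' + t'))).
  by rewrite /rfrac; field; rewrite !gt_eqF.
have pr0 : 0 < (1 + s + t) * (1 + s' + t') by rewrite mulr_gt0.
rewrite (le_trans (ler_normD _ _)) // (normrM (s - s')) (normrM (t' - t)) lerD //.
  rewrite ler_piMr // ger0_norm; last by rewrite divr_ge0 ?(ltW pr0) //; lra.
  by rewrite ler_pdivrMr // mul1r; nra.
rewrite distrC ler_piMr // ger0_norm; last by rewrite divr_ge0 ?(ltW pr0) //; lra.
by rewrite ler_pdivrMr // mul1r; nra.
Qed.

End fraction.

Section residual.
Context {R : realType} (n r d : nat) (E : 'I_r -> 'M[R]_(n, d)).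
Hypothesis E_orth : forall k l, (E k)^T *m E l = (k == l)%:R%:M.
Hypothesis E_full : \sum_k E k *m (E k)^T = 1%:M.
Hypothesis d0 : (0 < d)%N.
Variables (x p : R).
Hypotheses (x0 : 0 < x) (p0 : 0 <= p).
Implicit Types (M : 'M[R]_n) (k l : 'I_r).

Notation g M k := (btr E M k k).

(** The sum includes [l = k], which the block equation lacks. This makes averaging over all vertices
    exact and costs only the term of order [p / d] that leads [residualE]. *)
Definition residual M k : R :=
  x * g M k + p / d%:R * (\sum_l rfrac (g M k) (g M l)) - 1.

Let dR0 : 0 < d%:R :> R. Proof. by rewrite ltr0n. Qed.
Let pd0 : 0 <= p / d%:R. Proof. by rewrite divr_ge0. Qed.

Lemma residual_norm A k : psdmx A ->
  `|residual (resolvent x A) k| <= 1 + p * r%:R / d%:R.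
Proof.
move=> pA; have g0 l : 0 <= g (resolvent x A) l by exact: btr_ge0.
have gk : x * g (resolvent x A) k <= 1.
  by rewrite -ler_pdivlMl // mulr1 btr_le.
have gk0 : 0 <= x * g (resolvent x A) k by rewrite mulr_ge0 // ltW.
have s0 : 0 <= \sum_l rfrac (g (resolvent x A) k) (g (resolvent x A) l).
  by apply: sumr_ge0 => l _; have /andP[] := frac01 (g0 k) (g0 l).
have s1 : \sum_l rfrac (g (resolvent x A) k) (g (resolvent x A) l) <= r%:R.
  rewrite -[r in r%:R]card_ord -sum1_card natr_sum; apply: ler_sum => l _.
  by have /andP[] := frac01 (g0 k) (g0 l).
have h1 : 0 <= p / d%:R * \sum_l rfrac (g (resolvent x A) k) (g (resolvent x A) l) by rewrite mulr_ge0.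
have h2 : p / d%:R * \sum_l rfrac (g (resolvent x A) k) (g (resolvent x A) l) <= p * r%:R / d%:R.
  by rewrite [leRHS]mulrAC ler_wpM2l.
rewrite ler_norml /residual; move: gk gk0 h1 h2.
move: (x * _) (_ * \sum_l _) (p * _ / _) => a b c *.
by apply/andP; split; lra.
Qed.

(** One edge moves [g_k] by at most [1 / (x d)] and all [g_l] together by no more, and [rfrac] is
    1-Lipschitz. With [p r / d] bounded the change is O(1/d), which frees a residual from any single
    edge. *)
Lemma residual_rank_one A (u : 'cV[R]_n) k : psdmx A ->
  `|residual (resolvent x (A + u *m u^T)) k - residual (resolvent x A) k| <=
  (1 + (p * r%:R / d%:R + p / d%:R) / x) / d%:R.
Proof.
move=> pA; set G := resolvent x (A + _); set G' := resolvent x A.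
have pAu := psdmxD pA (psdmx_dyad u).
have g0 l : 0 <= g G l by exact: btr_ge0.
have g0' l : 0 <= g G' l by exact: btr_ge0.
have dl (l : 'I_r) : `|g G l - g G' l| <= (x * d%:R)^-1.
  by rewrite distrC; exact: btr_rank_one_norm.
have sdl : \sum_l `|g G l - g G' l| <= (x * d%:R)^-1.
  apply: le_trans (sum_btr_rank_one E_full d0 u pA x0); apply: ler_sum => l _.
  by rewrite distrC ger0_norm // btr_rank_one_ge0.
have -> : residual G k - residual G' k = x * (g G k - g G' k)
    + p / d%:R * (\sum_l (rfrac (g G k) (g G l) - rfrac (g G' k) (g G' l))).
  by rewrite /residual sumrB; ring.
rewrite (le_trans (ler_normD _ _)) // (normrM x) (normrM (p / d%:R)) (gtr0_norm x0) (ger0_norm pd0).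
have h1 : x * `|g G k - g G' k| <= d%:R^-1.
  by rewrite -ler_pdivlMl // -invfM dl.
have h2 : `|\sum_l (rfrac (g G k) (g G l) - rfrac (g G' k) (g G' l))| <=
    (r%:R + 1) * (x * d%:R)^-1.
  rewrite (le_trans (ler_norm_sum _ _ _)) //.
  apply: (@le_trans _ _ (\sum_l (`|g G k - g G' k| + `|g G l - g G' l|))).
    by apply: ler_sum => l _; exact: frac_lip.
  rewrite big_split /= mulrDl mul1r lerD //.
  by rewrite sumr_const card_ord mulr_natl lerMn2r dl orbT.
have h3 := ler_wpM2l pd0 h2.
rewrite (le_trans (lerD h1 h3)) //; apply: le_of_eq.
by field; rewrite !gt_eqF.
Qed.

Variable y : 'I_r * 'I_r -> 'cV[R]_d.

Notation G := (resolvent x (lap E y)).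
Notation G' e := (resolvent x (lap_del E y e)).

(** At the vector of the edge, with [M] the resolvent without that edge, [bilin] and [quad] are the
    forms [A_kl] and [B_kl]. [incr] compresses [M] to the difference of two blocks on which the edge
    acts. *)
Definition bilin M k l (z : 'cV[R]_d) : R := dotv z ((blk E M k k - blk E M k l) *m z).
Definition incr M (e : 'I_r * 'I_r) : 'M[R]_d := (E e.1 - E e.2)^T *m M *m (E e.1 - E e.2).
Definition quad M e (z : 'cV[R]_d) : R := dotv z (incr M e *m z).

Lemma incrE M e : incr M e =
  (blk E M e.1 e.1 - blk E M e.2 e.1) - (blk E M e.1 e.2 - blk E M e.2 e.2).
Proof.
by rewrite /incr /blk [(_ - _)^T]linearB /= mulmxBr !mulmxBl.
Qed.

Lemma quadE M e z : quad M e z = dotv ((E e.1 - E e.2) *m z) (M *m ((E e.1 - E e.2) *m z)).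
Proof. by rewrite /quad /incr dotv_mulmx !mulmxA. Qed.

Lemma quad_ge0 A e z : psdmx A -> 0 <= quad (resolvent x A) e z.
Proof. by move=> pA; rewrite quadE resolvent_ge0. Qed.

Lemma residualE k : residual G k =
  p / d%:R * rfrac (g G k) (g G k) +
  d%:R^-1 * \sum_(l | l != k) (p * rfrac (g G k) (g G l)
    - bilin (G' (srt k l)) k l (y (srt k l)) /
      (1 + quad (G' (srt k l)) (srt k l) (y (srt k l)))).
Proof.
have := resolvent_block_equation E_orth d0 y x0 k.
under eq_bigr do rewrite /edge_vec -quadE -/(bilin _ _ _ _).
set S := \sum_(l | _) _; move=> H.
have D1 : \sum_l rfrac (g G k) (g G l) = rfrac (g G k) (g G k)
    + \sum_(l | l != k) rfrac (g G k) (g G l) by rewrite (bigD1 k).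
have D2 : \sum_(l | l != k) p * rfrac (g G k) (g G l)
    = p * \sum_(l | l != k) rfrac (g G k) (g G l) by rewrite mulr_sumr.
rewrite /residual -[X in _ - X = _]H D1 sumrB -/S D2.
by move: (\sum_(l | _) rfrac _ _) => F; ring.
Qed.

(** By isotropy a normalized trace is the mean of the form at an independent vector. Here and in
    [tr_incr] it differs from [g_k], respectively [g_k + g_l], by cross traces alone. *)
Lemma tr_bilin M k l : \tr (blk E M k k - blk E M k l) / d%:R = g M k - btr E M k l.
Proof. by rewrite linearB /= mulrBl. Qed.

Lemma btr_sym M k l : M^T = M -> btr E M k l = btr E M l k.
Proof.
move=> sM; rewrite /btr; congr (_ / _).
by rewrite -mxtrace_tr /blk !trmx_mul trmxK sM mulmxA.
Qed.

Lemma srt_cases k l : srt k l = (k, l) \/ srt k l = (l, k).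
Proof. by rewrite /srt; case: ifP; [left|right]. Qed.

Lemma tr_incr M k l : M^T = M ->
  \tr (incr M (srt k l)) / d%:R = g M k + g M l - 2 * btr E M k l.
Proof.
move=> sM; have H a b : \tr (incr M (a, b)) / d%:R = g M a + g M b - 2 * btr E M a b.
  have trB (X Y : 'M[R]_d) : \tr (X - Y) = \tr X - \tr Y by rewrite linearB.
  rewrite incrE !trB !mulrBl.
  rewrite -/(btr E M a a) -/(btr E M b b) -/(btr E M a b) -/(btr E M b a).
  by rewrite (btr_sym b a sM); ring.
by case: (srt_cases k l) => ->; rewrite H // (btr_sym l k sM); ring.
Qed.

Lemma norm2_bilin_mx A k l u : psdmx A ->
  norm2 ((blk E (resolvent x A) k k - blk E (resolvent x A) k l) *m u) <= 2 / x * norm2 u.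
Proof.
move=> pA; rewrite mulmxBl (le_trans (norm2B _ _)) //.
have h1 := norm2_blk E_orth E_full pA x0 k k u.
have h2 := norm2_blk E_orth E_full pA x0 k l u.
by rewrite (le_trans (lerD h1 h2)) //; apply: le_of_eq; ring.
Qed.

Lemma norm2_incr A e u : psdmx A ->
  norm2 (incr (resolvent x A) e *m u) <= 4 / x * norm2 u.
Proof.
move=> pA; rewrite incrE !mulmxBl.
have h1 := norm2_blk E_orth E_full pA x0 e.1 e.1 u.
have h2 := norm2_blk E_orth E_full pA x0 e.2 e.1 u.
have h3 := norm2_blk E_orth E_full pA x0 e.1 e.2 u.
have h4 := norm2_blk E_orth E_full pA x0 e.2 e.2 u.
rewrite (le_trans (norm2B _ _)) //.
apply: (@le_trans _ _ ((norm2 u / x + norm2 u / x) + (norm2 u / x + norm2 u / x))).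
  by rewrite lerD // (le_trans (norm2B _ _)) // lerD.
by apply: le_of_eq; ring.
Qed.

Lemma norm_bilin_frac A k l z C0 : psdmx A -> dotv z z <= C0 ->
  `|bilin (resolvent x A) k l z / (1 + quad (resolvent x A) (srt k l) z)| <= 2 / x * C0.
Proof.
move=> pA zC; have q0 := quad_ge0 (srt k l) z pA.
have i0 : 0 <= (1 + quad (resolvent x A) (srt k l) z)^-1 by rewrite invr_ge0 addr_ge0.
have i1 : (1 + quad (resolvent x A) (srt k l) z)^-1 <= 1 by rewrite invf_le1 ?lerDl // ltr_wpDr.
have b : `|bilin (resolvent x A) k l z| <= 2 / x * C0.
  rewrite (le_trans (norm_dotv_le _ _)) //.
  apply: (@le_trans _ _ (norm2 z * (2 / x * norm2 z))).
    by rewrite ler_wpM2l ?norm2_ge0 // norm2_bilin_mx.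
  by rewrite mulrCA -expr2 norm2_sqr ler_wpM2l // divr_ge0 // ltW.
by rewrite normrM (ger0_norm i0) (le_trans _ b) // ler_piMr.
Qed.

(** The factor 3 collects the cross trace: once from the mean of [bilin], twice from the mean of
    [quad]. *)
Lemma bilin_frac_near A G0 k l z : psdmx A -> G0 = resolvent x A ->
  `|bilin G0 k l z / (1 + quad G0 (srt k l) z) - rfrac (g G0 k) (g G0 l)| <=
  `|bilin G0 k l z - \tr (blk E G0 k k - blk E G0 k l) / d%:R|
  + `|quad G0 (srt k l) z - \tr (incr G0 (srt k l)) / d%:R|
  + 3 * `|btr E G0 k l|.
Proof.
move=> pA G0E; have sG : G0^T = G0 by rewrite G0E trmx_resolvent.
have g0 m : 0 <= g G0 m by rewrite G0E btr_ge0.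
have q0 : 0 <= quad G0 (srt k l) z by rewrite G0E quad_ge0.
apply: le_trans (frac_perturb _ q0 (g0 k) (g0 l)) _.
rewrite tr_bilin tr_incr //; set b := bilin _ _ _ _; set q := quad _ _ _; set t := btr E G0 k l.
have h1 : `|b - g G0 k| <= `|b - (g G0 k - t)| + `|t|.
  have -> : b - g G0 k = (b - (g G0 k - t)) - t by ring.
  exact: ler_normB.
have h2 : `|q - (g G0 k + g G0 l)| <= `|q - (g G0 k + g G0 l - 2 * t)| + 2 * `|t|.
  have -> : q - (g G0 k + g G0 l) = (q - (g G0 k + g G0 l - 2 * t)) - 2 * t by ring.
  by rewrite (le_trans (ler_normB _ _)) // lerD2l normrM ger0_norm.
rewrite (le_trans (lerD h1 h2)) //; apply: le_of_eq; ring.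
Qed.

End residual.

(** * Mean square estimate of the residuals *)

Lemma norm_entry_le (R : realType) d (u : 'cV[R]_d) i : `|u i 0| <= norm2 u.
Proof.
rewrite -dotv_delta (le_trans (norm_dotv_le _ _)) //.
by rewrite /norm2 dotv_delta mxE !eqxx sqrtr1 mul1r.
Qed.

(** The sum separates the matrix, a function of the other edges, from functions of [z] alone, which
    is the form that decoupling needs. *)
Lemma dotv_quadE (R : realType) d (D : 'M[R]_d) (z : 'cV[R]_d) :
  dotv z (D *m z) - \tr D / d%:R =
  \sum_(q : 'I_d * 'I_d) D q.1 q.2 * (z q.1 0 * z q.2 0 - (q.1 == q.2)%:R / d%:R).
Proof.
rewrite -(pair_bigA _ (fun i j => D i j * (z i 0 * z j 0 - (i == j)%:R / d%:R))) /=.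
rewrite /dotv /mxtrace mulr_suml -sumrB; apply: eq_bigr => i _.
rewrite mxE mulr_sumr.
under [RHS]eq_bigr do rewrite mulrBr.
rewrite sumrB; congr (_ - _); first by apply: eq_bigr => j _; ring.
rewrite (bigD1 i) //= eqxx mul1r big1 ?addr0 // => j ji.
by rewrite eq_sym (negPf ji) mul0r mulr0.
Qed.

Section measurable_blocks.
Context dd (S : measurableType dd) (R : realType) (n r d : nat) (E : 'I_r -> 'M[R]_(n, d)).
Hypothesis E_orth : forall k l, (E k)^T *m E l = (k == l)%:R%:M.
Hypothesis E_full : \sum_k E k *m (E k)^T = 1%:M.
Hypothesis d0 : (0 < d)%N.
Variables (x p : R).
Hypotheses (x0 : 0 < x) (p0 : 0 <= p).
Variable A : S -> 'M[R]_n.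
Hypotheses (pA : forall w, psdmx (A w)) (mA : mfmx A).
Notation G w := (resolvent x (A w)).

Lemma mfmx_blk k l : mfmx (fun w => blk E (G w) k l).
Proof.
by apply: mfmxM (mfmxM (mfmx_cst _) (mfmx_resolvent x0 pA mA)) (mfmx_cst _).
Qed.

Lemma bmf_blk k l i j : bmf (fun w => blk E (G w) k l i j).
Proof.
split; first exact: mfmx_blk.
exists x^-1 => w.
have -> : blk E (G w) k l i j = (blk E (G w) k l *m (delta_mx j 0 : 'cV[R]_d)) i 0.
  by move: (blk _ _ _ _) => B; rewrite -colE [RHS]mxE.
rewrite (le_trans (norm_entry_le _ _)) // (le_trans (norm2_blk E_orth E_full (pA w) x0 _ _ _)) //.
by rewrite norm2_delta mul1r.
Qed.

Lemma btr_norm_le w k l : `|btr E (G w) k l| <= x^-1.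
Proof.
rewrite -(@ler_pXn2r _ 2) ?nnegrE ?invr_ge0 ?(ltW x0) // real_normK ?num_real //.
apply: le_trans (sum_btr_sqr E_orth E_full d0 (pA w) x0 l).
by rewrite (bigD1 k) //= lerDl; apply: sumr_ge0 => i _; exact: sqr_ge0.
Qed.

Lemma bmf_btr k l : bmf (fun w => btr E (G w) k l).
Proof.
split; last by exists x^-1 => w; exact: btr_norm_le.
by apply: measurable_funM => //; apply: measurable_trace; exact: mfmx_blk.
Qed.

Lemma bmf_frac k l : bmf (fun w => rfrac (btr E (G w) k k) (btr E (G w) l l)).
Proof.
split; last by exists 1 => w; apply: norm_frac_le; exact: btr_ge0.
have mb a : measurable_fun setT (fun w => btr E (G w) a a) by have [] := bmf_btr a a.
apply: measurable_funM => //; apply: measurable_funV.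
by apply: measurable_funD => //; apply: measurable_funD.
Qed.

Lemma bmf_residual k : bmf (fun w => residual E x p (G w) k).
Proof.
split; last by exists (1 + p * r%:R / d%:R) => w; exact: residual_norm.
apply: measurable_funB => //; apply: measurable_funD.
  by apply: measurable_funM => //; have [] := bmf_btr k k.
by apply: measurable_funM => //; apply: measurable_big_sum => l _; have [] := bmf_frac k l.
Qed.

End measurable_blocks.

(** Here [k0] bounds [p r / d], so [1 + k0] bounds a residual. In the middle factor [2 + 20 / x^2]
    comes from the two quadratic forms with [K = 2 / x] and [K = 4 / x], [3 + 3 / x] from the cross
    trace and [2 / x] from the fraction after deletion of an edge. The product with [1 + 2 / x * C0]
    is the change of the residual under deletion, and [3 (1 + k0) / x^2] the summed squares of cross
    traces. *)
Definition residual_rate (R : realType) (x k0 C0 : R) : R :=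
  (1 + k0) + k0 * (((1 + k0) * (5 + 20 / x ^+ 2 + 5 / x)
    + (1 + (k0 + 1) / x) * (1 + 2 / x * C0)) + 3 * (1 + k0) / x ^+ 2).

Section average_residual.
Context dd (T : measurableType dd) (R : realType) (P : probability T R).
Context (n r d : nat) (E : 'I_r -> 'M[R]_(n, d)).
Hypothesis E_orth : forall k l, (E k)^T *m E l = (k == l)%:R%:M.
Hypothesis E_full : \sum_k E k *m (E k)^T = 1%:M.
Hypotheses (d0 : (0 < d)%N) (r0 : (0 < r)%N).
Variables (x p C0 th : R).
Hypotheses (x0 : 0 < x) (p0 : 0 <= p) (C0_ge0 : 0 <= C0) (th0 : 0 < th).
Variables (GR GV : 'I_r * 'I_r -> set (set T)).
Variables (chi : 'I_r * 'I_r -> T -> R) (z : 'I_r * 'I_r -> T -> 'cV[R]_d).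
Notation SR e := (g_sigma_algebraType (GR e)).
Notation SV e := (g_sigma_algebraType (GV e)).
Implicit Types e f : 'I_r * 'I_r.
Hypothesis GR_m : forall e, (e.1 < e.2)%N -> GR e `<=` measurable.
Hypothesis GV_m : forall e, (e.1 < e.2)%N -> GV e `<=` measurable.
Hypothesis chi01 : forall e w, chi e w = 0 \/ chi e w = 1.
Hypothesis chi_m : forall e, (e.1 < e.2)%N -> measurable_fun setT (chi e).
Hypothesis dec : forall e (U phi : T -> R), (e.1 < e.2)%N ->
  bmf (U : SR e -> R) -> bmf (phi : SV e -> R) ->
  Ex P (fun w => chi e w * phi w * U w) = p * Ex P phi * Ex P U.
Hypothesis yR : forall e f, (e.1 < e.2)%N -> (f.1 < f.2)%N -> f != e ->
  mfmx ((fun w => chi f w *: z f w) : SR e -> 'cV[R]_d).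
Hypothesis zV : forall e, (e.1 < e.2)%N -> mfmx (z e : SV e -> 'cV[R]_d).
Hypothesis zC : forall e w, dotv (z e w) (z e w) <= C0.
Hypothesis var : forall e (D : 'M[R]_d) (K : R), (e.1 < e.2)%N -> 0 <= K ->
  (forall u, norm2 (D *m u) <= K * norm2 u) ->
  Ex P (fun w => (dotv (z e w) (D *m z e w) - \tr D / d%:R) ^+ 2) <= K ^+ 2 * th ^+ 2.

Let y w e : 'cV[R]_d := chi e w *: z e w.
Notation G w := (resolvent x (lap E (y w))).
Notation G' e w := (resolvent x (lap_del E (y w) e)).

Lemma bmf_chi e : (e.1 < e.2)%N -> bmf (chi e).
Proof.
move=> e12; split; first exact: chi_m.
by exists 1 => w; case: (chi01 e w) => ->; rewrite ?normr0 ?normr1.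
Qed.

Lemma bmf_z e i : (e.1 < e.2)%N -> bmf ((fun w => z e w i 0) : SV e -> R).
Proof.
move=> e12; split; first exact: zV.
exists (Num.sqrt C0) => w; rewrite (le_trans (norm_entry_le _ _)) //.
by rewrite ler_sqrt.
Qed.

Lemma Ex_chi e : (e.1 < e.2)%N -> Ex P (chi e) = p.
Proof.
move=> e12; have := @dec e (cst 1) (cst 1) e12 (@bmf_cst _ _ _ 1) (@bmf_cst _ _ _ 1).
rewrite !Ex_cst !mulr1 => <-; congr Ex.
by apply/funext => w; rewrite !mulr1.
Qed.

Lemma mfmx_y e : (e.1 < e.2)%N -> mfmx (fun w => y w e).
Proof.
move=> e12; apply: mfmxZ; first exact: chi_m.
by move=> i j; rewrite ord1; have [] := bmf_sub_sigma (GV_m e12) (bmf_z i e12).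
Qed.

Lemma mfmx_edge_dyad dd' (S : measurableType dd') (yy : S -> 'I_r * 'I_r -> 'cV[R]_d) e :
  mfmx (fun w => yy w e) -> mfmx (fun w => edge_dyad E (yy w) e).
Proof.
move=> my; have me : mfmx (fun w => edge_vec E (yy w) e) by apply: mfmxM => //; exact: mfmx_cst.
by apply: mfmxM => //; exact: mfmx_tr.
Qed.

Lemma mfmx_lap : mfmx (fun w => lap E (y w)).
Proof. by apply: mfmx_sum => e e12; apply: mfmx_edge_dyad; exact: mfmx_y. Qed.

Lemma mfmx_lap_del e : (e.1 < e.2)%N -> mfmx ((fun w => lap_del E (y w) e) : SR e -> 'M[R]_n).
Proof.
move=> e12; apply: mfmx_sum => f /andP[f12 fe].
by apply: (@mfmx_edge_dyad _ (SR e)); exact: yR.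
Qed.

(* Expanding the square into products of a function of the other edges and a
   function of the edge e lets [dec] replace conditioning on the other edges. *)
Lemma quad_decoupling (I : finType) e (D phi : I -> T -> R) Mb : (e.1 < e.2)%N ->
  (forall i, bmf (D i : SR e -> R)) -> (forall i, bmf (phi i : SV e -> R)) ->
  (forall w', Ex P (fun w => (\sum_i D i w' * phi i w) ^+ 2) <= Mb) ->
  Ex P (fun w => chi e w * (\sum_i D i w * phi i w) ^+ 2) <= p * Mb.
Proof.
move=> e12 bD bphi H.
have bD' i : bmf (D i) by exact: bmf_sub_sigma (GR_m e12) (bD i).
have bphi' i : bmf (phi i) by exact: bmf_sub_sigma (GV_m e12) (bphi i).
have bc := bmf_chi e12.
have sq (a b : I -> R) : (\sum_i a i * b i) ^+ 2 = \sum_i \sum_j (b i * b j) * (a i * a j).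
  rewrite expr2 mulr_suml; apply: eq_bigr => i _; rewrite mulr_sumr; apply: eq_bigr => j _; ring.
pose c i j : R := Ex P (fun w => phi i w * phi j w).
have b1 i j : bmf (fun w => chi e w * (phi i w * phi j w) * (D i w * D j w)).
  by apply: bmfM; [apply: bmfM => //; exact: bmfM|exact: bmfM].
have b2 w' i j : bmf (fun w => (phi i w * phi j w) * (D i w' * D j w')).
  by apply: bmfM; [exact: bmfM|exact: bmf_cst].
have b3 i j : bmf (fun w' => c i j * (D i w' * D j w')).
  by apply: bmfM; [exact: bmf_cst|exact: bmfM].
have inner w' : Ex P (fun w => (\sum_i D i w' * phi i w) ^+ 2) =
    \sum_i \sum_j c i j * (D i w' * D j w').
  transitivity (Ex P (fun w => \sum_i \sum_j (phi i w * phi j w) * (D i w' * D j w'))).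
    by congr Ex; apply/funext => w; exact: sq.
  rewrite Ex_sum => [|i _]; last exact: bmf_sum.
  apply: eq_bigr => i _; rewrite Ex_sum //; apply: eq_bigr => j _.
  rewrite [RHS]mulrC /c -ExZ; last exact: bmfM.
  by congr Ex; apply/funext => w; exact: mulrC.
have -> : Ex P (fun w => chi e w * (\sum_i D i w * phi i w) ^+ 2) =
    p * Ex P (fun w' => \sum_i \sum_j c i j * (D i w' * D j w')).
  transitivity (Ex P (fun w => \sum_i \sum_j chi e w * (phi i w * phi j w) * (D i w * D j w))).
    congr Ex; apply/funext => w; rewrite sq mulr_sumr; apply: eq_bigr => i _.
    by rewrite mulr_sumr; apply: eq_bigr => j _; rewrite mulrA.
  rewrite !Ex_sum => [|i _|i _]; try exact: bmf_sum.
  rewrite mulr_sumr; apply: eq_bigr => i _; rewrite !Ex_sum // mulr_sumr.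
  apply: eq_bigr => j _; rewrite ExZ; last exact: bmfM.
  rewrite mulrA -(@dec e (fun w => D i w * D j w) (fun w => phi i w * phi j w)) //; exact: bmfM.
rewrite ler_wpM2l //; apply: Ex_le_cst => [|w']; last by rewrite -inner.
by apply: bmf_sum => i _; exact: bmf_sum.
Qed.

Lemma bmf_quad e (D : T -> 'M[R]_d) : (e.1 < e.2)%N ->
  (forall i j, bmf ((fun w => D w i j) : SR e -> R)) ->
  bmf (fun w => dotv (z e w) (D w *m z e w) - \tr (D w) / d%:R).
Proof.
move=> e12 bD.
apply: (@eq_bmf _ _ _ (fun w => \sum_(q : 'I_d * 'I_d) D w q.1 q.2 *
  (z e w q.1 0 * z e w q.2 0 - (q.1 == q.2)%:R / d%:R))) => [w|].
  by rewrite dotv_quadE.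
apply: bmf_sum => q _; apply: bmfM; first exact: bmf_sub_sigma (GR_m e12) (bD _ _).
have bz i := bmf_sub_sigma (GV_m e12) (bmf_z i e12).
by apply: bmfB; [exact: bmfM|exact: bmf_cst].
Qed.

(** Keeping [chi] under the expectation produces the factor [p]. The pointwise bound
    [|W| <= th + W^2 / th] passes to second moments without square roots. *)
Lemma Ex_chi_quad e (D : T -> 'M[R]_d) K : (e.1 < e.2)%N -> 0 <= K ->
  (forall i j, bmf ((fun w => D w i j) : SR e -> R)) ->
  (forall w u, norm2 (D w *m u) <= K * norm2 u) ->
  Ex P (fun w => chi e w * `|dotv (z e w) (D w *m z e w) - \tr (D w) / d%:R|)
  <= p * (th * (1 + K ^+ 2)).
Proof.
move=> e12 K0 bD DK.
pose W w := dotv (z e w) (D w *m z e w) - \tr (D w) / d%:R.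
have bphi (q : 'I_d * 'I_d) :
    bmf ((fun w => z e w q.1 0 * z e w q.2 0 - (q.1 == q.2)%:R / d%:R) : SV e -> R).
  by apply: bmfB; [apply: bmfM; exact: bmf_z|exact: bmf_cst].
have WE w : W w = \sum_(q : 'I_d * 'I_d) D w q.1 q.2 *
    (z e w q.1 0 * z e w q.2 0 - (q.1 == q.2)%:R / d%:R) by rewrite -dotv_quadE.
have H : Ex P (fun w => chi e w * W w ^+ 2) <= p * (K ^+ 2 * th ^+ 2).
  have -> : (fun w => chi e w * W w ^+ 2) = fun w => chi e w *
     (\sum_(q : 'I_d * 'I_d) D w q.1 q.2 * (z e w q.1 0 * z e w q.2 0 - (q.1 == q.2)%:R / d%:R)) ^+ 2.
    by apply/funext => w; rewrite WE.
  apply: (quad_decoupling e12 (fun q => bD q.1 q.2) bphi) => w'.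
  apply: le_trans (var e12 K0 (DK w')); apply: le_of_eq.
  by congr Ex; apply/funext => w; rewrite dotv_quadE.
have bW : bmf W := bmf_quad e12 bD.
have bc := bmf_chi e12.
have bW2 : bmf (fun w => chi e w * W w ^+ 2) by apply: bmfM => //; exact: bmf_exp.
apply: (@le_trans _ _ (Ex P (fun w => th * chi e w + th^-1 * (chi e w * W w ^+ 2)))).
  apply: le_Ex => [||w].
  - by apply: bmfM => //; exact: bmf_norm.
  - by apply: bmfD; apply: bmfM => //; exact: bmf_cst.
  - have th1 : 0 < th^-1 by rewrite invr_gt0.
    have h : `|W w| <= th + th^-1 * W w ^+ 2.
      rewrite -(ler_pM2l th0) mulrDr mulrA mulfV ?gt_eqF // mul1r -[W w ^+ 2]real_normK ?num_real //.
      have := sqr_ge0 (th - `|W w|); have := normr_ge0 (W w); have := ltW th0.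
      by move: `|W w| => a; nra.
    rewrite -/(W w); case: (chi01 e w) => ->; rewrite ?mul0r ?mulr0 ?addr0 //.
    by rewrite !mul1r mulr1.
rewrite ExD; [|by apply: bmfM => //; exact: bmf_cst|by apply: bmfM => //; exact: bmf_cst].
rewrite !ExZ // Ex_chi //.
have -> : p * (th * (1 + K ^+ 2)) = th * p + th^-1 * (p * (K ^+ 2 * th ^+ 2)).
  by field; rewrite gt_eqF.
by rewrite lerD2l ler_wpM2l // invr_ge0 ltW.
Qed.


Variable k0 : R.
Hypotheses (p1 : p <= 1) (k0E : p * r%:R / d%:R <= k0) (d_th : d%:R^-1 <= th)
  (r_th : r%:R^-1 <= th ^+ 2).
Let Kb : R := 1 + k0.
Let Q : R := 2 / x * C0.
Let del : R := (x * d%:R)^-1.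
Let rh : R := (1 + (k0 + 1) / x) / d%:R.

Let dR0 : 0 < d%:R :> R. Proof. by rewrite ltr0n. Qed.
Let k0_ge0 : 0 <= k0.
Proof. by apply: le_trans k0E; rewrite divr_ge0 ?mulr_ge0 ?ler0n. Qed.
Let Kb0 : 0 <= Kb. Proof. by rewrite addr_ge0. Qed.
Let Q0 : 0 <= Q. Proof. by rewrite mulr_ge0 // divr_ge0 // ltW. Qed.
Let del0 : 0 <= del. Proof. by rewrite invr_ge0 mulr_ge0 // ltW. Qed.

Notation Res k w := (residual E x p (G w) k).
Notation Res' k e w := (residual E x p (G' e w) k).
Notation a k l w := (rfrac (btr E (G w) k k) (btr E (G w) l l)).
Notation a' k l e w := (rfrac (btr E (G' e w) k k) (btr E (G' e w) l l)).
Notation q k l w := (bilin E (G' (srt k l) w) k l (z (srt k l) w) /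
   (1 + quad E (G' (srt k l) w) (srt k l) (z (srt k l) w))).
Notation W1 k l w := (bilin E (G' (srt k l) w) k l (z (srt k l) w) -
   \tr (blk E (G' (srt k l) w) k k - blk E (G' (srt k l) w) k l) / d%:R).
Notation W2 k l w := (quad E (G' (srt k l) w) (srt k l) (z (srt k l) w) -
   \tr (incr E (G' (srt k l) w) (srt k l)) / d%:R).

Lemma residual_chiE k w : Res k w = p / d%:R * a k k w +
  d%:R^-1 * \sum_(l | l != k) (p * a k l w - chi (srt k l) w * q k l w).
Proof.
rewrite (residualE E_orth d0 p x0); congr (_ + _ * _); apply: eq_bigr => l _.
congr (_ - _); rewrite /y; move: (srt k l) => e.
case: (chi01 e w) => ->; last by rewrite scale1r mul1r.
by rewrite scale0r mul0r /bilin dotvC dotv0r mul0r.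
Qed.

Lemma Res_le k w : `|Res k w| <= Kb.
Proof.
rewrite (le_trans (residual_norm E_orth d0 x0 p0 k (psdmx_lap E (y w)))) //.
by rewrite lerD2l.
Qed.

Lemma Res'_le k e w : `|Res' k e w| <= Kb.
Proof.
rewrite (le_trans (residual_norm E_orth d0 x0 p0 k (psdmx_lap_del E (y w) e))) //.
by rewrite lerD2l.
Qed.

Lemma Res_near k e w : (e.1 < e.2)%N -> `|Res k w - Res' k e w| <= rh.
Proof.
move=> e12; rewrite (lapD E (y w) e12).
rewrite (le_trans (residual_rank_one E_full d0 x0 p0 _ k (psdmx_lap_del E (y w) e))) //.
rewrite ler_pM2r ?invr_gt0 // lerD2l ler_pM2r ?invr_gt0 // lerD //.
by rewrite ler_pdivrMr // mul1r (le_trans p1) // ler1n.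
Qed.

Lemma btr_near k l e w : (e.1 < e.2)%N -> `|btr E (G' e w) k l - btr E (G w) k l| <= del.
Proof.
move=> e12; rewrite (lapD E (y w) e12).
exact: (btr_rank_one_norm E_full d0 _ (psdmx_lap_del E (y w) e) x0).
Qed.

(** Deleting the edge from both the residual and the fraction leaves the first summand, which
    decoupling will show to have mean zero. The others bound the fluctuation of the two forms, the
    cross trace and the effect of the deletion. *)
Lemma residual_term_pointwise k l w : l != k ->
  Res k w * (p * a k l w - chi (srt k l) w * q k l w) <=
  (p - chi (srt k l) w) * (Res' k (srt k l) w * a' k l (srt k l) w) +
  (Kb * (chi (srt k l) w * `|W1 k l w|) + Kb * (chi (srt k l) w * `|W2 k l w|)
   + 3 * Kb * (chi (srt k l) w * `|btr E (G' (srt k l) w) k l|)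
   + (rh * Q * chi (srt k l) w + (rh * p + 2 * Kb * p * del))).
Proof.
move=> lk; have e12 := srt_lt lk.
have pA := psdmx_lap_del E (y w) (srt k l).
have pL := psdmx_lap E (y w).
have g0 m : 0 <= btr E (G w) m m by exact: btr_ge0.
have g0' m : 0 <= btr E (G' (srt k l) w) m m by exact: btr_ge0.
have H1 := Res_le k w; have H2 := Res'_le k (srt k l) w.
have H3 := Res_near k w e12.
have H4 : `|q k l w| <= Q := norm_bilin_frac E_orth E_full x0 k l pA (zC (srt k l) w).
have H5 := bilin_frac_near E x0 k l (z (srt k l) w) pA erefl.
have H6 : `|a k l w - a' k l (srt k l) w| <= 2 * del.
  rewrite (le_trans (frac_lip _ _ _ _)) // mulr2n mulrDl mul1r.
  by rewrite lerD // distrC; exact: btr_near.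
have H7 : `|a k l w| <= 1 by exact: norm_frac_le.
move: H1 H2 H3 H4 H5 H6 H7.
move: (Res k w) (Res' _ _ _) (q k l w) (a k l w) (a' _ _ _ _) => A A' qq b b'.
move: (W1 k l w) (W2 k l w) => w1 w2.
move: (btr _ _ k l) => t H1 H2 H3 H4 H5 H6 H7.
have c01 := chi01 (srt k l) w; move: (chi _ w) c01 => ch c01.
have ch0 : 0 <= ch by case: c01 => ->.
have -> : A * (p * b - ch * qq) = (p - ch) * (A' * b') + (A' * (ch * (b' - qq))
   + (A - A') * (p * b - ch * qq) + A' * (p * (b - b'))) by ring.
rewrite lerD2l.
have T1 : A' * (ch * (b' - qq)) <= Kb * (ch * (`|w1| + `|w2| + 3 * `|t|)).
  rewrite (le_trans (ler_norm _)) // normrM (normrM ch) (ger0_norm ch0).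
  by rewrite ler_pM ?mulr_ge0 // ler_wpM2l // distrC.
have T2 : (A - A') * (p * b - ch * qq) <= rh * (p + ch * Q).
  rewrite (le_trans (ler_norm _)) // normrM ler_pM //.
  rewrite (le_trans (ler_normB _ _)) // (normrM p) (normrM ch) (ger0_norm ch0) (ger0_norm p0).
  by rewrite lerD // ?ler_wpM2l // ler_piMr.
have T3 : A' * (p * (b - b')) <= Kb * (p * (2 * del)).
  rewrite (le_trans (ler_norm _)) // normrM (normrM p) (ger0_norm p0).
  by rewrite ler_pM ?mulr_ge0 // ler_wpM2l.
rewrite (le_trans (lerD (lerD T1 T2) T3)) //; apply: le_of_eq.
by ring.
Qed.


Let bW1D k l : l != k -> forall i j, bmf ((fun w =>
  (blk E (G' (srt k l) w) k k - blk E (G' (srt k l) w) k l) i j) : SR (srt k l) -> R).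
Proof.
move=> /srt_lt e12 i j; have mA := mfmx_lap_del e12.
have b a b' : bmf ((fun w => blk E (G' (srt k l) w) a b' i j) : SR (srt k l) -> R).
  exact: (@bmf_blk _ (SR (srt k l)) _ _ _ _ _ E_orth E_full _ x0 _ (fun w => psdmx_lap_del E (y w) (srt k l)) mA).
by apply: eq_bmf (bmfB (b k k) (b k l)) => w; rewrite !mxE.
Qed.

Let bW2D e : (e.1 < e.2)%N -> forall i j, bmf ((fun w => incr E (G' e w) e i j) : SR e -> R).
Proof.
move=> e12 i j; have mA := mfmx_lap_del e12.
have b a b' : bmf ((fun w => blk E (G' e w) a b' i j) : SR e -> R).
  exact: (@bmf_blk _ (SR e) _ _ _ _ _ E_orth E_full _ x0 _ (fun w => psdmx_lap_del E (y w) e) mA).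
apply: eq_bmf (bmfB (bmfB (b e.1 e.1) (b e.2 e.1)) (bmfB (b e.1 e.2) (b e.2 e.2))) => w.
by rewrite incrE !mxE.
Qed.

Lemma bmf_Res k : bmf (fun w => Res k w).
Proof. exact: (bmf_residual E_orth E_full d0 x0 p0 (fun w => psdmx_lap E (y w)) mfmx_lap). Qed.

Lemma bmf_chi_fraction k l : l != k -> bmf (fun w => chi (srt k l) w * q k l w).
Proof.
move=> lk; have e12 := srt_lt lk; apply: bmfM; first exact: bmf_chi.
split; last first.
  exists Q => w; exact: (norm_bilin_frac E_orth E_full x0 k l (psdmx_lap_del E (y w) (srt k l)) (zC (srt k l) w)).
have mz : mfmx (z (srt k l)).
  by move=> i j; rewrite ord1; have [] := bmf_sub_sigma (GV_m e12) (bmf_z i e12).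
have mD1 : mfmx (fun w => blk E (G' (srt k l) w) k k - blk E (G' (srt k l) w) k l).
  by move=> i j; have [] := bmf_sub_sigma (GR_m e12) (bW1D lk i j).
have mD2 : mfmx (fun w => incr E (G' (srt k l) w) (srt k l)).
  by move=> i j; have [] := bmf_sub_sigma (GR_m e12) (bW2D e12 i j).
apply: measurable_funM; first by apply: measurable_dotv => //; exact: mfmxM.
apply: measurable_funV; apply: measurable_funD => //.
by apply: measurable_dotv => //; exact: mfmxM.
Qed.

Lemma bmf_afrac k l : bmf (fun w => a k l w).
Proof. exact: (bmf_frac E_orth E_full d0 x0 (fun w => psdmx_lap E (y w)) mfmx_lap). Qed.

Lemma bmf_btr_lap k l : bmf (fun w => btr E (G w) k l).
Proof. exact: (bmf_btr E_orth E_full d0 x0 (fun w => psdmx_lap E (y w)) mfmx_lap). Qed.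

Let cc : R := Kb * (5 + 20 / x ^+ 2 + 5 / x) + (1 + (k0 + 1) / x) * (1 + Q).

Lemma Ex_residual_term k l : l != k ->
  Ex P (fun w => Res k w * (p * a k l w - chi (srt k l) w * q k l w)) <=
  p * (th * cc + 3 * Kb / th * Ex P (fun w => btr E (G w) k l ^+ 2)).
Proof.
move=> lk; have e12 := srt_lt lk; set e := srt k l in e12 *.
have pA w := psdmx_lap_del E (y w) e; have mA := mfmx_lap_del e12.
have bc := bmf_chi e12.
have bU : bmf ((fun w => Res' k e w * a' k l e w) : SR e -> R).
  by apply: bmfM; [exact: (@bmf_residual _ (SR e) _ _ _ _ _ E_orth E_full d0 _ _ x0 p0 _ pA mA)
    |exact: (@bmf_frac _ (SR e) _ _ _ _ _ E_orth E_full d0 _ x0 _ pA mA)].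
have bt : bmf ((fun w => btr E (G' e w) k l) : SR e -> R).
  exact: (@bmf_btr _ (SR e) _ _ _ _ _ E_orth E_full d0 _ x0 _ pA mA).
have bta := bmf_norm bt.
have bU' := bmf_sub_sigma (GR_m e12) bU; have bta' := bmf_sub_sigma (GR_m e12) bta.
have bw1 : bmf (fun w => chi e w * `|W1 k l w|).
  by apply: bmfM => //; apply: bmf_norm; exact: bmf_quad e12 (bW1D lk).
have bw2 : bmf (fun w => chi e w * `|W2 k l w|).
  by apply: bmfM => //; apply: bmf_norm; exact: bmf_quad e12 (bW2D e12).
have bct : bmf (fun w => chi e w * `|btr E (G' e w) k l|) by exact: bmfM.
have bcU : bmf (fun w => (p - chi e w) * (Res' k e w * a' k l e w)).
  by apply: bmfM => //; apply: bmfB => //; exact: bmf_cst.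
have bZ (c : R) (f : T -> R) : bmf f -> bmf (fun w => c * f w) by move=> bf; apply: bmfM => //; exact: bmf_cst.
have bK : bmf (fun _ : T => rh * p + 2 * Kb * p * del) := @bmf_cst _ _ _ _.
(* [Res'] and [a'] depend on the other edges only, so [chi e] may be replaced by its mean [p]. *)
have E0 : Ex P (fun w => (p - chi e w) * (Res' k e w * a' k l e w)) = 0.
  transitivity (Ex P (fun w => p * (Res' k e w * a' k l e w) -
      chi e w * 1 * (Res' k e w * a' k l e w))).
    by congr Ex; apply/funext => w; rewrite mulr1 mulrBl.
  rewrite ExB; [|exact: bZ|by apply: bmfM => //; apply: bmfM => //; exact: bmf_cst].
  rewrite ExZ // (@dec e _ (cst 1) e12 bU (@bmf_cst _ _ _ 1)) Ex_cst mulr1.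
  by rewrite subrr.
(* The trace of the deleted resolvent is decoupled from [chi], then exchanged for that of [G] at
   cost [del]: the bound on sums of squares is for a single matrix, whereas the deleted one varies
   with [l]. *)
have Et : Ex P (fun w => chi e w * `|btr E (G' e w) k l|) <=
    p * (th + th^-1 * Ex P (fun w => btr E (G w) k l ^+ 2) + del).
  apply: (@le_trans _ _ (Ex P (fun w => chi e w * 1 * `|btr E (G' e w) k l|))).
    by apply: le_of_eq; congr Ex; apply/funext => w; rewrite mulr1.
  rewrite (@dec e _ (cst 1) e12 bta (@bmf_cst _ _ _ 1)) Ex_cst mulr1 ler_wpM2l //.
  have b2 : bmf (fun w => btr E (G w) k l ^+ 2) by apply: bmf_exp; exact: bmf_btr_lap.
  have c1 : bmf (fun _ : T => th) := @bmf_cst _ _ _ _.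
  have c2 : bmf (fun _ : T => del) := @bmf_cst _ _ _ _.
  apply: (@le_trans _ _ (Ex P (fun w => th + th^-1 * btr E (G w) k l ^+ 2 + del))).
    apply: le_Ex => // [|w]; first by apply: bmfD => //; apply: bmfD => //; exact: bZ.
    have h := btr_near k l w e12.
    have : `|btr E (G' e w) k l| <= `|btr E (G w) k l| + del.
      rewrite -[btr E (G' e w) k l](subrK (btr E (G w) k l)) addrC.
      by rewrite (le_trans (ler_normD _ _)) // lerD2l.
    move=> /le_trans; apply; rewrite lerD2r.
    rewrite -(ler_pM2l th0) mulrDr mulrA mulfV ?gt_eqF // mul1r -[btr E (G w) k l ^+ 2]real_normK ?num_real //.
    have := sqr_ge0 (th - `|btr E (G w) k l|); have := normr_ge0 (btr E (G w) k l); have := ltW th0.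
    by move: `|btr E _ k l| => u; nra.
  by rewrite ExD //; [rewrite ExD ?Ex_cst ?ExZ //; exact: bZ|apply: bmfD => //; exact: bZ].
have x2 : 0 <= 2 / x :> R by rewrite divr_ge0 // ltW.
have x4 : 0 <= 4 / x :> R by rewrite divr_ge0 // ltW.
have E1 : Ex P (fun w => chi e w * `|W1 k l w|) <= p * (th * (1 + (2 / x) ^+ 2)).
  by apply: Ex_chi_quad e12 x2 (bW1D lk) _ => w u; exact: norm2_bilin_mx.
have E2 : Ex P (fun w => chi e w * `|W2 k l w|) <= p * (th * (1 + (4 / x) ^+ 2)).
  by apply: Ex_chi_quad e12 x4 (bW2D e12) _ => w u; exact: norm2_incr.
apply: (@le_trans _ _ (Ex P (fun w => (p - chi e w) * (Res' k e w * a' k l e w) +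
  (Kb * (chi e w * `|W1 k l w|) + Kb * (chi e w * `|W2 k l w|)
   + 3 * Kb * (chi e w * `|btr E (G' e w) k l|)
   + (rh * Q * chi e w + (rh * p + 2 * Kb * p * del)))))).
  apply: le_Ex => [||w]; last exact: residual_term_pointwise.
    apply: bmfM; first exact: bmf_Res.
    by apply: bmfB; [apply: bZ; exact: bmf_afrac|exact: bmf_chi_fraction].
  by do ![apply: bmfD => // | apply: bZ].
rewrite ExD //; last by do ![apply: bmfD => // | apply: bZ].
rewrite E0 add0r ExD; [|by do ![apply: bmfD => // | apply: bZ]..].
rewrite ExD; [|by do ![apply: bmfD => // | apply: bZ]..].
rewrite ExD; [|by do ![apply: bmfD => // | apply: bZ]..].
rewrite [X in _ + _ + X]ExD; [|exact: bZ|exact: bK].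
rewrite !ExZ // Ex_cst Ex_chi //.
move: Et E1 E2; set X := Ex P _; set Y := Ex P _; set Z := Ex P _; set V := Ex P _ => Et E1 E2.
have del_le : del <= th / x.
  by rewrite /del invfM mulrC ler_pM2r ?invr_gt0.
have rh_le : rh <= (1 + (k0 + 1) / x) * th.
  by rewrite /rh ler_wpM2l // addr_ge0 // divr_ge0 ?addr_ge0 // ltW.
apply: (@le_trans _ _ (Kb * (p * (th * (1 + (2 / x) ^+ 2))) + Kb * (p * (th * (1 + (4 / x) ^+ 2)))
   + 3 * Kb * (p * (th + th^-1 * Y + th / x))
   + ((1 + (k0 + 1) / x) * th * Q * p + ((1 + (k0 + 1) / x) * th * p + 2 * Kb * p * (th / x))))).
  apply: lerD; [apply: lerD; [apply: lerD|]|apply: lerD; [|apply: lerD]].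
  - exact: ler_wpM2l.
  - exact: ler_wpM2l.
  - rewrite ler_wpM2l ?mulr_ge0 // (le_trans Et) // ler_wpM2l // lerD2l //.
  - by rewrite ler_wpM2r // ler_wpM2r.
  - by rewrite ler_wpM2r.
  - by rewrite ler_wpM2l // !mulr_ge0.
apply: le_of_eq; rewrite /cc.
by move: Kb Q k0 => *; field; rewrite !gt_eqF.
Qed.


Let rR0 : 0 < r%:R :> R. Proof. by rewrite ltr0n. Qed.
Let cc0 : 0 <= cc.
Proof.
have xi0 : 0 <= x^-1 by rewrite invr_ge0 ltW.
by rewrite addr_ge0 // mulr_ge0 // !addr_ge0 // ?mulr_ge0 // ?addr_ge0 // invr_ge0 exprn_ge0 // ltW.
Qed.

(** One factor of the square stays whole while the other is expanded by [residual_chiE], so each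
    edge term meets a residual that barely depends on that edge. The diagonal term is at most
    [Kb * (p / d) <= Kb * th]. *)
Lemma Ex_residual_sqr k : Ex P (fun w => Res k w ^+ 2) <= Kb * th +
  p / d%:R * \sum_l (th * cc + 3 * Kb / th * Ex P (fun w => btr E (G w) k l ^+ 2)).
Proof.
have bR := bmf_Res k.
have bt l : l != k -> bmf (fun w => Res k w * (p * a k l w - chi (srt k l) w * q k l w)).
  move=> lk; apply: bmfM => //; apply: bmfB; last exact: bmf_chi_fraction.
  by apply: bmfM; [exact: bmf_cst|exact: bmf_afrac].
have ba : bmf (fun w => p / d%:R * (Res k w * a k k w)).
  by apply: bmfM; [exact: bmf_cst|apply: bmfM => //; exact: bmf_afrac].
have bS : bmf (fun w => \sum_(l | l != k) Res k w * (p * a k l w - chi (srt k l) w * q k l w)).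
  exact: bmf_sum.
have -> : (fun w => Res k w ^+ 2) = fun w => p / d%:R * (Res k w * a k k w) +
  d%:R^-1 * \sum_(l | l != k) Res k w * (p * a k l w - chi (srt k l) w * q k l w).
  apply/funext => w; rewrite -mulr_sumr {1}expr2 [in X in _ * X = _]residual_chiE.
  by move: (\sum_(l | _) _) => *; ring.
rewrite ExD //; last by apply: bmfM => //; exact: bmf_cst.
rewrite [X in _ + X]ExZ // Ex_sum //; apply: lerD.
  apply: Ex_le_cst => // w.
  have h : Res k w * a k k w <= Kb * 1.
    rewrite (le_trans (ler_norm _)) // normrM ler_pM // ?Res_le //.
    by apply: norm_frac_le; apply: btr_ge0 => //; exact: psdmx_lap.
  rewrite mulr1 in h; rewrite (le_trans (ler_wpM2l _ h)) ?divr_ge0 // mulrC.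
  by rewrite ler_wpM2l // (le_trans _ d_th) // ler_pdivrMr // mulVf ?gt_eqF.
have D1 : d%:R^-1 * \sum_(l | l != k) p * (th * cc + 3 * Kb / th * Ex P (fun w => btr E (G w) k l ^+ 2))
   <= p / d%:R * \sum_l (th * cc + 3 * Kb / th * Ex P (fun w => btr E (G w) k l ^+ 2)).
  rewrite -mulr_sumr mulrA (mulrC _ p) ler_wpM2l ?divr_ge0 //.
  rewrite [leRHS](bigD1 k) //= lerDr addr_ge0 // ?mulr_ge0 ?invr_ge0 // ?(ltW th0) //.
  by apply: Ex_ge0 => w; exact: sqr_ge0.
apply: le_trans D1; rewrite ler_pM2l ?invr_gt0 //.
by apply: ler_sum => l lk; exact: Ex_residual_term.
Qed.

Lemma Ex_average_residual :
  Ex P (fun w => (\sum_k `|Res k w|) / r%:R) ^+ 2 <= th * residual_rate x k0 C0.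
Proof.
have bR k : bmf (fun w => `|Res k w|) by apply: bmf_norm; exact: bmf_Res.
have bR2 k : bmf (fun w => Res k w ^+ 2) by apply: bmf_exp; exact: bmf_Res.
have bS : bmf (fun w => (\sum_k `|Res k w|) / r%:R).
  by apply: bmfM; [exact: bmf_sum|exact: bmf_cst].
have bS2 : bmf (fun w => \sum_k Res k w ^+ 2) by exact: bmf_sum.
apply: le_trans (Ex_sqr_le P bS) _.
apply: (@le_trans _ _ (Ex P (fun w => r%:R^-1 * \sum_k Res k w ^+ 2))).
  apply: le_Ex => [||w]; first exact: bmf_exp.
    by apply: bmfM => //; exact: bmf_cst.
  rewrite exprMn [r%:R^-1 ^+ 2]expr2 mulrA mulrC ler_pM2l ?invr_gt0 //.
  rewrite ler_pdivrMr // mulrC (le_trans (sqr_sum_le _)) // card_ord.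
  by rewrite ler_wpM2l // ler_sum // => k _; rewrite real_normK ?num_real.
rewrite ExZ // Ex_sum //.
have bt k l : bmf (fun w => btr E (G w) k l ^+ 2) by apply: bmf_exp; exact: bmf_btr_lap.
(* There are [r^2] cross traces, yet the sum of their squares is of order [r] only. *)
set W := \sum_k \sum_l Ex P (fun w => btr E (G w) k l ^+ 2).
have WE : W <= r%:R * x^-1 ^+ 2.
  rewrite /W exchange_big /=.
  apply: (@le_trans _ _ (\sum_(l < r) x^-1 ^+ 2)); last first.
    by rewrite sumr_const card_ord mulr_natl.
  apply: ler_sum => l _; rewrite -Ex_sum //; apply: Ex_le_cst; first exact: bmf_sum.
  by move=> w; apply: sum_btr_sqr => //; exact: psdmx_lap.
apply: (@le_trans _ _ (r%:R^-1 * (r%:R * (Kb * th) + p / d%:R * (r%:R ^+ 2 * (th * cc) + 3 * Kb / th * W)))).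
  rewrite ler_pM2l ?invr_gt0 //.
  apply: le_trans (ler_sum _ (fun k _ => Ex_residual_sqr k)) _.
  rewrite big_split /= sumr_const card_ord -(mulr_natl (Kb * th)) lerD2l.
  rewrite -mulr_sumr; apply: le_of_eq; congr (_ * _).
  rewrite /W mulr_sumr.
  transitivity (\sum_(k < r) (r%:R * (th * cc) + 3 * Kb / th * \sum_l Ex P (fun w => btr E (G w) k l ^+ 2))).
    apply: eq_bigr => k _; rewrite big_split /= sumr_const card_ord -(mulr_natl (th * cc)); congr (_ + _).
    by rewrite mulr_sumr.
  by rewrite big_split /= sumr_const card_ord -(mulr_natl (_ * (th * cc))); congr (_ + _); ring.
have pr0 : 0 <= p / d%:R by rewrite divr_ge0.
apply: (@le_trans _ _ (Kb * th + (p * r%:R / d%:R) * (th * cc + 3 * Kb * x^-1 ^+ 2 * (th^-1 * r%:R^-1)))).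
  apply: (@le_trans _ _ (r%:R^-1 * (r%:R * (Kb * th) + p / d%:R * (r%:R ^+ 2 * (th * cc) + 3 * Kb / th * (r%:R * x^-1 ^+ 2))))).
    rewrite ler_pM2l ?invr_gt0 // lerD2l ler_wpM2l // lerD2l ler_wpM2l //.
    by rewrite divr_ge0 ?mulr_ge0 // ltW.
  apply: le_of_eq.
  by move: Kb cc => *; field; rewrite !gt_eqF.
(* The factor [th^-1] lost in splitting products is paid for by the [r^-1] gained from averaging the
   cross traces. *)
have thr : th^-1 * r%:R^-1 <= th.
  by rewrite mulrC ler_pdivrMr // -expr2.
have xx0 : 0 <= x^-1 ^+ 2 by rewrite exprn_ge0 // invr_ge0 ltW.
apply: (@le_trans _ _ (Kb * th + k0 * (th * cc + 3 * Kb * x^-1 ^+ 2 * th))).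
  rewrite lerD2l ler_pM //.
  - by rewrite divr_ge0 ?mulr_ge0.
  - by rewrite addr_ge0 // !mulr_ge0 // ?invr_ge0 // ltW.
  - by rewrite lerD2l; apply: ler_wpM2l => //; apply: mulr_ge0 => //; exact: mulr_ge0.
apply: le_of_eq.
by rewrite /residual_rate -/Kb -/Q -/cc exprVn; ring.
Qed.

End average_residual.

(** * Stability of the limiting equation *)

Lemma dist_of_mono (R : realType) (x b : R) (phi : R -> R) s t : 0 < x -> 0 <= b ->
  (forall u v, 0 <= u -> u <= v -> phi u <= phi v) -> 0 <= s -> 0 <= t ->
  x * `|s - t| <= `|(x * s + b * phi s) - (x * t + b * phi t)|.
Proof.
move=> x0 b0 mono; wlog ts : s t / t <= s => [H s0 t0|s0 t0].
  have [ts|/ltW st] := leP t s; first exact: H.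
  by rewrite distrC [leRHS]distrC; exact: H.
have h := ler_wpM2l b0 (mono _ _ t0 ts).
rewrite ger0_norm ?subr_ge0 // (le_trans _ (ler_norm _)) //.
by move: h; move: (phi s) (phi t) => *; nra.
Qed.

Section stieltjes_point.
Context {R : realType} (x c : R).
Hypotheses (x0 : 0 < x) (c0 : 0 <= c).

(** The larger root of [2 x t^2 + (x + c - 2) t - 1 = 0]. Its discriminant [(c + x - 2)^2 + 8 x] is
    written in the form in which it appears in the Stieltjes transform of the limit law. *)
Definition tstar : R := (2 - c - x + Num.sqrt ((2 + c + x) ^+ 2 - 8 * c)) / (4 * x).

Lemma tstarP : 0 <= tstar /\ x * tstar + c * rfrac tstar tstar = 1.
Proof.
have xx := x0; have cc := c0.
have D0 : 0 <= (2 + c + x) ^+ 2 - 8 * c.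
  have -> : (2 + c + x) ^+ 2 - 8 * c = (c + x - 2) ^+ 2 + 8 * x by ring.
  by rewrite addr_ge0 ?sqr_ge0 // mulr_ge0 // ltW.
pose s := Num.sqrt ((2 + c + x) ^+ 2 - 8 * c); have s2 := sqr_sqrtr D0; rewrite -/s in s2.
have sge : `|c + x - 2| <= s.
  rewrite -sqrtr_sqr ler_sqrt //; have -> : (2 + c + x) ^+ 2 - 8 * c = (c + x - 2) ^+ 2 + 8 * x by ring.
  by rewrite lerDl mulr_ge0 // ltW.
have t0 : 0 <= tstar.
  rewrite divr_ge0 ?mulr_ge0 ?(ltW x0) // -/s.
  by have := le_trans (ler_norm _) sge; lra.
split => //; move: t0; rewrite /rfrac /tstar -/s.
set t := (_ / _) => t0.
have st : s = 4 * x * t - (2 - c - x).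
  by rewrite /t; field; rewrite gt_eqF.
have t1 : 0 < 1 + t + t by lra.
have E : x * t * (1 + t + t) + c * t = 1 + t + t.
  move: s2; rewrite st => s2.
  have : 8 * x * (x * t * (1 + t + t) + c * t - (1 + t + t)) = 0.
    by move: s2 => /eqP; rewrite -subr_eq0 => /eqP <-; ring.
  by move=> /eqP; rewrite mulf_eq0 gt_eqF ?mulr_gt0 //= subr_eq0 => /eqP.
have tn : 1 + t + t != 0 by rewrite gt_eqF.
apply: (mulIf tn).
by rewrite mulrDl mul1r -[RHS]E mulrA mulfVK // gt_eqF.
Qed.

End stieltjes_point.

Section stability.
Context {R : realType} (r : nat) (g : 'I_r -> R) (x b c : R).
Hypotheses (x0 : 0 < x) (b0 : 0 <= b) (c0 : 0 <= c) (r0 : (0 < r)%N).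
Hypothesis g0 : forall k, 0 <= g k.

Let Res k : R := x * g k + b * (\sum_l rfrac (g k) (g l)) - 1.
Let gb : R := (\sum_k g k) / r%:R.
Let A : R := (\sum_k `|Res k|) / r%:R.
Let rR0 : 0 < r%:R :> R. Proof. by rewrite ltr0n. Qed.

Lemma dist_le_residual k j : `|g k - g j| <= (`|Res k| + `|Res j|) / x.
Proof.
rewrite ler_pdivlMr // mulrC (le_trans (@dist_of_mono _ x b (fun u => \sum_l rfrac u (g l)) _ _ x0 b0 _ (g0 k) (g0 j))) //.
  move=> u v u0 uv; apply: ler_sum => l _; have gl := g0 l.
  have a1 : 0 < 1 + u + g l by lra.
  have a2 : 0 < 1 + v + g l by lra.
  by rewrite /rfrac ler_pdivrMr // mulrAC ler_pdivlMr //; nra.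
rewrite (le_trans _ (ler_normB _ _)) // /Res.
by apply: le_of_eq; congr `|_|; ring.
Qed.

Let avg_cst (F : 'I_r -> R) y : (\sum_k (F k - y)) / r%:R = (\sum_k F k) / r%:R - y.
Proof.
rewrite sumrB sumr_const card_ord -mulr_natl.
by move: (\sum_k _) => u; field; rewrite gt_eqF.
Qed.

Lemma dist_mean_le k : `|g k - gb| <= (`|Res k| + A) / x.
Proof.
have -> : g k - gb = - ((\sum_j (g j - g k)) / r%:R).
  by rewrite avg_cst opprB.
rewrite normrN normrM (ger0_norm (_ : 0 <= r%:R^-1)) ?invr_ge0 ?ler0n //.
rewrite ler_pdivrMr // (le_trans (ler_norm_sum _ _ _)) //.
apply: (@le_trans _ _ (\sum_j (`|Res j| + `|Res k|) / x)).
  by apply: ler_sum => j _; exact: dist_le_residual.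
rewrite -mulr_suml big_split /= sumr_const card_ord -(mulr_natl `|Res k|) /A.
apply: le_of_eq.
by move: (\sum_k _) `|Res k| => *; field; rewrite !gt_eqF.
Qed.

Lemma average_dist_mean_le : \sum_k `|g k - gb| <= r%:R * (2 * A / x).
Proof.
apply: (@le_trans _ _ (\sum_k (`|Res k| + A) / x)).
  by apply: ler_sum => k _; exact: dist_mean_le.
rewrite -mulr_suml big_split /= sumr_const card_ord -(mulr_natl A).
have -> : \sum_k `|Res k| = r%:R * A by rewrite /A mulrCA mulfV ?mulr1 // gt_eqF.
by apply: le_of_eq; ring.
Qed.

(** Averaging the residuals shows that [gb] nearly solves the scalar equation, with errors from
    [b r - c], from the residuals and from replacing [g k], [g l] by their mean; monotonicity then
    compares [gb] with the exact solution. The 4 is two arguments of [rfrac], each at average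
    distance at most [2 A / x]. *)
Lemma mean_stability :
  `|gb - tstar x c| <= (`|b * r%:R - c| + (1 + 4 * (b * r%:R) / x) * A) / x.
Proof.
have [t0 tE] := tstarP x0 c0.
have gb0 : 0 <= gb by rewrite divr_ge0 ?ler0n //; apply: sumr_ge0.
rewrite ler_pdivlMr // mulrC.
have := @dist_of_mono _ x c (fun u => rfrac u u) gb _ x0 c0 _ gb0 t0.
rewrite tE => /(_ _) h; apply: le_trans (h _) _ => {h}.
  move=> u v u0 uv; have a1 : 0 < 1 + u + u by lra.
  have a2 : 0 < 1 + v + v by lra.
  by rewrite /rfrac ler_pdivrMr // mulrAC ler_pdivlMr //; nra.
pose S := \sum_k \sum_l (rfrac (g k) (g l) - rfrac gb gb).
have SE : S = \sum_k \sum_l rfrac (g k) (g l) - r%:R * (r%:R * rfrac gb gb).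
  rewrite /S; under eq_bigr do rewrite sumrB sumr_const card_ord -(mulr_natl (rfrac _ _)).
  by rewrite sumrB sumr_const card_ord -(mulr_natl (_ * rfrac _ _)).
have RE : \sum_k Res k = x * (r%:R * gb) + b * (\sum_k \sum_l rfrac (g k) (g l)) - r%:R.
  rewrite /Res sumrB sumr_const card_ord big_split /= -!mulr_sumr.
  by rewrite /gb (mulrCA r%:R) mulfV ?mulr1 // gt_eqF.
have key : x * gb + c * rfrac gb gb - 1 =
  (\sum_k Res k) / r%:R - b * S / r%:R - (b * r%:R - c) * rfrac gb gb.
  by rewrite RE SE; move: (\sum_k _) (rfrac gb gb) gb => *; field; rewrite gt_eqF.
have S_le : `|S| <= r%:R * (r%:R * (4 * A / x)).
  rewrite (le_trans (ler_norm_sum _ _ _)) //.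
  apply: (@le_trans _ _ (\sum_k \sum_l (`|g k - gb| + `|g l - gb|))).
    apply: ler_sum => k _; rewrite (le_trans (ler_norm_sum _ _ _)) //.
    by apply: ler_sum => l _; exact: frac_lip.
  have -> : \sum_k \sum_l (`|g k - gb| + `|g l - gb|) =
      r%:R * (\sum_k `|g k - gb| + \sum_l `|g l - gb|).
    transitivity (\sum_k (r%:R * `|g k - gb| + \sum_l `|g l - gb|)).
      by apply: eq_bigr => k _; rewrite big_split /= sumr_const card_ord mulr_natl.
    by rewrite big_split /= sumr_const card_ord -mulr_sumr mulrDr mulr_natl.
  rewrite ler_wpM2l // (le_trans (lerD average_dist_mean_le average_dist_mean_le)) //.
  by apply: le_of_eq; ring.
rewrite key (le_trans (ler_normB _ _)) // addrC lerD //.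
  rewrite normrM ler_piMr // norm_frac_le //.
rewrite (le_trans (ler_normB _ _)) // mulrDl mul1r lerD //.
  rewrite normrM (ger0_norm (_ : 0 <= r%:R^-1)) ?invr_ge0 ?ler0n //.
  by rewrite ler_pM2r ?invr_gt0 // ler_norm_sum.
rewrite normrM (normrM b) (ger0_norm b0) (ger0_norm (_ : 0 <= r%:R^-1)) ?invr_ge0 ?ler0n //.
rewrite ler_pdivrMr // (le_trans (ler_wpM2l b0 S_le)) //.
by apply: le_of_eq; ring.
Qed.

End stability.

(** * Isotropic vectors *)

Section operator_norm.
Context {R : realType} (n : nat).
Implicit Types (D : 'M[R]_n) (u : 'cV[R]_n).

Let S D : set R := [set norm2 (D *m x) | x in [set x : 'cV[R]_n | norm2 x <= 1]].

Lemma norm2_0 : norm2 (0 : 'cV[R]_n) = 0.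
Proof. by rewrite /norm2 dotv0r sqrtr0. Qed.

Lemma opnorm_nonempty D : S D !=set0.
Proof. by exists (norm2 (D *m 0)); exists 0 => //=; rewrite norm2_0. Qed.

Lemma opnorm_le D K : 0 <= K -> (forall u, norm2 (D *m u) <= K * norm2 u) -> opnorm D <= K.
Proof.
move=> K0 DK; apply: ge_sup; first exact: opnorm_nonempty.
by move=> _ [u /= u1 <-]; rewrite (le_trans (DK u)) // ler_piMr.
Qed.

(** [opnorm] is a [sup] of reals, informative only for a bounded set; the constant [K] certifies
    boundedness here and below. *)
Lemma le_opnorm D K u : 0 <= K -> (forall u, norm2 (D *m u) <= K * norm2 u) ->
  norm2 u <= 1 -> norm2 (D *m u) <= opnorm D.
Proof.
move=> K0 DK u1; apply: ub_le_sup; last by exists u.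
by exists K => _ [u' /= u1' <-]; rewrite (le_trans (DK u')) // ler_piMr.
Qed.

Lemma opnorm_ge0 D K : 0 <= K -> (forall u, norm2 (D *m u) <= K * norm2 u) -> 0 <= opnorm D.
Proof.
move=> K0 DK; apply: le_trans (le_opnorm K0 DK (_ : norm2 0 <= 1)).
  exact: norm2_ge0.
by rewrite norm2_0.
Qed.

Lemma opnorm_eq0 D K : 0 <= K -> (forall u, norm2 (D *m u) <= K * norm2 u) ->
  opnorm D = 0 -> D = 0.
Proof.
move=> K0 DK D0; apply/matrixP => i j; rewrite mxE; apply/eqP; rewrite -normr_le0.
have h : `|(D *m (delta_mx j 0 : 'cV[R]_n)) i 0| <= 0.
  rewrite -D0 (le_trans (norm_entry_le _ _)) // (le_opnorm K0 DK) //.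
  by rewrite /norm2 dotv_delta mxE !eqxx sqrtr1.
by move: h; rewrite -colE mxE.
Qed.

Lemma opnormZ D K a : 0 <= K -> (forall u, norm2 (D *m u) <= K * norm2 u) -> 0 < a ->
  opnorm (a *: D) = a * opnorm D.
Proof.
move=> K0 DK a0.
have aDK u : norm2 (a *: D *m u) <= a * K * norm2 u.
  by rewrite -scalemxAl norm2Z gtr0_norm // -mulrA ler_pM2l.
apply/le_anti/andP; split.
  apply: ge_sup; first exact: opnorm_nonempty.
  move=> _ [u /= u1 <-]; rewrite -scalemxAl norm2Z gtr0_norm // ler_pM2l //.
  exact: (le_opnorm K0 DK).
rewrite mulrC -ler_pdivlMr //; apply: ge_sup; first exact: opnorm_nonempty.
move=> _ [u /= u1 <-]; rewrite ler_pdivlMr // mulrC.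
have := le_opnorm (mulr_ge0 (ltW a0) K0) aDK u1.
by rewrite -scalemxAl norm2Z gtr0_norm.
Qed.

Lemma opnorm1 : (0 < n)%N -> opnorm (1%:M : 'M[R]_n) = 1.
Proof.
move=> n0; have h u : norm2 ((1%:M : 'M[R]_n) *m u) <= 1 * norm2 u by rewrite mul1mx mul1r.
apply/le_anti/andP; split; first exact: opnorm_le.
have d1 : norm2 (delta_mx (Ordinal n0) 0 : 'cV[R]_n) = 1.
  by rewrite /norm2 dotv_delta mxE !eqxx sqrtr1.
by have := @le_opnorm 1%:M 1 (delta_mx (Ordinal n0) 0) ler01 h; rewrite mul1mx d1; apply.
Qed.

End operator_norm.

Section truncation.
Context {R : realType} (d : nat) (C0 : R).
Hypothesis C0_ge0 : 0 <= C0.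

(** Vectors that are too long go to 0. As a function of the vector alone, the truncation stays
    measurable for the sigma-algebra of its own edge, which preserves independence. *)
Definition trunc (u : 'cV[R]_d) : 'cV[R]_d := (dotv u u <= C0)%R%:R *: u.

Lemma dotv_trunc u : dotv (trunc u) (trunc u) <= C0.
Proof.
rewrite /trunc; case: (leP (dotv u u) C0) => h; first by rewrite scale1r.
by rewrite scale0r dotv0r.
Qed.

Lemma mfmx_trunc dd (S : measurableType dd) (u : S -> 'cV[R]_d) :
  mfmx u -> mfmx (fun w => trunc (u w)).
Proof.
move=> mu; apply: mfmxZ => //.
have m : measurable [set w | dotv (u w) (u w) <= C0].
  have := measurable_dotv mu mu measurableT (measurable_itv `]-oo, C0]).
  rewrite setTI; congr measurable; apply/seteqP; split => w /=; rewrite in_itv //=.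
apply: (@eq_mf _ _ _ (\1_[set w | dotv (u w) (u w) <= C0])) => [w|].
  by rewrite indicE mem_setE.
exact: measurable_indic.
Qed.

End truncation.

Section isotropic_vector.
Context dd (T : measurableType dd) (R : realType) (P : probability T R).
Variables (d : nat) (v : T -> 'cV[R]_d) (C0 : R).
Hypothesis C0_ge0 : 0 <= C0.
Hypothesis mv : mfmx v.
Hypothesis v_isotropic : forall i j : 'I_d,
     'E_P[fun w => (v w *m (v w)^T) i j]%E = ((d%:R^-1)%:M i j : R)%:E.
Hypothesis v_bounded : {ae P, forall w, norm2 (v w) ^+ 2 <= C0}.
Notation z w := (trunc C0 (v w)).

Lemma trunc_ae : {ae P, forall w, z w = v w}.
Proof.
apply: filterS v_bounded => w; rewrite norm2_sqr /trunc => ->.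
by rewrite scale1r.
Qed.

Lemma bmf_trunc i : bmf (fun w => z w i 0).
Proof.
split; first exact: mfmx_trunc.
exists (Num.sqrt C0) => w; rewrite (le_trans (norm_entry_le _ _)) //.
by rewrite ler_sqrt // dotv_trunc.
Qed.

Lemma Ex_ae (f g : T -> R) : measurable_fun setT f -> bmf g -> {ae P, forall w, g w = f w} ->
  'E_P[f]%E = (Ex P g)%:E.
Proof.
move=> mf bg fg; rewrite unlock ExE //; apply: ae_eq_integral => //.
- exact/measurable_EFinP.
- by apply/measurable_EFinP; case: bg.
- by apply: filterS fg => w -> _.
Qed.

Lemma Ex_trunc i j : Ex P (fun w => z w i 0 * z w j 0) = (i == j)%:R / d%:R.
Proof.
have b : bmf (fun w => z w i 0 * z w j 0) by apply: bmfM; exact: bmf_trunc.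
have m : measurable_fun setT (fun w => (v w *m (v w)^T) i j).
  by have := mfmxM mv (mfmx_tr mv) i j.
have h : {ae P, forall w, z w i 0 * z w j 0 = (v w *m (v w)^T) i j}.
  by apply: filterS trunc_ae => w ->; rewrite mxE big_ord1 mxE.
have := Ex_ae m b h; rewrite v_isotropic => -[<-].
by rewrite mxE; case: eqP => _; rewrite ?mulr1n ?mulr0n ?mul1r ?mul0r.
Qed.

Let quadEsum (D : 'M[R]_d) (u : 'cV[R]_d) : dotv u (D *m u) = \sum_i \sum_j D i j * (u i 0 * u j 0).
Proof.
apply: eq_bigr => i _; rewrite mxE mulr_sumr.
by apply: eq_bigr => j _; rewrite mulrCA.
Qed.

Lemma bmf_quad_trunc (D : 'M[R]_d) : bmf (fun w => dotv (z w) (D *m z w)).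
Proof.
apply: eq_bmf (_ : bmf (fun w => \sum_i \sum_j D i j * (z w i 0 * z w j 0))) => [w|].
  by rewrite quadEsum.
apply: bmf_sum => i _; apply: bmf_sum => j _; apply: bmfM; first exact: bmf_cst.
by apply: bmfM; exact: bmf_trunc.
Qed.

Lemma Ex_quad_trunc (D : 'M[R]_d) : Ex P (fun w => dotv (z w) (D *m z w)) = \tr D / d%:R.
Proof.
transitivity (Ex P (fun w => \sum_i \sum_j D i j * (z w i 0 * z w j 0))).
  by congr Ex; apply/funext => w; rewrite quadEsum.
have b i j : bmf (fun w => D i j * (z w i 0 * z w j 0)).
  by apply: bmfM; [exact: bmf_cst|apply: bmfM; exact: bmf_trunc].
rewrite Ex_sum => [|i _]; last exact: bmf_sum.
rewrite /mxtrace mulr_suml; apply: eq_bigr => i _.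
rewrite Ex_sum // (bigD1 i) //= big1 ?addr0 => [|j ji].
  by rewrite ExZ ?Ex_trunc ?eqxx ?mul1r //; apply: bmfM; exact: bmf_trunc.
rewrite ExZ ?Ex_trunc 1?eq_sym ?(negPf ji) ?mul0r ?mulr0 //.
by apply: bmfM; exact: bmf_trunc.
Qed.

Lemma variance_trunc (D : 'M[R]_d) : 'V_P[fun w => dotv (D *m v w) (v w)]%E =
  (Ex P (fun w => (dotv (z w) (D *m z w) - \tr D / d%:R) ^+ 2))%:E.
Proof.
have bq := bmf_quad_trunc D.
have mX : measurable_fun setT (fun w => dotv (D *m v w) (v w)).
  by apply: measurable_dotv => //; apply: mfmxM => //; exact: mfmx_cst.
have XE : {ae P, forall w, dotv (z w) (D *m z w) = dotv (D *m v w) (v w)}.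
  by apply: filterS trunc_ae => w ->; rewrite dotvC.
rewrite /variance covariance.unlock (Ex_ae mX bq XE) Ex_quad_trunc /=.
apply: Ex_ae.
- by apply: measurable_funM; apply: measurable_funB.
- by apply: bmf_exp; apply: bmfB => //; exact: bmf_cst.
- by apply: filterS XE => w ->; rewrite expr2.
Qed.

End isotropic_vector.

(** * Uniformity of the variance bound *)

Section uniform_variance.
Context (R : realType) (disp : nat -> measure_display) (T : forall r, measurableType (disp r))
  (P : forall r, probability (T r) R) (d : nat -> nat)
  (v : forall r, 'I_r -> 'I_r -> T r -> 'cV[R]_(d r)).
Hypothesis v_variance : forall D : forall n, 'M[R]_n,
     (forall n, (0 < n)%N -> opnorm (D n) = 1) ->
     ereal_sup [set 'V_(P r)[fun w =>
                       dotv (D (d r) *m v kl.1 kl.2 w) (v kl.1 kl.2 w)]%E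
               | kl in [set kl : 'I_r * 'I_r | (kl.1 < kl.2)%N]]
       @[r --> \oo] --> 0%E.
Hypothesis d_infty : d r @[r --> \oo] --> \oo.

Let V r (D : 'M[R]_(d r)) (kl : 'I_r * 'I_r) : \bar R :=
  'V_(P r)[fun w => dotv (D *m v kl.1 kl.2 w) (v kl.1 kl.2 w)]%E.

(* If the variance bound failed for arbitrarily large r, a single family D,
   holding in each dimension n = d r a violating matrix for some such r,
   would contradict v_variance; this works because d r tends to infinity. *)
Lemma uniform_variance (eps : R) : 0 < eps -> \forall r \near \oo,
  forall D : 'M[R]_(d r), opnorm D = 1 ->
  forall kl : 'I_r * 'I_r, (kl.1 < kl.2)%N -> (V D kl <= eps%:E)%E.
Proof.
move=> eps0.
pose bad r (D : 'M[R]_(d r)) :=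
  exists kl : 'I_r * 'I_r, (kl.1 < kl.2)%N /\ (eps%:E < V D kl)%E.
(* Quantifying over families [F] with [F n = D] lets a matrix of size [n] be used at size [d r = n]
   without a cast along the equality. *)
have pick n : exists D : 'M[R]_n, ((0 < n)%N -> opnorm D = 1) /\
    ((exists r, d r = n /\ exists D' : 'M[R]_(d r), opnorm D' = 1 /\ bad r D') ->
     exists r, d r = n /\ forall F : (forall m, 'M[R]_m), F n = D -> bad r (F (d r))).
  have [[r [rn [D' [oD' bD']]]]|nb] := pselect
    (exists r, d r = n /\ exists D' : 'M[R]_(d r), opnorm D' = 1 /\ bad r D').
    subst n; exists D'; split=> // _; exists r; split=> // F ->; exact: bD'.
  by exists 1%:M; split=> [|//]; exact: opnorm1.
pose F n := projT1 (cid (pick n)).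
have F1 n : (0 < n)%N -> opnorm (F n) = 1 by have [] := projT2 (cid (pick n)).
have F2 n : (exists r, d r = n /\ exists D' : 'M[R]_(d r), opnorm D' = 1 /\ bad r D') ->
    exists r, d r = n /\ bad r (F (d r)).
  have [_ H] := projT2 (cid (pick n)) => /H [r [rn Hr]]; exists r; split=> //.
  exact: Hr.
have small : \forall r \near \oo, ~ bad r (F (d r)).
  have h : nbhs (0%E : \bar R) [set y : \bar R | (y < eps%:E)%E].
    have e0 : (0%E < eps%:E :> \bar R)%E by rewrite lte_fin.
    exact: (open_ereal_lt' e0).
  have h2 : \forall r \near \oo, (ereal_sup [set V (F (d r)) kl
      | kl in [set kl : 'I_r * 'I_r | (kl.1 < kl.2)%N]] < eps%:E)%E := v_variance F1 h.
  apply: filterS h2 => r sr [kl [kl12 epsV]].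
  have : (V (F (d r)) kl <= ereal_sup [set V (F (d r)) kl
      | kl in [set kl : 'I_r * 'I_r | (kl.1 < kl.2)%N]])%E by apply: ereal_sup_ubound; exists kl.
  by move=> /(lt_le_trans epsV) /lt_trans /(_ sr); rewrite ltxx.
have [N _ HN] := small.
(* A violation in dimension [d r > M] gives one by the family [F] at some [r'] with [d r' = d r].
   All indices below [N] have dimension at most [M], so [r' >= N], where [F] is known to be good. *)
pose M := \max_(r < N) d r.
have big : \forall r \near \oo, (M < d r)%N.
  exact: (d_infty (nbhs_infty_gt M)).
apply: filterS big => r Mr D oD kl kl12; rewrite leNgt; apply/negP => Vkl.
have [r' [dr' br']] : exists r', d r' = d r /\ bad r' (F (d r')).
  by apply: F2; exists r; split=> //; exists D; split=> //; exists kl.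
apply: (HN r') br' => /=; rewrite leqNgt; apply/negP => r'N.
have : (d r' <= M)%N by exact: (@leq_bigmax _ (fun i : 'I_N => d i) (Ordinal r'N)).
by rewrite dr' leqNgt Mr.
Qed.

Variable C0 : R.
Hypothesis C0_ge0 : 0 <= C0.
Hypothesis v_measurable : forall r (k l : 'I_r) (i : 'I_(d r)), (k < l)%N ->
     measurable_fun setT (fun w => v k l w i 0).
Hypothesis v_isotropic : forall r (k l : 'I_r), (k < l)%N -> forall i j : 'I_(d r),
     'E_(P r)[fun w => (v k l w *m (v k l w)^T) i j]%E
       = (((d r)%:R^-1)%:M i j : R)%:E.
Hypothesis v_bounded : forall r (k l : 'I_r), (k < l)%N ->
       {ae P r, forall w, norm2 (v k l w) ^+ 2 <= C0}.

(** Uniformity over [D] is essential because [D] will be a frozen value of blocks of a random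
    resolvent. Dividing by [opnorm D] reduces to norm 1, with [D = 0] apart. *)
Lemma uniform_variance_trunc (eps : R) : 0 < eps -> \forall r \near \oo,
  forall (k l : 'I_r) (D : 'M[R]_(d r)) (K : R), (k < l)%N -> 0 <= K ->
  (forall u, norm2 (D *m u) <= K * norm2 u) ->
  Ex (P r) (fun w => (dotv (trunc C0 (v k l w)) (D *m trunc C0 (v k l w))
    - \tr D / (d r)%:R) ^+ 2) <= K ^+ 2 * eps.
Proof.
move=> eps0; apply: filterS (uniform_variance eps0) => r H k l D K kl K0 DK.
have mv : mfmx (v k l) by move=> i j; rewrite ord1; exact: v_measurable.
have oK := opnorm_le K0 DK; have o0 := opnorm_ge0 K0 DK.
have [oD|oD] := eqVneq (opnorm D) 0.
  rewrite (opnorm_eq0 K0 DK oD) (_ : (fun w => _) = cst 0).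
    by rewrite Ex_cst mulr_ge0 ?exprn_ge0 // ltW.
  by apply/funext => w; rewrite mul0mx dotv0r mxtrace0 mul0r subrr expr0n.
have op : 0 < opnorm D by rewrite lt_neqAle eq_sym oD.
pose D1 := (opnorm D)^-1 *: D.
have D1E : opnorm D1 = 1.
  by rewrite (opnormZ K0 DK) ?invr_gt0 // mulVf.
have := H D1 D1E (k, l) kl.
rewrite /V /= (variance_trunc C0_ge0 mv (v_isotropic kl) (v_bounded kl)) lee_fin => h.
have bq : bmf (fun w => (dotv (trunc C0 (v k l w)) (D1 *m trunc C0 (v k l w))
    - \tr D1 / (d r)%:R) ^+ 2).
  by apply: bmf_exp; apply: bmfB; [exact: bmf_quad_trunc|exact: bmf_cst].
have -> : (fun w => (dotv (trunc C0 (v k l w)) (D *m trunc C0 (v k l w)) - \tr D / (d r)%:R) ^+ 2)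
  = fun w => opnorm D ^+ 2 * (dotv (trunc C0 (v k l w)) (D1 *m trunc C0 (v k l w))
    - \tr D1 / (d r)%:R) ^+ 2.
  apply/funext => w; rewrite -exprMn mulrBr /D1 -scalemxAl dotvZr mxtraceZ.
  move: (dotv _ _) (\tr D) ((d r)%:R^-1) (opnorm D) oD => a b c' o o0'.
  by congr (_ ^+ 2); field.
rewrite ExZ //; apply: ler_pM => //; first exact: exprn_ge0.
  by apply: Ex_ge0 => w; exact: sqr_ge0.
by rewrite ler_pXn2r // nnegrE.
Qed.

End uniform_variance.

(** * The graph Laplacian as a sum of dyads *)

Section block_embedding.
Context {R : realType} (r d : nat).
Notation n := (\sum_(k < r) d)%N.
Implicit Types (k l : 'I_r) (e : 'I_r * 'I_r).

Definition bE k : 'M[R]_(n, d) := mxcol (fun j : 'I_r => ((j == k)%:R : R)%:M).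

Lemma bE_orth k l : (bE k)^T *m bE l = (k == l)%:R%:M.
Proof.
rewrite /bE tr_mxcol mul_mxrow_mxcol (bigD1 k) //= big1 ?addr0 => [|j jk].
  by rewrite eqxx tr_scalar_mx mul1mx.
by rewrite (negPf jk) tr_scalar_mx raddf0 mul0mx.
Qed.

Lemma bE_full : \sum_k bE k *m (bE k)^T = 1%:M.
Proof.
transitivity (mxblock (fun i j : 'I_r => (i == j)%:R%:M : 'M[R]_d)); last first.
  rewrite -[RHS]mxdiagZ; apply: eq_mxblock => i j; case: eqP => _; last by rewrite raddf0.
  by rewrite conform_mx_id.
transitivity (\sum_(k < r) mxblock (fun i j : 'I_r =>
    (i == k)%:R%:M *m ((j == k)%:R%:M)^T : 'M[R]_d)).
  by apply: eq_bigr => k _; rewrite /bE tr_mxcol mul_mxcol_mxrow.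
rewrite -mxblock_sum; apply: eq_mxblock => i j.
rewrite (bigD1 i) //= big1 ?addr0 => [|k ki].
  by rewrite eqxx mul1mx tr_scalar_mx eq_sym.
by rewrite eq_sym (negPf ki) raddf0 mul0mx.
Qed.

Lemma sum_const_block : n = (r * d)%N.
Proof. by rewrite sum_nat_const card_ord. Qed.

Let cf e (i : 'I_r) : R := (i == e.1)%:R - (i == e.2)%:R.

Lemma edge_dyad_bE (y : 'I_r * 'I_r -> 'cV[R]_d) e :
  edge_dyad bE y e = mxblock (fun i j : 'I_r => (cf e i * cf e j) *: (y e *m (y e)^T)).
Proof.
rewrite /edge_dyad /edge_vec /bE -mxcolB mxcol_mul tr_mxcol mul_mxcol_mxrow.
apply: eq_mxblock => i j; rewrite -!raddfB /= !mul_scalar_mx linearZ /=.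
by rewrite -scalemxAl -scalemxAr scalerA.
Qed.

Lemma edge_block_srt (xi : 'I_r -> 'I_r -> R) (v : 'I_r -> 'I_r -> 'cV[R]_d) k l :
  edge_block xi v k l = xi (srt k l).1 (srt k l).2 *:
    (v (srt k l).1 (srt k l).2 *m (v (srt k l).1 (srt k l).2)^T).
Proof. by rewrite /edge_block /srt; case: ifP. Qed.

Lemma srtC k l : srt k l = srt l k.
Proof. by rewrite /srt; case: ltngtP => // /val_inj ->. Qed.

Lemma laplacian_mxE (xi : 'I_r -> 'I_r -> R) (v : 'I_r -> 'I_r -> 'cV[R]_d) :
  laplacian_mx xi v = \sum_(e : 'I_r * 'I_r | (e.1 < e.2)%N)
    xi e.1 e.2 *: edge_dyad bE (fun e => v e.1 e.2) e.
Proof.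
pose X e : 'M[R]_d := xi e.1 e.2 *: (v e.1 e.2 *m (v e.1 e.2)^T).
transitivity (mxblock (fun i j : 'I_r =>
    \sum_(e : 'I_r * 'I_r | (e.1 < e.2)%N) (cf e i * cf e j) *: X e)); last first.
  rewrite mxblock_sum; apply: eq_bigr => e _; rewrite edge_dyad_bE.
  have mxblockZ a (B : 'I_r -> 'I_r -> 'M[R]_d) : a *: mxblock B = mxblock (fun i j => a *: B i j).
    by apply/matrixP => s t; rewrite !mxE.
  by rewrite mxblockZ; apply: eq_mxblock => i j; rewrite /X !scalerA mulrC.
rewrite /laplacian_mx /adjacency_mx -mxblockB; apply: eq_mxblock => i j.
apply/matrixP => a b; rewrite summxE.
(* Block row [i] sees only edges at [i]. On the edge to [l] the product of coefficients is 1 for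
   [j = i] and -1 for [j = l], as the sign of the orientation occurs twice. *)
transitivity (\sum_(l | l != i) ((j == i)%:R - (j == l)%:R) * X (srt i l) a b); last first.
  under [RHS]eq_bigr do rewrite mxE.
  rewrite (@sum_incident _ _ i); last first.
    move=> e _ e1 e2; rewrite /cf (eq_sym i) (eq_sym i e.2) (negPf e1) (negPf e2).
    by rewrite subrr !mul0r.
  apply: eq_bigr => l li; congr (_ * _); rewrite /cf /srt.
  by case: ifP => _ /=; rewrite eqxx (eq_sym i l) (negPf li) /= mulr0n mulr1n; ring.
rewrite !mxE edge_block_srt -/(X _) summxE eq_sym.
have [->|ji] := eqVneq j i.
  rewrite subrr mul0r subr0 mul1r; apply: eq_bigr => l li.
  by rewrite edge_block_srt -/(X _) srtC eq_sym (negPf li) subr0 mul1r.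
rewrite mul0r sub0r subr0 mul1r [RHS](bigD1 j) //= [X in _ = _ + X]big1 => [|l /andP[li lj]].
  by rewrite eqxx sub0r mulN1r addr0.
by rewrite (eq_sym j l) (negPf lj) subr0 mul0r.
Qed.

(** On the right [xi] scales the vector and so enters each dyad squared; for values 0 and 1 the
    square is [xi] itself. *)
Lemma laplacian_mx_lap (xi : 'I_r -> 'I_r -> R) (v : 'I_r -> 'I_r -> 'cV[R]_d) :
  (forall e, (e.1 < e.2)%N -> xi e.1 e.2 = 0 \/ xi e.1 e.2 = 1) ->
  laplacian_mx xi v = lap bE (fun e => xi e.1 e.2 *: v e.1 e.2).
Proof.
move=> xi01; rewrite laplacian_mxE; apply: eq_bigr => e e12.
rewrite /edge_dyad /edge_vec -scalemxAr linearZ /= -scalemxAl -scalemxAr scalerA.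
by case: (xi01 e e12) => ->; rewrite ?mulr0 ?mul1r // !scale0r.
Qed.

Lemma trmx_laplacian (xi : 'I_r -> 'I_r -> R) (v : 'I_r -> 'I_r -> 'cV[R]_d) :
  (laplacian_mx xi v)^T = laplacian_mx xi v.
Proof.
rewrite laplacian_mxE linear_sum; apply: eq_bigr => e _ /=.
by rewrite linearZ /= /edge_dyad trmx_mul trmxK.
Qed.

Lemma mfmx_laplacian dd (S : measurableType dd) (xi : 'I_r -> 'I_r -> S -> R)
    (v : 'I_r -> 'I_r -> S -> 'cV[R]_d) :
  (forall k l, (k < l)%N -> measurable_fun setT (xi k l)) ->
  (forall k l, (k < l)%N -> mfmx (v k l)) ->
  mfmx (fun w => laplacian_mx (fun k l => xi k l w) (fun k l => v k l w)).
Proof.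
move=> mxi mv.
apply: eq_mfmx (_ : mfmx (fun w => \sum_(e : 'I_r * 'I_r | (e.1 < e.2)%N)
    xi e.1 e.2 w *: edge_dyad bE (fun e => v e.1 e.2 w) e)) => [w|].
  by rewrite laplacian_mxE.
apply: mfmx_sum => e e12; apply: mfmxZ; first exact: mxi.
have m : mfmx (fun w => edge_vec bE (fun e => v e.1 e.2 w) e).
  by apply: mfmxM; [exact: mfmx_cst|exact: mv].
by apply: mfmxM => //; exact: mfmx_tr.
Qed.

End block_embedding.

(** * The truncated Laplacian *)

Lemma measurable_fun_generated dd (T : measurableType dd) (R : realType)
    (G : set (set T)) (f : T -> R) :
  (forall B, measurable B -> <<s G >> (f @^-1` B)) ->
  measurable_fun setT (f : g_sigma_algebraType G -> R).
Proof. by move=> H _ B mB; rewrite setTI; exact: H. Qed.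

Section truncated_laplacian.
Context dd (T : measurableType dd) (R : realType) (P : probability T R).
Variables (r d : nat) (xi : 'I_r -> 'I_r -> T -> R) (v : 'I_r -> 'I_r -> T -> 'cV[R]_d)
  (p C0 : R).
Hypothesis xi_measurable : forall k l : 'I_r, (k < l)%N -> measurable_fun setT (xi k l).
Hypothesis v_measurable : forall (k l : 'I_r) (i : 'I_d), (k < l)%N ->
  measurable_fun setT (fun w => v k l w i 0).
Hypothesis C0_ge0 : 0 <= C0.
Implicit Types e f : 'I_r * 'I_r.
Notation BE := (@bE R r d).

(* Almost surely the truncated Laplacian coincides with the original one; the
   truncation makes all bounds hold at every sample point. *)
Definition xi1 e (w : T) : R := (xi e.1 e.2 w == 1)%:R.
Definition vtrunc e (w : T) : 'cV[R]_d := trunc C0 (v e.1 e.2 w).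
Definition lap_trunc w : 'M[R]_(\sum_(k < r) d) := lap BE (fun e => xi1 e w *: vtrunc e w).

Lemma xi1_01 e w : xi1 e w = 0 \/ xi1 e w = 1.
Proof. by rewrite /xi1; case: eqP; [right|left]. Qed.

Lemma psdmx_lap_trunc w : psdmx (lap_trunc w).
Proof. exact: psdmx_lap. Qed.

Let xi_pre e (B : set R) : measurable B -> <<s xi_gen xi e >> (xi e.1 e.2 @^-1` B).
Proof.
move=> mB; apply: sub_sigma_algebra; exists tt => //; exists B => //.
by rewrite setTI.
Qed.

Let v_pre e i (B : set R) : measurable B ->
  <<s v_gen v e >> ((fun w => v e.1 e.2 w i 0) @^-1` B).
Proof.
move=> mB; apply: sub_sigma_algebra; exists i => //; exists B => //.
by rewrite setTI.
Qed.

Let gT (G : set (set T)) : <<s G >> setT.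
Proof. exact: (@measurableT _ (g_sigma_algebraType G)). Qed.

Let rest_here e f (A B : set T) : (f.1 < f.2)%N -> f != e ->
  <<s xi_gen xi f >> A -> <<s v_gen v f >> B -> rest_gen xi v e (A `&` B).
Proof.
move=> f12 fe mA mB.
exists (fun g => if g == f then A else setT), (fun g => if g == f then B else setT).
split=> [g|g|]; try by case: eqP => [->|_].
apply/seteqP; split=> [w [Aw Bw] g _ /=|w H]; first by case: eqP.
by have := H f; rewrite /= inE f12 fe eqxx; apply.
Qed.

Lemma measurable_xi_rest e f : (f.1 < f.2)%N -> f != e ->
  measurable_fun setT ((xi f.1 f.2 : T -> R) : g_sigma_algebraType (rest_gen xi v e) -> R).
Proof.
move=> f12 fe; apply: measurable_fun_generated => B mB; apply: sub_sigma_algebra.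
by have := rest_here f12 fe (@xi_pre f _ mB) (@gT _); rewrite setIT.
Qed.

Lemma measurable_v_rest e f i : (f.1 < f.2)%N -> f != e ->
  measurable_fun setT ((fun w => v f.1 f.2 w i 0) : g_sigma_algebraType (rest_gen xi v e) -> R).
Proof.
move=> f12 fe; apply: measurable_fun_generated => B mB; apply: sub_sigma_algebra.
by have := rest_here f12 fe (@gT _) (@v_pre f i _ mB); rewrite setTI.
Qed.

Lemma measurable_eq1 dd' (S : measurableType dd') (f : S -> R) :
  measurable_fun setT f -> measurable_fun setT (fun w => (f w == 1)%:R : R).
Proof.
move=> mf; apply: (@eq_mf _ _ _ (\1_(f @^-1` [set 1]))) => [w|].
  rewrite indicE; case: eqP => h; first by rewrite mem_set.
  by rewrite memNset.
by apply: measurable_indic; have := mf measurableT [set 1] (measurable_set1 _); rewrite setTI.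
Qed.

Lemma mfmx_scaled_rest e f : (e.1 < e.2)%N -> (f.1 < f.2)%N -> f != e ->
  mfmx ((fun w => xi1 f w *: vtrunc f w) : g_sigma_algebraType (rest_gen xi v e) -> 'cV[R]_d).
Proof.
move=> _ f12 fe; apply: mfmxZ.
  exact: (measurable_eq1 (measurable_xi_rest f12 fe)).
apply: (@mfmx_trunc _ _ _ _ (g_sigma_algebraType (rest_gen xi v e))) => i j; rewrite ord1.
exact: measurable_v_rest.
Qed.

Lemma mfmx_vtrunc_gen e : (e.1 < e.2)%N ->
  mfmx (vtrunc e : g_sigma_algebraType (v_gen v e) -> 'cV[R]_d).
Proof.
move=> e12; apply: (@mfmx_trunc _ _ _ _ (g_sigma_algebraType (v_gen v e))) => i j; rewrite ord1.
by apply: measurable_fun_generated => B mB; exact: v_pre.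
Qed.

Lemma measurable_xi1 e : (e.1 < e.2)%N -> measurable_fun setT (xi1 e).
Proof. by move=> e12; apply: measurable_eq1; exact: xi_measurable. Qed.

Lemma mfmx_lap_trunc : mfmx lap_trunc.
Proof.
apply: mfmx_sum => e e12; apply: mfmx_edge_dyad; apply: mfmxZ; first exact: measurable_xi1.
by apply: mfmx_trunc => i j; rewrite ord1; exact: v_measurable.
Qed.

Section core_estimate.
Hypothesis xi_law : forall k l : 'I_r, (k < l)%N -> P [set w | xi k l w = 1] = p%:E.
Hypothesis xi_independent : mutually_independent P (@edge r)
     (fun kl => sigma_gen setT (fun _ : unit => xi kl.1 kl.2)).
Hypothesis v_independent : mutually_independent P (@edge r)
     (fun kl => sigma_gen setT (fun (i : 'I_d) w => v kl.1 kl.2 w i 0)).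
Hypothesis xi_v_independent : independent2 P
     (sigma_gen [set kl : 'I_r * 'I_r | (kl.1 < kl.2)%N] (fun kl => xi kl.1 kl.2))
     (sigma_gen [set q : ('I_r * 'I_r) * 'I_d | (q.1.1 < q.1.2)%N]
        (fun q w => v q.1.1 q.1.2 w q.2 0)).
Hypotheses (d0 : (0 < d)%N) (r0 : (0 < r)%N).
Variables (x c th k0 : R).
Hypotheses (x0 : 0 < x) (c0 : 0 <= c) (th0 : 0 < th) (p0 : 0 <= p) (p1 : p <= 1).
Hypothesis var : forall (k l : 'I_r) (D : 'M[R]_d) (K : R), (k < l)%N -> 0 <= K ->
  (forall u, norm2 (D *m u) <= K * norm2 u) ->
  Ex P (fun w => (dotv (trunc C0 (v k l w)) (D *m trunc C0 (v k l w))
    - \tr D / d%:R) ^+ 2) <= K ^+ 2 * th ^+ 2.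
Hypotheses (k0E : p * r%:R / d%:R <= k0) (d_th : d%:R^-1 <= th) (r_th : r%:R^-1 <= th ^+ 2).

Let G w := resolvent x (lap_trunc w).
Let rR0 : 0 < r%:R :> R. Proof. by rewrite ltr0n. Qed.
Let dR0 : 0 < d%:R :> R. Proof. by rewrite ltr0n. Qed.

Lemma Ex_resolvent_near :
  Ex P (fun w => `|(\sum_k btr BE (G w) k k) / r%:R - tstar x c|) <=
  (`|p * r%:R / d%:R - c| + (1 + 4 * k0 / x) * Num.sqrt (th * residual_rate x k0 C0)) / x.
Proof.
have zC e w : dotv (vtrunc e w) (vtrunc e w) <= C0 by exact: dotv_trunc.
have GV_m e : (e.1 < e.2)%N -> v_gen v e `<=` measurable.
  by move=> e12; exact: v_gen_measurable.
have GR_m e : (e.1 < e.2)%N -> rest_gen xi v e `<=` measurable.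
  by move=> e12; exact: rest_gen_measurable.
have bb k : bmf (fun w => btr BE (G w) k k).
  by apply: (bmf_btr_lap (@bE_orth R r d) (@bE_full R r d) d0 x0 C0_ge0 GV_m measurable_xi1 mfmx_vtrunc_gen zC k k).
have bR k : bmf (fun w => residual BE x p (G w) k).
  exact: (bmf_residual (@bE_orth R r d) (@bE_full R r d) d0 x0 p0 psdmx_lap_trunc mfmx_lap_trunc).
have := Ex_average_residual (@bE_orth R r d) (@bE_full R r d) d0 r0 x0 p0 C0_ge0 th0 GR_m GV_m xi1_01
  measurable_xi1
  (fun e U phi => @edge_decoupling _ _ _ _ _ _ _ _ _ xi_measurable v_measurable xi_law
     xi_independent v_independent xi_v_independent e U phi)
  mfmx_scaled_rest mfmx_vtrunc_gen zC
  (fun e D K h => @var e.1 e.2 D K h) p1 k0E d_th r_th.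
set A : T -> R := fun w => _; move=> A2.
have bA : bmf A.
  apply: bmfM; last exact: bmf_cst.
  by apply: bmf_sum => k _; apply: bmf_norm; exact: bR.
have A0 : 0 <= Ex P A.
  by apply: Ex_ge0 => w; rewrite divr_ge0 ?ler0n //; apply: sumr_ge0.
have rate0 : 0 <= th * residual_rate x k0 C0 := le_trans (sqr_ge0 _) A2.
have As : Ex P A <= Num.sqrt (th * residual_rate x k0 C0).
  by rewrite -(ger0_norm A0) -sqrtr_sqr ler_sqrt.
have k00 : 0 <= k0 by apply: le_trans k0E; rewrite divr_ge0 ?mulr_ge0 ?ler0n.
have b0 : 0 <= p / d%:R by rewrite divr_ge0 // ltW.
have prE : p / d%:R * r%:R = p * r%:R / d%:R by rewrite mulrAC.
have fac0 : 0 <= 1 + 4 * k0 / x by rewrite addr_ge0 // divr_ge0 ?mulr_ge0 // ltW.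
apply: (@le_trans _ _ (Ex P (fun w => `|p * r%:R / d%:R - c| / x + (1 + 4 * k0 / x) / x * A w))).
  apply: le_Ex => [||w].
  - apply: bmf_norm; apply: bmfB; last exact: bmf_cst.
    by apply: bmfM; [exact: bmf_sum|exact: bmf_cst].
  - by apply: bmfD; [exact: bmf_cst|apply: bmfM => //; exact: bmf_cst].
  have g0 k : 0 <= btr BE (G w) k k by apply: btr_ge0 => //; exact: psdmx_lap_trunc.
  have Aw0 : 0 <= A w by rewrite divr_ge0 ?ler0n //; apply: sumr_ge0.
  have := mean_stability x0 b0 c0 r0 g0; rewrite prE => /le_trans; apply.
  rewrite (mulrAC (1 + 4 * k0 / x)) -(mulrDl `|_ - c|) ler_pM2r ?invr_gt0 // lerD2l.
  have -> : (\sum_(k < r) `|x * btr BE (G w) k k + p / d%:R *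
      (\sum_l rfrac (btr BE (G w) k k) (btr BE (G w) l l)) - 1|) / r%:R = A w by [].
  by rewrite ler_wpM2r // lerD2l ler_pM2r ?invr_gt0 // ler_pM2l.
rewrite ExD; [|exact: bmf_cst|by apply: bmfM => //; exact: bmf_cst].
rewrite Ex_cst ExZ // (mulrDl `|_ - c|) lerD2l (mulrAC (1 + 4 * k0 / x)) ler_pM2r ?invr_gt0 //.
exact: ler_wpM2l.
Qed.

Lemma Ex_smean_near :
  Ex P (fun w => `|(\sum_(z <- eigenvalues (lap_trunc w)) sker x z) / (\sum_(k < r) d)%:R
    - tstar x c|) <=
  (`|p * r%:R / d%:R - c| + (1 + 4 * k0 / x) * Num.sqrt (th * residual_rate x k0 C0)) / x.
Proof.
apply: le_trans Ex_resolvent_near; apply: le_of_eq.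
congr Ex; apply/funext => w; congr (`|_ - _|).
have -> : \sum_(z <- eigenvalues (lap_trunc w)) sker x z = \tr (G w).
  rewrite /G -(sum_eigenvalues_resolvent (psdmx_lap_trunc w) x0).
  rewrite big_seq [RHS]big_seq; apply: eq_bigr => z /(eigenvalues_ge0 (psdmx_lap_trunc w)) z0.
  by rewrite /sker max_l.
rewrite (sum_btr (@bE_full R r d)); move: (\tr _) => t.
by rewrite sum_const_block natrM; field; rewrite !gt_eqF.
Qed.

End core_estimate.

End truncated_laplacian.

(** * Empirical spectral distributions *)

Lemma ge0_integral_esd (R : realType) n (M : 'M[R]_n) (f : R -> R) :
  size (eigenvalues M) = n -> measurable_fun setT f -> (forall x, 0 <= f x) ->
  (\int[esd M]_x (f x)%:E = ((\sum_(z <- eigenvalues M) f z) / n%:R)%:E)%E.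
Proof.
move=> sM mf f0.
have mf' : measurable_fun (setT : set (measurableTypeR R)) (EFin \o f) by exact/measurable_EFinP.
rewrite /esd (@ge0_integral_mscale _ (measurableTypeR R)) //; last first.
  by move=> x _; rewrite lee_fin.
rewrite (@ge0_integral_measure_sum _ (measurableTypeR R)) //; last first.
  by move=> x _; rewrite lee_fin.
rewrite (big_nth 0) big_mkord sM mulrC EFinM -sumEFin; congr (_ * _)%E.
apply: eq_bigr => i _.
by rewrite (@integral_dirac _ (measurableTypeR R)) // diracT mul1e.
Qed.

Lemma Rintegral_esd (R : realType) n (M : 'M[R]_n) (f : R -> R) :
  size (eigenvalues M) = n -> measurable_fun setT f ->
  \int[esd M]_x f x = (\sum_(z <- eigenvalues M) f z) / n%:R.
Proof.
move=> sM mf; rewrite /Rintegral.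
suff -> : (\int[esd M]_x (f x)%:E = ((\sum_(z <- eigenvalues M) f z) / n%:R)%:E)%E by [].
rewrite integralE.
have mp : measurable_fun setT (fun x => Num.max (f x) 0) by apply: measurable_maxr.
have mm : measurable_fun setT (fun x => Num.max (- f x) 0).
  by apply: measurable_maxr => //; exact: measurable_funN.
have -> : ((fun x => (f x)%:E)^\+ = fun x => (Num.max (f x) 0)%:E)%E.
  by apply/funext => x; rewrite funeposE -EFin_max.
have -> : ((fun x => (f x)%:E)^\- = fun x => (Num.max (- f x) 0)%:E)%E.
  by apply/funext => x; rewrite funenegE -EFinN -EFin_max.
rewrite !ge0_integral_esd //; try by move=> x; rewrite le_max lexx orbT.
rewrite -EFinB -mulrBl -sumrB; congr ((_ / _)%:E); apply: eq_bigr => z _.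
by case: (leP (f z) 0) => h; rewrite /Order.max; case: ltP; case: ltP; lra.
Qed.

Section limit_law_support.
Context (R : realType) (c : R).
Hypothesis c0 : 0 <= c.
Variable N : probability (measurableTypeR R) R.
Hypothesis NE : forall A : set (measurableTypeR R),
  N A = ((Num.max (1 - c / 2) 0)%R%:E * \d_(0%R : measurableTypeR R) A
               + \int[lebesgue_measure]_(x in A) (rho c x)%:E)%E.

Lemma rho_gt_cplus x : cplus c < x -> rho c x = 0.
Proof.
move=> cx; have h : cminus c <= cplus c.
  rewrite /cminus /cplus; have := sqrtr_ge0 (2 : R); have := sqrtr_ge0 c.
  by move: (Num.sqrt _) (Num.sqrt _) => a b *; nra.
rewrite /rho max_r ?sqrtr0 ?mulr0 //.
have -> : (cplus c - x) * (x - cminus c) = - ((x - cplus c) * (x - cminus c)) by ring.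
by rewrite oppr_le0 mulr_ge0 // subr_ge0 ltW // (le_lt_trans h).
Qed.

Lemma cplus_ge0 : 0 <= cplus c. Proof. exact: sqr_ge0. Qed.

(** The complement of [[0, cplus c]] is a null set of [N]: the atom sits at 0 and the density
    vanishes on both sides. *)
Lemma limit_law_supp (f g : R -> R) : bcont f -> bcont g ->
  (forall x, 0 <= x <= cplus c -> f x = g x) -> Ex N f = Ex N g.
Proof.
move=> bf bg fg; have bf' := bcont_bmf bf; have bg' := bcont_bmf bg.
suff : (Ex N f)%:E = (Ex N g)%:E by case.
rewrite !ExE //; apply: ae_eq_integral => //.
- by apply/measurable_EFinP; case: bf'.
- by apply/measurable_EFinP; case: bg'.
have mA : measurable (`[0, cplus c]%classic : set R) by exact: measurable_itv.
exists (~` `[0, cplus c]%classic); split.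
- exact: measurableC.
- apply: (etrans (NE _)).
  rewrite diracE memNset /=; last by rewrite in_itv /= lexx cplus_ge0; apply.
  rewrite mule0 add0e; apply: integral0_eq => x /= /negP.
  rewrite in_itv /= negb_and -!ltNge => /orP[x0|xc].
    by rewrite rho_lt0.
  by rewrite rho_gt_cplus.
- move=> x /= H; apply: contra_not H => xin _.
  by rewrite fg //; move: xin; rewrite in_itv.
Qed.

End limit_law_support.

(** * Almost sure equality of the Laplacian and its truncation *)

Section almost_sure_truncation.
Context dd (T : measurableType dd) (R : realType) (P : probability T R).
Variables (r d : nat) (xi : 'I_r -> 'I_r -> T -> R) (v : 'I_r -> 'I_r -> T -> 'cV[R]_d)
  (p C0 : R).
Hypothesis xi_measurable : forall k l : 'I_r, (k < l)%N -> measurable_fun setT (xi k l).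
Hypothesis xi_law : forall k l : 'I_r, (k < l)%N ->
     P [set w | xi k l w = 1] = p%:E /\ P [set w | xi k l w = 0] = (1 - p)%:E.
Hypothesis v_bounded : forall k l : 'I_r, (k < l)%N ->
  {ae P, forall w, norm2 (v k l w) ^+ 2 <= C0}.

Lemma xi_ae (k l : 'I_r) : (k < l)%N -> {ae P, forall w, xi k l w = 0 \/ xi k l w = 1}.
Proof.
move=> kl; have [P1 P0] := xi_law kl.
have m a : measurable [set w | xi k l w = a].
  by have := xi_measurable kl measurableT (measurable_set1 a); rewrite setTI.
have mU : measurable ([set w | xi k l w = 0] `|` [set w | xi k l w = 1]) by exact: measurableU.
exists (~` ([set w | xi k l w = 0] `|` [set w | xi k l w = 1])); split.
- exact: measurableC.
- have PU : P ([set w | xi k l w = 0] `|` [set w | xi k l w = 1]) = 1%E.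
    transitivity (P [set w | xi k l w = 0%R] + P [set w | xi k l w = 1%R])%E.
      apply: measureU => //; apply/seteqP; split => // w [/= -> /eqP].
      by rewrite eq_sym oner_eq0.
    by rewrite P0 P1 -EFinD subrK.
  transitivity (1 - P ([set w | xi k l w = 0%R] `|` [set w | xi k l w = 1%R]))%E.
    exact: probability_setC.
  by rewrite PU subee.
- by move=> w /= H; exact: H.
Qed.

Lemma laplacian_ae : {ae P, forall w,
  laplacian_mx (fun k l => xi k l w) (fun k l => v k l w) = lap_trunc xi v C0 w}.
Proof.
have H : {ae P, forall w, forall e : 'I_r * 'I_r, (e.1 < e.2)%N ->
    (xi e.1 e.2 w = 0 \/ xi e.1 e.2 w = 1) /\ trunc C0 (v e.1 e.2 w) = v e.1 e.2 w}.
  apply: filter_forall => e; have [e12|e12] := ltnP e.1 e.2; last first.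
    by apply: filterE => w.
  by apply: filterS2 (xi_ae e12) (trunc_ae (v_bounded e12)) => w h1 h2 _.
apply: filterS H => w H.
rewrite laplacian_mx_lap => [|e e12]; last by have [] := H e e12.
apply: eq_bigr => e e12; have [h1 h2] := H e e12.
rewrite /edge_dyad /edge_vec /vtrunc h2 /xi1.
by case: h1 => ->; rewrite ?eqxx // eq_sym oner_eq0.
Qed.

End almost_sure_truncation.

(** * Convergence *)

Section convergence.
Context (R : realType) (disp : nat -> measure_display) (T : forall r, measurableType (disp r))
  (P : forall r, probability (T r) R) (d : nat -> nat) (p : nat -> R) (c C0 : R)
  (xi : forall r, 'I_r -> 'I_r -> T r -> R)
  (v : forall r, 'I_r -> 'I_r -> T r -> 'cV[R]_(d r)).
Hypothesis d_gt0 : forall r, (0 < d r)%N.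
Hypothesis p_range : forall r, 0 < p r <= 1.
Hypothesis xi_measurable : forall r (k l : 'I_r), (k < l)%N ->
     measurable_fun setT (xi k l).
Hypothesis xi_law : forall r (k l : 'I_r), (k < l)%N ->
     P r [set w | xi k l w = 1] = (p r)%:E /\
     P r [set w | xi k l w = 0] = (1 - p r)%:E.
Hypothesis xi_independent : forall r, mutually_independent (P r) (@edge r)
     (fun kl => sigma_gen setT (fun _ : unit => xi kl.1 kl.2)).
Hypothesis v_measurable : forall r (k l : 'I_r) (i : 'I_(d r)), (k < l)%N ->
     measurable_fun setT (fun w => v k l w i 0).
Hypothesis v_independent : forall r, mutually_independent (P r) (@edge r)
     (fun kl => sigma_gen setT (fun (i : 'I_(d r)) w => v kl.1 kl.2 w i 0)).
Hypothesis xi_v_independent : forall r, independent2 (P r)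
     (sigma_gen [set kl : 'I_r * 'I_r | (kl.1 < kl.2)%N]
        (fun kl => xi kl.1 kl.2))
     (sigma_gen [set q : ('I_r * 'I_r) * 'I_(d r) | (q.1.1 < q.1.2)%N]
        (fun q w => v q.1.1 q.1.2 w q.2 0)).
Hypothesis v_isotropic : forall r (k l : 'I_r), (k < l)%N -> forall i j : 'I_(d r),
     'E_(P r)[fun w => (v k l w *m (v k l w)^T) i j]%E
       = (((d r)%:R^-1)%:M i j : R)%:E.
Hypothesis C0_ge0 : 0 <= C0.
Hypothesis v_bounded : forall r (k l : 'I_r), (k < l)%N ->
       {ae P r, forall w, norm2 (v k l w) ^+ 2 <= C0}.
Hypothesis v_variance : forall D : forall n, 'M[R]_n,
     (forall n, (0 < n)%N -> opnorm (D n) = 1) ->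
     ereal_sup [set 'V_(P r)[fun w =>
                       dotv (D (d r) *m v kl.1 kl.2 w) (v kl.1 kl.2 w)]%E
               | kl in [set kl : 'I_r * 'I_r | (kl.1 < kl.2)%N]]
       @[r --> \oo] --> 0%E.
Hypothesis d_infty : d r @[r --> \oo] --> \oo.
Hypothesis c_ge0 : 0 <= c.
Hypothesis rpd_cvg : r%:R * p r / (d r)%:R @[r --> \oo] --> c.
Variable N : probability (measurableTypeR R) R.
Hypothesis NE : forall A : set (measurableTypeR R),
  N A = ((Num.max (1 - c / 2) 0)%R%:E * \d_(0%R : measurableTypeR R) A
               + \int[lebesgue_measure]_(x in A) (rho c x)%:E)%E.
Hypothesis N_stieltjes : forall z, 0 < z -> \int[N]_x (Num.max x 0 + z)^-1 = tstar z c.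

Let n r := (\sum_(k < r) d r)%N.
Let L r (w : T r) : seq R := eigenvalues (lap_trunc (@xi r) (@v r) C0 w).

Lemma residual_rate_small (x k0 y : R) : 0 < y ->
  exists2 th, 0 < th & Num.sqrt (th * residual_rate x k0 C0) <= y.
Proof.
move=> y0; have h0 : 0 < `|residual_rate x k0 C0| + 1 by rewrite ltr_wpDl.
exists (y ^+ 2 / (`|residual_rate x k0 C0| + 1)); first by rewrite divr_gt0 // exprn_gt0.
rewrite -[leRHS](ger0_norm (ltW y0)) -(sqrtr_sqr y) ler_wsqrtr //.
rewrite mulrAC ler_pdivrMr // ler_wpM2l ?sqr_ge0 //.
by rewrite (le_trans (ler_norm _)) // lerDl.
Qed.

Lemma trunc_stieltjes_cvg x : 0 < x -> l1cvg P N L n (sker x).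
Proof.
move=> x0 e e0.
have B0 : 0 < 1 + 4 * (c + 1) / x.
  by rewrite ltr_pwDl // divr_ge0 ?(ltW x0) // mulr_ge0 // addr_ge0.
(* Half of [e * x] is reserved for [p r / d - c], the other half for the residuals. Here [c + 1]
   plays the part of [k0], which is legitimate once [p r / d] is within 1 of [c]. *)
have y0 : 0 < e * x / 2 / (1 + 4 * (c + 1) / x) by rewrite !divr_gt0 // mulr_gt0.
have [th th0 Hth] := residual_rate_small x (c + 1) y0.
have ex0 : 0 < e * x / 2 by rewrite divr_gt0 // mulr_gt0.
have V := uniform_variance_trunc v_variance d_infty C0_ge0 v_measurable v_isotropic v_bounded
  (exprn_gt0 2 th0).
have K1 : \forall r \near \oo, `|c - r%:R * p r / (d r)%:R| <= 1.
  exact: ((cvgrPdist_le _ _).1 rpd_cvg).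
have K2 : \forall r \near \oo, `|c - r%:R * p r / (d r)%:R| <= e * x / 2.
  exact: ((cvgrPdist_le _ _).1 rpd_cvg).
have D1 : \forall r \near \oo, th^-1 <= (d r)%:R :> R.
  exact: (d_infty (nbhs_infty_ger (th^-1))).
have D2 : \forall r \near \oo, (th ^+ 2)^-1 <= r%:R :> R by exact: nbhs_infty_ger.
near=> r.
have r0 : (0 < r)%N by near: r; exact: nbhs_infty_gt.
have dR0 : 0 < (d r)%:R :> R by rewrite ltr0n.
have rR0 : 0 < r%:R :> R by rewrite ltr0n.
have var : forall (k l : 'I_r) (D : 'M[R]_(d r)) (K : R), (k < l)%N -> 0 <= K ->
  (forall u, norm2 (D *m u) <= K * norm2 u) ->
  Ex (P r) (fun w => (dotv (trunc C0 (v k l w)) (D *m trunc C0 (v k l w))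
    - \tr D / (d r)%:R) ^+ 2) <= K ^+ 2 * th ^+ 2 by near: r.
have k1 : `|c - r%:R * p r / (d r)%:R| <= 1 by near: r.
have k2 : `|c - r%:R * p r / (d r)%:R| <= e * x / 2 by near: r.
have d_th : (d r)%:R^-1 <= th.
  by rewrite -[th]invrK lef_pV2 ?posrE ?invr_gt0 //; near: r.
have r_th : r%:R^-1 <= th ^+ 2.
  by rewrite -[th ^+ 2]invrK lef_pV2 ?posrE ?invr_gt0 ?exprn_gt0 //; near: r.
have /andP[p0 p1] := p_range r.
have k0E : p r * r%:R / (d r)%:R <= c + 1.
  by rewrite (mulrC (p r)); move: k1; rewrite ler_norml => /andP[]; move: (_ / _) => ? *; lra.
have := Ex_smean_near (@xi_measurable r) (@v_measurable r) C0_ge0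
  (fun k l kl => (xi_law kl).1) (@xi_independent r) (@v_independent r) (@xi_v_independent r)
  (d_gt0 r) r0 x0 c_ge0 th0 (ltW p0) p1 var k0E d_th r_th.
have -> : l1dev P N L n r (sker x) = Ex (P r) (fun w =>
    `|(\sum_(z <- eigenvalues (lap_trunc (@xi r) (@v r) C0 w)) sker x z) / (\sum_(k < r) d r)%:R
    - tstar x c|).
  by rewrite /l1dev; congr Ex; apply/funext => w; rewrite /dev -(N_stieltjes x0).
move=> /le_trans; apply; rewrite ler_pdivrMr // (mulrC (p r)) distrC.
rewrite (le_trans (lerD k2 (ler_wpM2l (ltW B0) Hth))) //.
move: (1 + _) B0 => B B0; have -> : B * (e * x / 2 / B) = e * x / 2 by field; rewrite gt_eqF.
by lra.
Unshelve. all: by end_near. Qed.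

Lemma size_trunc_eigenvalues r (w : T r) : size (L w) = n r.
Proof. by apply: size_eigenvalues; have [] := psdmx_lap_trunc (@xi r) (@v r) C0 w. Qed.

Lemma measurable_trunc_eigenvalues r (f : R -> R) : bcont f ->
  measurable_fun setT (fun w : T r => \sum_(z <- L w) f z).
Proof.
move=> [cf _]; apply: measurable_sum_eigenvalues => // [w|].
  by have [] := psdmx_lap_trunc (@xi r) (@v r) C0 w.
by apply: mfmx_lap_trunc; [exact: xi_measurable|exact: v_measurable].
Qed.

Lemma trunc_eigenvalues_ge0 r (w : T r) z : z \in L w -> 0 <= z.
Proof. exact/eigenvalues_ge0/psdmx_lap_trunc. Qed.

Lemma trunc_l1cvg f : bcont f -> l1cvg P N L n f.
Proof.
apply: (@stieltjes_l1cvg _ _ _ _ _ (cplus c)).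
- exact: size_trunc_eigenvalues.
- by move=> r r0; rewrite /n sum_const_block muln_gt0 r0 d_gt0.
- exact: trunc_eigenvalues_ge0.
- exact: measurable_trunc_eigenvalues.
- exact: cplus_ge0.
- by move=> ? ? ? ?; apply: (limit_law_supp c_ge0 NE).
- exact: trunc_stieltjes_cvg.
Qed.

Notation lapl r w := (laplacian_mx (fun k l : 'I_r => xi k l w) (fun k l => v k l w)).

(** The truncated matrix differs from the true one on a null set only, so the expectations coincide;
    measurability is shown for the true one because Markov's inequality is applied to it. *)
Lemma Ex_esd_dev r f : bcont f ->
  bmf (fun w : T r => `|\int[esd (lapl r w)]_x f x - \int[N]_x f x|) /\
  Ex (P r) (fun w => `|\int[esd (lapl r w)]_x f x - \int[N]_x f x|) = l1dev P N L n r f.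
Proof.
move=> bf; have [cf [C fC]] := bf.
have mf : measurable_fun setT f by exact: continuous_measurable_fun.
have sz w : size (eigenvalues (lapl r w)) = n r by apply: size_eigenvalues; exact: trmx_laplacian.
have esdE w : \int[esd (lapl r w)]_x f x =
    (\sum_(z <- eigenvalues (lapl r w)) f z) / (n r)%:R by exact: Rintegral_esd.
have b1 : bmf (fun w : T r => `|\int[esd (lapl r w)]_x f x - \int[N]_x f x|).
  apply: bmf_norm; apply: bmfB; last exact: bmf_cst.
  split.
    apply: (@eq_mf _ _ _ (fun w => (\sum_(z <- eigenvalues (lapl r w)) f z) / (n r)%:R)) => [w|//].
      by rewrite esdE.
    apply: measurable_funM => //; apply: measurable_sum_eigenvalues => // [w|].
      exact: trmx_laplacian.
    by apply: mfmx_laplacian => k l kl; [exact: xi_measurable|move=> i j; rewrite ord1; exact: v_measurable].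
  exists `|C| => w; rewrite esdE normrM normfV normr_nat.
  have [->|n0] := posnP (n r); first by rewrite invr0 mulr0.
  rewrite ler_pdivrMr ?ltr0n // (le_trans (ler_norm_sum _ _ _)) //.
  rewrite mulr_natr -(sz w).
  apply: (@le_trans _ _ (\sum_(z <- eigenvalues (lapl r w)) `|C|)).
    by apply: ler_sum => z _; rewrite (le_trans (fC z)) // ler_norm.
  by rewrite big_const_seq count_predT iter_addr addr0.
split=> //.
have b2 := bmf_norm (bmf_dev N size_trunc_eigenvalues trunc_eigenvalues_ge0 measurable_trunc_eigenvalues r bf).
rewrite /l1dev; suff : (Ex (P r) (fun w => `|\int[esd (lapl r w)]_x f x - \int[N]_x f x|))%:E =
   (Ex (P r) (fun w => `|dev N L n f w|))%:E by case.
rewrite !ExE //; apply: ae_eq_integral => //.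
- by apply/measurable_EFinP; case: b1.
- by apply/measurable_EFinP; case: b2.
apply: filterS (laplacian_ae (@xi_measurable r) (@xi_law r) (@v_bounded r)) => w lE _.
by rewrite esdE lE.
Qed.

Lemma esd_cvg_in_probability : cvg_in_probability_weakly P (fun r w => esd (lapl r w)) N.
Proof.
move=> f cf bf e e0; have bcf : bcont f by split.
have H := trunc_l1cvg bcf.
have l0 : l1dev P N L n r f @[r --> \oo] --> (0 : R).
  apply/cvgrPdist_le => a a0; apply: filterS (H a a0) => r.
  by rewrite sub0r normrN ger0_norm //; apply: Ex_ge0.
have le0 : (l1dev P N L n r f / e)%:E @[r --> \oo] --> (0 : \bar R)%E.
  have : l1dev P N L n r f / e @[r --> \oo] --> 0 / e by apply: cvgMl.
  by rewrite mul0r => h; apply: cvg_EFin => //; exact: nearW.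
apply: (@squeeze_cvge _ _ _ _ (fun=> 0%E) _ _ _ _ _ le0); last exact: cvg_cst.
apply: nearW => r; rewrite measure_ge0 /=.
have [b1 <-] := Ex_esd_dev r bcf.
exact: markov_Ex.
Qed.

End convergence.

Theorem theorem1p4 (R : realType)
  (disp : nat -> measure_display) (T : forall r, measurableType (disp r))
  (P : forall r, probability (T r) R)
  (d : nat -> nat) (p : nat -> R) (c : R)
  (xi : forall r, 'I_r -> 'I_r -> T r -> R)
  (v : forall r, 'I_r -> 'I_r -> T r -> 'cV[R]_(d r))
  (d_gt0 : forall r, (0 < d r)%N)
  (p_range : forall r, 0 < p r <= 1)
  (xi_measurable : forall r (k l : 'I_r), (k < l)%N ->
     measurable_fun setT (xi r k l))
  (xi_law : forall r (k l : 'I_r), (k < l)%N ->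
     P r [set w | xi r k l w = 1] = (p r)%:E /\
     P r [set w | xi r k l w = 0] = (1 - p r)%:E)
  (xi_independent : forall r, mutually_independent (P r) (@edge r)
     (fun kl => sigma_gen setT (fun _ : unit => xi r kl.1 kl.2)))
  (v_measurable : forall r (k l : 'I_r) (i : 'I_(d r)), (k < l)%N ->
     measurable_fun setT (fun w => v r k l w i 0))
  (v_independent : forall r, mutually_independent (P r) (@edge r)
     (fun kl => sigma_gen setT (fun (i : 'I_(d r)) w => v r kl.1 kl.2 w i 0)))
  (xi_v_independent : forall r, independent2 (P r)
     (sigma_gen [set kl : 'I_r * 'I_r | (kl.1 < kl.2)%N]
        (fun kl => xi r kl.1 kl.2))
     (sigma_gen [set q : ('I_r * 'I_r) * 'I_(d r) | (q.1.1 < q.1.2)%N]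
        (fun q w => v r q.1.1 q.1.2 w q.2 0)))
  (v_isotropic : forall r (k l : 'I_r), (k < l)%N -> forall i j : 'I_(d r),
     'E_(P r)[fun w => (v r k l w *m (v r k l w)^T) i j]%E
       = (((d r)%:R^-1)%:M i j : R)%:E)
  (v_bounded : exists C0 : R, 0 < C0 /\
     forall r (k l : 'I_r), (k < l)%N ->
       {ae P r, forall w, norm2 (v r k l w) ^+ 2 <= C0})
  (v_variance : forall D : forall n, 'M[R]_n,
     (forall n, (0 < n)%N -> opnorm (D n) = 1) ->
     ereal_sup [set 'V_(P r)[fun w =>
                       dotv (D (d r) *m v r kl.1 kl.2 w) (v r kl.1 kl.2 w)]%E
               | kl in [set kl : 'I_r * 'I_r | (kl.1 < kl.2)%N]]
       @[r --> \oo] --> 0%E)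
  (d_infty : d r @[r --> \oo] --> \oo)
  (c_ge0 : 0 <= c)
  (rpd_cvg : r%:R * p r / (d r)%:R @[r --> \oo] --> c) :
  exists NL : probability (measurableTypeR R) R,
    (forall A : set (measurableTypeR R), measurable A ->
       NL A = ((Num.max (1 - c / 2) 0)%R%:E * \d_(0%R : measurableTypeR R) A
               + \int[lebesgue_measure]_(x in A) (rho c x)%:E)%E) /\
    cvg_in_probability_weakly P
      (fun r w => esd (laplacian_mx (fun k l => xi r k l w)
                                    (fun k l => v r k l w))) NL.
Proof.
have [N [NE NS]] := @limit_law_exists R c c_ge0.
exists N; split => [A _|]; first exact: NE.
have [C0 [C0_gt0 vb]] := v_bounded.
exact: (esd_cvg_in_probability d_gt0 p_range xi_measurable xi_law xi_independent v_measurable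
  v_independent xi_v_independent v_isotropic (ltW C0_gt0) vb v_variance d_infty c_ge0
  rpd_cvg NE NS).
Qed.
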